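(* Let $1<p<\infty$, let $\Omega\subset\mathbb{R}^N$ be a bounded open set (no regularity of $\partial\Omega$ is assumed), and let $\{a_\varepsilon\}_{\varepsilon>0}$, $a_\varepsilon\colon\Omega\times\mathbb{R}^N\to\mathbb{R}^N$, be a family satisfying the structure conditions (as defined in the context) with constants independent of $\varepsilon$. Assume that the operators $-\operatorname{div}(a_\varepsilon(x,\nabla u))$ $G$-converge, as $\varepsilon\downarrow0$, to $-\operatorname{div}(a(x,\nabla u))$. Let $\rho_\varepsilon\in L^\infty(\Omega)$ have nontrivial positive and negative parts and suppose $\rho_\varepsilon\rightharpoonup\rho$ weakly* in $L^\infty(\Omega)$ as $\varepsilon\downarrow0$. For $k\ge1$ let $\lambda_{k,\varepsilon}^+$ denote the $k$-th positive variational eigenvalue associated with $a_\varepsilon$ and the weight $\rho_\varepsilon$ in $\Omega$. Then, for every $k\ge 1$: (i) if $\rho^+=0$ (that is, $\rho\le0$ a.e. in $\Omega$), then $\lambda_{k,\varepsilon}^+\to\infty$ as $\varepsilon\downarrow0$; (ii) if $\rho^+\ne0$, then $\lambda_{k,\varepsilon}^+\to\lambda_k^+$ as $\varepsilon\downarrow0$, where $\lambda_k^+$ is the $k$-th positive variational eigenvalue associated with $a$ and the weight $\rho$ in $\Omega$.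
   Context: Structure conditions. A function $a\colon\Omega\times\mathbb{R}^N\to\mathbb{R}^N$ satisfies the structure conditions with constants $\alpha,\beta,c>0$ if, for a.e. $x\in\Omega$ and all $\xi,\xi_1,\xi_2,\dots\in\mathbb{R}^N$, with $\Psi(x,\xi_1,\xi_2)=a(x,\xi_1)\cdot\xi_1+a(x,\xi_2)\cdot\xi_2$, $\delta=\min\{p/2,p-1\}$ and $\gamma=\max\{2,p\}$: - $a$ is a Carathéodory function ($a(x,\cdot)$ continuous for a.e. $x$, $a(\cdot,\xi)$ measurable for every $\xi$); - monotonicity: $0\le(a(x,\xi_1)-a(x,\xi_2))\cdot(\xi_1-\xi_2)$; - coercivity: $\alpha|\xi|^p\le a(x,\xi)\cdot\xi$; - continuity: $|a(x,\xi)|\le\beta|\xi|^{p-1}$; - homogeneity: $a(x,t\xi)=t^{p-1}a(x,\xi)$ for every $t>0$; - oddness: $a(x,-\xi)=-a(x,\xi)$; - equi-continuity: $|a(x,\xi_1)-a(x,\xi_2)|\le c\,\Psi(x,\xi_1,\xi_2)^{(p-1-\delta)/p}\big((a(x,\xi_1)-a(x,\xi_2))\cdot(\xi_1-\xi_2)\big)^{\delta/p}$; - cyclical monotonicity: $\sum_{i=1}^k a(x,\xi_i)\cdot(\xi_{i+1}-\xi_i)\le0$ for all $k\ge1$ and $\xi_1,\dots,\xi_{k+1}$ with $\xi_{k+1}=\xi_1$; - strict monotonicity: $\alpha|\xi_1-\xi_2|^\gamma\,\Psi(x,\xi_1,\xi_2)^{1-\gamma/p}\le(a(x,\xi_1)-a(x,\xi_2))\cdot(\xi_1-\xi_2)$.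 Potential. For such $a$ there is a unique Carathéodory function $\Phi(x,\xi)$, even, $p$-homogeneous, strictly convex and differentiable in $\xi$, with $\nabla_\xi\Phi(x,\xi)=p\,a(x,\xi)$ and $\Phi(x,0)=0$; it satisfies $\alpha|\xi|^p\le\Phi(x,\xi)\le\beta|\xi|^p$. $G$-convergence. The operators $-\operatorname{div}(a_\varepsilon(x,\nabla u))$ $G$-converge to $-\operatorname{div}(a(x,\nabla u))$ if for every $f\in W^{-1,p'}(\Omega)$ ($p'=p/(p-1)$) and every $f_\varepsilon\to f$ strongly in $W^{-1,p'}(\Omega)$, the solutions $u^\varepsilon\in W^{1,p}_0(\Omega)$ of $-\operatorname{div}(a_\varepsilon(x,\nabla u^\varepsilon))=f_\varepsilon$ satisfy $u^\varepsilon\rightharpoonup u$ weakly in $W_0^{1,p}(\Omega)$ and $a_\varepsilon(x,\nabla u^\varepsilon)\rightharpoonup a(x,\nabla u)$ weakly in $(L^{p'}(\Omega))^N$, where $u\in W_0^{1,p}(\Omega)$ solves $-\operatorname{div}(a(x,\nabla u))=f$. It is known that the $G$-limit $a$ of a family satisfying the structure conditions (with uniform constants) again satisfies the structure conditions, so its potential is defined. Variational eigenvalues. For $a$ satisfying the structure conditions, with potential $\Phi$, and $\rho\in L^\infty(\Omega)$ with $\rho^+\ne0$, the $k$-th positive variational eigenvalue of $-\operatorname{div}(a(x,\nabla u))=\lambda\rho|u|^{p-2}u$ in $\Omega$, $u=0$ on $\partial\Omega$, is $$\lambda_k^+=\inf_{C\in\mathcal{C}_k}\ \sup_{v\in C}\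 \frac{\int_\Omega\Phi(x,\nabla v)\,dx}{\int_\Omega\rho|v|^p\,dx},$$ where $\mathcal{C}_k$ is the family of compact symmetric ($C=-C$) subsets $C$ of $M^+=\{u\in W_0^{1,p}(\Omega):\int_\Omega\rho|u|^p\,dx>0\}$ with $\gamma(C)\ge k$, and $\gamma(A)=\min\{k\in\mathbb{N}:\text{there is an odd continuous } f\colon A\to\mathbb{R}^k\setminus\{0\}\}$ ($\infty$ if there is none) is the Krasnoselskii genus. *)

(* Defs.v *)
From HB Require Import structures.
From mathcomp Require Import all_boot all_order all_algebra.
From mathcomp Require Import all_classical all_reals all_analysis.
From mathcomp Require Import measurable_realfun ess_sup_inf.

Set Implicit Arguments.
Unset Strict Implicit.
Unset Printing Implicit Defensive.

Import Order.TTheory GRing.Theory Num.Theory.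
Import numFieldNormedType.Exports.

Local Open Scope classical_set_scope.
Local Open Scope ring_scope.

(* The Borel sigma-algebra of R^n (generated by the coordinates). *)
Definition measure_rV_display : measure_display -> measure_display.
Proof. exact. Qed.

Section measurable_rV.
Context (R : realType) (n : nat).

Let coor (i : 'I_n) (x : 'rV[R]_n) : measurableTypeR R := x 0 i.

Let rV_set0 : g_sigma_preimage coor set0.
Proof. exact: sigma_algebra0. Qed.

Let rV_setC A : g_sigma_preimage coor A -> g_sigma_preimage coor (~` A).
Proof. exact: sigma_algebraC. Qed.

Let rV_bigcup (F : _^nat) : (forall i, g_sigma_preimage coor (F i)) ->
  g_sigma_preimage coor (\bigcup_i F i).
Proof. exact: sigma_algebra_bigcup. Qed.

HB.instance Definition _ := @isMeasurable.Build
  (measure_rV_display default_measure_display)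
  'rV[R]_n (g_sigma_preimage coor) rV_set0 rV_setC rV_bigcup.

End measurable_rV.

Lemma measurable_coor (R : realType) n (i : 'I_n) :
  measurable_fun [set: 'rV[R]_n] (fun x => x 0 i).
Proof.
move=> _ Y mY; rewrite setTI; apply: sub_sigma_algebra => /=.
rewrite -bigcup_seq/=; exists i => /=; first by rewrite mem_index_enum.
by exists Y => //; rewrite setTI.
Qed.

Lemma measurable_fun_coorP (R : realType) d (T : measurableType d) n
    (f : T -> 'rV[R]_n) :
  (forall i, measurable_fun [set: T] (fun t => f t 0 i)) ->
  measurable_fun [set: T] f.
Proof.
move=> mf _ Y mY; rewrite setTI.
pose S : set (set 'rV[R]_n) := [set A | measurable (f @^-1` A)].
have sS : sigma_algebra setT S.
  split=> [|A SA|F SF]; rewrite /S/=.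
  - by rewrite preimage_set0.
  - by rewrite setTD preimage_setC; exact: measurableC.
  - by rewrite preimage_bigcup; exact: bigcupT_measurable.
suff : measurable `<=` S by apply.
apply: smallest_sub => //.
move=> A; rewrite -bigcup_seq/= => -[i _ [B mB <-]].
by rewrite /S/= setTI; have := mf i measurableT B mB; rewrite setTI.
Qed.

Lemma open_measurable_rV (R : realType) n (A : set 'rV[R]_n) :
  open A -> measurable A.
Proof.
move=> oA.
pose box (q : {ffun 'I_n -> rat} * nat) : set 'rV[R]_n :=
  [set x | forall i, ball (ratr (q.1 i) : R) (q.2.+1%:R^-1) (x 0 i)].
have mbox q : measurable (box q).
  have -> : box q = \big[setI/setT]_(i < n)
      ((fun x : 'rV[R]_n => x 0 i) @^-1` ball (ratr (q.1 i) : R) q.2.+1%:R^-1).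
    rewrite -bigcap_seq; apply/seteqP; split => [x xq i _|x xq i]; first exact: xq.
    by apply: xq => /=; rewrite mem_index_enum.
  apply: bigsetI_measurable => i _.
  rewrite -[X in measurable X]setTI; apply: measurable_coor => //.
  exact: measurable_ball.
have -> : A = \bigcup_(q in [set q | box q `<=` A]) box q.
  apply/seteqP; split => [x Ax|x [q /= + ]]; last exact.
  have /nbhs_ballP[e /= e0 eA] : nbhs x A by exact: open_nbhs_nbhs.
  have [k ke] : exists k : nat, k.+1%:R^-1 < e / 2.
    exists (Num.truncn (e / 2)^-1).
    rewrite -[ltRHS]invrK ltf_pV2 ?posrE ?invr_gt0 ?divr_gt0//.
    exact: truncnS_gt.
  have k0 : 0 < k.+1%:R^-1 :> R by rewrite invr_gt0.
  have /choice[q qP] : forall i, exists q : rat,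
      ball (x 0 i) k.+1%:R^-1 (ratr q : R).
    move=> i; have [|q qP] := @rat_in_itvoo R (x 0 i) (x 0 i + k.+1%:R^-1).
      by rewrite ltrDl.
    exists q; rewrite /ball/= ltr_distlC; move: qP; rewrite in_itv/= => /andP[h ->].
    by rewrite andbT (lt_trans _ h)// ltrBlDr ltrDl.
  exists ([ffun i => q i], k) => /=.
    move=> y qy; apply: eA; rewrite /ball/=; split => // i j.
    rewrite ord1 (splitr e); apply: (@ball_triangle _ _ (ratr (q j) : R)).
      by apply: le_ball (qP j); exact: ltW.
    by have := qy j; rewrite ffunE; apply: le_ball; exact: ltW.
  by move=> i; rewrite ffunE; exact/ball_sym/qP.
rewrite bigcup_mkcond; apply: countable_bigcupT_measurable => // q.
by case: ifPn.
Qed.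

(* Lebesgue measure on R^n: the n-fold product of the Lebesgue measure on R. *)
Definition rV_cons (R : realType) n (z : measurableTypeR R * 'rV[R]_n) :
  'rV[R]_n.+1 := row_mx (z.1%:M : 'M[R]_1) z.2.

Definition rV_uncons (R : realType) n (x : 'rV[R]_n.+1) :
  measurableTypeR R * 'rV[R]_n := (x 0 ord0, \row_i x 0 (lift ord0 i)).

Lemma rV_consE0 (R : realType) n (z : measurableTypeR R * 'rV[R]_n) :
  rV_cons z 0 ord0 = z.1.
Proof.
rewrite /rV_cons.
have -> : ord0 = lshift n (ord0 : 'I_1) :> 'I_(1 + n) by exact/val_inj.
by rewrite (row_mxEl (z.1%:M : 'M[R]_1)) mxE eqxx mulr1n.
Qed.

Lemma rV_consES (R : realType) n (z : measurableTypeR R * 'rV[R]_n) i :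
  rV_cons z 0 (lift ord0 i) = z.2 0 i.
Proof.
rewrite /rV_cons.
have -> : lift ord0 i = rshift 1 i :> 'I_(1 + n) by exact/val_inj.
by rewrite (row_mxEr (z.1%:M : 'M[R]_1)).
Qed.

Lemma rV_consK (R : realType) n : cancel (@rV_cons R n) (@rV_uncons R n).
Proof.
move=> z; rewrite /rV_uncons rV_consE0 [RHS]surjective_pairing; congr pair.
by apply/rowP => i; rewrite mxE rV_consES.
Qed.

Lemma rV_unconsK (R : realType) n : cancel (@rV_uncons R n) (@rV_cons R n).
Proof.
move=> x; apply/rowP => i; case: (unliftP ord0 i) => [j ->|->].
  by rewrite rV_consES mxE.
by rewrite rV_consE0.
Qed.

Lemma measurable_rV_cons (R : realType) n :
  measurable_fun setT (@rV_cons R n).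
Proof.
apply: measurable_fun_coorP => i; case: (unliftP ord0 i) => [j ->|->].
  under eq_fun do rewrite rV_consES.
  exact: (measurableT_comp (@measurable_coor R n j) measurable_snd).
under eq_fun do rewrite rV_consE0.
exact: measurable_fst.
Qed.

Lemma measurable_rV_uncons (R : realType) n :
  measurable_fun setT (@rV_uncons R n).
Proof.
apply/measurable_fun_pairP; split; first exact: measurable_coor.
apply: measurable_fun_coorP => i; under eq_fun do rewrite /= mxE.
exact: measurable_coor.
Qed.

Definition lebesgue_cons (R : realType) n
    (m : {sigma_finite_measure set 'rV[R]_n -> \bar R}) :
    set 'rV[R]_n.+1 -> \bar R :=
  pushforward ((@lebesgue_measure R) \x m)%E (@rV_cons R n).

Section lebesgue_cons.
Context (R : realType) (n : nat).
Variable m : {sigma_finite_measure set 'rV[R]_n -> \bar R}.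
Local Open Scope ereal_scope.
Local Notation prod := ((@lebesgue_measure R) \x m).

Let cons0 : lebesgue_cons m set0 = 0.
Proof. by rewrite /lebesgue_cons /pushforward preimage_set0 measure0. Qed.

Let cons_ge0 A : 0 <= lebesgue_cons m A.
Proof. by rewrite /lebesgue_cons /pushforward; exact: measure_ge0. Qed.

Let cons_sigma_additive : semi_sigma_additive (lebesgue_cons m).
Proof.
move=> F mF tF mUF; rewrite /lebesgue_cons /pushforward preimage_bigcup.
apply: measure_semi_sigma_additive.
- by move=> i; rewrite -[X in measurable X]setTI; exact: measurable_rV_cons.
- apply/trivIsetP => /= i j _ _ ij; rewrite -preimage_setI.
  by move/trivIsetP : tF => /(_ _ _ _ _ ij) ->//; rewrite preimage_set0.
- rewrite -preimage_bigcup -[X in measurable X]setTI.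
  exact: measurable_rV_cons.
Qed.

HB.instance Definition _ := isMeasure.Build _ _ _ (lebesgue_cons m)
  cons0 cons_ge0 cons_sigma_additive.

Let cons_sigma_finite : sigma_finite setT (lebesgue_cons m).
Proof.
have [F FT Foo] : sigma_finite setT prod.
  have /sigma_finiteP[F [TF ndF Foo]] := sigma_finiteT (@lebesgue_measure R).
  have /sigma_finiteP[G [TG ndG Goo]] := sigma_finiteT m.
  exists (fun k => F k `*` G k).
    rewrite -setXTT TF TG predeqE => -[x y]; split.
      move=> [/= [i _ Fix] [j _ Gjy]]; exists (maxn i j) => //; split.
      - by move: x Fix; exact/subsetPset/ndF/leq_maxl.
      - by move: y Gjy; exact/subsetPset/ndG/leq_maxr.
    by move=> [i _ []/= ? ?]; split; exists i.
  move=> k; have [? ?] := Foo k; have [? ?] := Goo k.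
  split; first exact: measurableX.
  by rewrite product_measure1E// lte_mul_pinfty// ge0_fin_numE.
exists (fun k => @rV_uncons R n @^-1` F k).
  by rewrite -preimage_bigcup -FT preimage_setT.
move=> k; have [mF Fk] := Foo k; split.
  by rewrite -[X in measurable X]setTI; exact: measurable_rV_uncons.
rewrite /lebesgue_cons /pushforward.
rewrite (_ : _ @^-1` _ = F k)//; apply/seteqP.
by split => z /=; rewrite rV_consK.
Qed.

HB.instance Definition _ := Measure_isSigmaFinite.Build _ _ _ (lebesgue_cons m)
  cons_sigma_finite.

End lebesgue_cons.

Fixpoint lebesgue_rV (R : realType) (n : nat) :
    {sigma_finite_measure set 'rV[R]_n -> \bar R} :=
  match n with
  | 0 => @dirac _ 'rV[R]_0 0 R
  | n'.+1 => lebesgue_cons (lebesgue_rV R n')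
  end.

Definition lebesgue_on (R : realType) (n : nat) (O : set 'rV[R]_n)
    (oO : open O) : {measure set 'rV[R]_n -> \bar R} :=
  mrestr (lebesgue_rV R n) (open_measurable_rV oO).

(* The library norm of 'rV[R]_n is the sup norm. *)
Definition dotr (R : realType) n (x y : 'rV[R]_n) : R :=
  \sum_i x 0 i * y 0 i.
Definition enorm (R : realType) n (x : 'rV[R]_n) : R := Num.sqrt (dotr x x).

Definition partial (R : realType) n (i : 'I_n) (f : 'rV[R]_n -> R)
    (x : 'rV[R]_n) : R :=
  'D_(delta_mx 0 i) f x.

Fixpoint is_Ck (R : realType) n (k : nat) (f : 'rV[R]_n -> R) : Prop :=
  match k with
  | 0 => continuous f
  | k'.+1 => (forall x, differentiable f x) /\
             forall i, is_Ck k' (partial i f)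
  end.

Definition support (R : realType) n (f : 'rV[R]_n -> R) : set 'rV[R]_n :=
  closure [set x | f x != 0].

Definition test_function (R : realType) n (O : set 'rV[R]_n)
    (f : 'rV[R]_n -> R) : Prop :=
  [/\ forall k, is_Ck k f, compact (support f) & support f `<=` O].

Lemma partialZD (R : realType) n (i : 'I_n) (f g : 'rV[R]_n -> R) (a : R) :
  (forall x, differentiable f x) -> (forall x, differentiable g x) ->
  partial i (fun x => a * f x + g x) =
  (fun x => a * partial i f x + partial i g x).
Proof.
move=> df dg; apply/funext => x; rewrite /partial.
have dfi : derivable f x (delta_mx 0 i) by exact: diff_derivable.
have dgi : derivable g x (delta_mx 0 i) by exact: diff_derivable.
rewrite (_ : (fun _ => _) = a *: f + g); last exact/funext.
rewrite (deriveD (@derivableZ _ _ _ f a _ _ dfi) dgi).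
by rewrite (deriveZ a dfi).
Qed.

Lemma is_CkZD (R : realType) n k (f g : 'rV[R]_n -> R) (a : R) :
  is_Ck k f -> is_Ck k g -> is_Ck k (fun x => a * f x + g x).
Proof.
elim: k f g => [|k IH] f g /=.
  move=> cf cg x; apply: (@continuousD _ _ _ (fun x => a * f x)); last exact: cg.
  exact: (continuousM (@cst_continuous _ _ a x) (cf x)).
move=> [df pf] [dg pg]; split => [x|i].
  rewrite (_ : (fun _ => _) = a *: f + g); last exact/funext.
  by apply: differentiableD => //; exact: differentiableZ.
by rewrite partialZD//; exact: IH.
Qed.

Lemma is_Ck0 (R : realType) n k : is_Ck k (cst 0 : 'rV[R]_n -> R).
Proof.
elim: k => [|k IH] /=; first exact: cst_continuous.
split => [x|i]; first exact: differentiable_cst.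
rewrite (_ : partial i _ = cst 0)//; apply/funext => x.
by rewrite /partial derive_cst.
Qed.

Lemma test_functionZD (R : realType) n (O : set 'rV[R]_n)
    (f g : 'rV[R]_n -> R) (a : R) :
  test_function O f -> test_function O g ->
  test_function O (fun x => a * f x + g x).
Proof.
move=> [sf cf Of] [sg cg Og].
have sub : support (fun x => a * f x + g x) `<=` support f `|` support g.
  rewrite /support -closureU; apply: closure_subset => x /=.
  have [->|] := eqVneq (f x) 0; last by left.
  by rewrite mulr0 add0r; right.
split; first by move=> k; exact: is_CkZD.
  apply: subclosed_compact sub; first exact: closed_closure.
  exact: compactU.
by apply: (subset_trans sub) => x []; [exact: Of|exact: Og].
Qed.

Lemma test_function0 (R : realType) n (O : set 'rV[R]_n) :
  test_function O (cst 0).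
Proof.
have s0 : support (cst 0 : 'rV[R]_n -> R) = set0.
  rewrite /support (_ : [set _ | _] = set0) ?closure0//.
  by apply/seteqP; split => // x /=; rewrite eqxx.
split; [by move=> k; exact: is_Ck0|rewrite s0; exact: compact0|].
by rewrite s0; exact: sub0set.
Qed.

Lemma lt1_le1E (R : realType) (p : R) : 1 < p -> (1 <= p%:E)%E.
Proof. by move=> p1; rewrite lee_fin ltW. Qed.

Section sobolev.
Context (R : realType) (n : nat) (O : set 'rV[R]_n) (oO : open O).
Context (p : R) (p1 : 1 < p).

Local Notation mu := (lebesgue_on oO).
Local Notation Lp := (LfunType mu (lt1_le1E p1)).

(* Pairs (u, (G_i)_i) of p-integrable functions. *)
Definition Lp_graph : Type := (Lp * {ffun 'I_n -> Lp})%type.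
HB.instance Definition _ := GRing.Lmodule.on Lp_graph.

Definition graph_fun (w : Lp_graph) : 'rV[R]_n -> R := w.1.
Definition graph_grad (w : Lp_graph) (i : 'I_n) : 'rV[R]_n -> R := w.2 i.

Definition graph_norm (w : Lp_graph) : R :=
  fine 'N[mu]_p%:E[EFin \o graph_fun w] +
  \sum_i fine 'N[mu]_p%:E[EFin \o graph_grad w i].

Definition test_graph : set Lp_graph :=
  [set w | exists2 f, test_function O f &
     graph_fun w =1 f /\ forall i, graph_grad w i =1 partial i f].

(* W_0^{1,p}(O) is the closure of C_c^oo(O) for the W^{1,p} norm; an element
   is represented by u together with its weak gradient (G_i)_i. *)
Definition in_sobolev0 : {pred Lp_graph} :=
  mem [set w : Lp_graph | forall e : R, 0 < e ->
    exists2 t, test_graph t & graph_norm (w - t) < e].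

Lemma graph_normD (w z : Lp_graph) :
  graph_norm (w + z) <= graph_norm w + graph_norm z.
Proof.
rewrite /graph_norm /graph_grad addrACA -big_split/=; apply: lerD; first exact: ler_LnormD.
by apply: ler_sum => i _; rewrite ffunE; exact: ler_LnormD.
Qed.

Lemma graph_normZ (a : R) (w : Lp_graph) :
  graph_norm (a *: w) = `|a| * graph_norm w.
Proof.
have fZ (f : Lp) : fine 'N[mu]_p%:E[EFin \o (a *: f : Lp)] =
    `|a| * fine 'N[mu]_p%:E[EFin \o f].
  apply: EFin_inj; rewrite EFinM !finite_norm_fine -LnormZ.
  by congr Lnorm.
rewrite /graph_norm /graph_grad fZ mulrDr mulr_sumr; congr (_ + _).
by apply: eq_bigr => i _; rewrite ffunE fZ.
Qed.

Lemma graph_norm0 : graph_norm 0 = 0.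
Proof. by rewrite -(scale0r 0) graph_normZ normr0 mul0r. Qed.

Lemma graph_normN w : graph_norm (- w) = graph_norm w.
Proof. by rewrite -scaleN1r graph_normZ normrN1 mul1r. Qed.

Lemma graph_norm_ge0 w : 0 <= graph_norm w.
Proof.
rewrite /graph_norm addr_ge0 ?sumr_ge0// => *; exact/fine_ge0/Lnorm_ge0.
Qed.

Lemma in_sobolev0_submod_closed : submod_closed in_sobolev0.
Proof.
split.
  rewrite inE/= => e e0; exists 0; last by rewrite subr0 graph_norm0.
  exists (cst 0); first exact: test_function0.
  split => // i x; rewrite /graph_grad ffunE.
  by rewrite /partial derive_cst.
move=> a w z /set_mem hw /set_mem hz; apply/mem_set => e e0.
have a0 : 0 < `|a| + 1 by rewrite ltr_wpDl.
have [t [f tf [tf1 tf2]] wt] := hw (e / 2 / (`|a| + 1))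
  (divr_gt0 (divr_gt0 e0 (ltr0n _ 2)) a0).
have [s [g tg [sg1 sg2]] zs] := hz (e / 2) (divr_gt0 e0 (ltr0n _ 2)).
exists (a *: t + s).
  exists (fun x => a * f x + g x); first exact: test_functionZD.
  split => [x|i x]; first by rewrite -tf1 -sg1.
  rewrite partialZD -?tf2 -?sg2 /graph_grad ?ffunE//.
  - by have [/(_ 1%N)[]] := tf.
  - by have [/(_ 1%N)[]] := tg.
rewrite (_ : _ - _ = a *: (w - t) + (z - s)); last first.
  by rewrite scalerBr opprD addrACA.
apply: (le_lt_trans (graph_normD _ _)).
rewrite graph_normZ (splitr e) ler_ltD//.
rewrite (@le_trans _ _ ((`|a| + 1) * graph_norm (w - t)))//.
  by rewrite ler_wpM2r ?graph_norm_ge0// lerDl.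
by rewrite mulrC -ler_pdivlMr// ltW.
Qed.

HB.instance Definition _ := GRing.isSubmodClosed.Build R Lp_graph in_sobolev0
  in_sobolev0_submod_closed.

Record sobolev0 : Type := Sobolev0 {
  sobolev0_graph : Lp_graph ;
  _ : sobolev0_graph \in in_sobolev0 }.

HB.instance Definition _ := [isSub for sobolev0_graph].
HB.instance Definition _ := gen_eqMixin sobolev0.
HB.instance Definition _ := gen_choiceMixin sobolev0.
HB.instance Definition _ := [SubChoice_isSubLmodule of sobolev0 by <:].

Definition sobolev0_fun (u : sobolev0) : 'rV[R]_n -> R := graph_fun (\val u).

Definition grad (u : sobolev0) (x : 'rV[R]_n) : 'rV[R]_n :=
  \row_i graph_grad (\val u) i x.

Definition sobolev0_norm (u : sobolev0) : R := graph_norm (\val u).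

(* The W^{1,p} pseudometric: functions equal a.e. are at distance 0, so that
   the separated quotient is the usual Banach space W_0^{1,p}(O). *)
Definition sobolev0_ball : sobolev0 -> R -> set sobolev0 :=
  ball_ sobolev0_norm.

Let ball_center u (e : R) : 0 < e -> sobolev0_ball u e u.
Proof.
by rewrite /sobolev0_ball/= subrr /sobolev0_norm raddf0 graph_norm0.
Qed.

Let ball_sym u v (e : R) : sobolev0_ball u e v -> sobolev0_ball v e u.
Proof.
by rewrite /sobolev0_ball/= -opprB /sobolev0_norm raddfN/= graph_normN.
Qed.

Let ball_triangle u v w (d e : R) : sobolev0_ball u d v ->
  sobolev0_ball v e w -> sobolev0_ball u (d + e) w.
Proof.
rewrite /sobolev0_ball/= => uv vw.
rewrite -(subrK v u) -addrA /sobolev0_norm raddfD/=.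
exact: le_lt_trans (graph_normD _ _) (ltrD uv vw).
Qed.

HB.instance Definition _ := hasNbhs.Build sobolev0
  (nbhs_ (entourage_ sobolev0_ball)).
HB.instance Definition _ := @Nbhs_isPseudoMetric.Build R sobolev0
  (entourage_ sobolev0_ball) erefl sobolev0_ball
  ball_center ball_sym ball_triangle erefl.

End sobolev.

Section eigenvalue_problem.
Context (R : realType) (n : nat) (O : set 'rV[R]_n) (oO : open O).
Context (p : R) (p1 : 1 < p).

Local Notation E := 'rV[R]_n.
Local Notation mu := (lebesgue_on oO).
Local Notation W := (sobolev0 oO p1).
Local Notation p' := (p / (p - 1)).

(* Lebesgue measurability: equality a.e. with a Borel function. *)
Definition ae_measurable (f : E -> R) : Prop :=
  exists2 g : E -> R, measurable_fun setT g & {ae mu, forall x, f x = g x}.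

Definition in_Lspace (q : \bar R) (f : E -> R) : Prop :=
  ae_measurable f /\ finite_norm mu q f.

Definition caratheodory (F : E -> E -> R) : Prop :=
  {ae mu, forall x, continuous (F x)} /\
  forall xi, ae_measurable (fun x => F x xi).

Record structure_conditions (a : E -> E -> E) (alpha beta c : R) : Prop := {
  sc_pos : [/\ 0 < alpha, 0 < beta & 0 < c] ;
  sc_caratheodory : forall i, caratheodory (fun x xi => a x xi 0 i) ;
  sc_monotone : {ae mu, forall x, forall xi1 xi2,
    0 <= dotr (a x xi1 - a x xi2) (xi1 - xi2)} ;
  sc_coercive : {ae mu, forall x, forall xi,
    alpha * enorm xi `^ p <= dotr (a x xi) xi} ;
  sc_bounded : {ae mu, forall x, forall xi,
    enorm (a x xi) <= beta * enorm xi `^ (p - 1)} ;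
  sc_homogeneous : {ae mu, forall x, forall xi t, 0 < t ->
    a x (t *: xi) = t `^ (p - 1) *: a x xi} ;
  sc_odd : {ae mu, forall x, forall xi, a x (- xi) = - a x xi} ;
  sc_equicontinuous : {ae mu, forall x, forall xi1 xi2,
    let delta := Num.min (p / 2) (p - 1) in
    let Psi := dotr (a x xi1) xi1 + dotr (a x xi2) xi2 in
    enorm (a x xi1 - a x xi2) <=
      c * Psi `^ ((p - 1 - delta) / p) *
      dotr (a x xi1 - a x xi2) (xi1 - xi2) `^ (delta / p)} ;
  sc_cyclically_monotone : {ae mu, forall x, forall (k : nat) (xi : nat -> E),
    (0 < k)%N -> xi k = xi 0%N ->
    \sum_(i < k) dotr (a x (xi i)) (xi i.+1 - xi i) <= 0} ;
  sc_strictly_monotone : {ae mu, forall x, forall xi1 xi2,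
    let gamma := Num.max 2 p in
    let Psi := dotr (a x xi1) xi1 + dotr (a x xi2) xi2 in
    alpha * enorm (xi1 - xi2) `^ gamma * Psi `^ (1 - gamma / p) <=
      dotr (a x xi1 - a x xi2) (xi1 - xi2)}
}.

Record is_potential (a : E -> E -> E) (Phi : E -> E -> R) : Prop := {
  pot_caratheodory : caratheodory Phi ;
  pot_even : {ae mu, forall x, forall xi, Phi x (- xi) = Phi x xi} ;
  pot_homogeneous : {ae mu, forall x, forall xi t,
    Phi x (t *: xi) = `|t| `^ p * Phi x xi} ;
  pot_strictly_convex : {ae mu, forall x, forall xi1 xi2 t,
    xi1 != xi2 -> 0 < t < 1 ->
    Phi x (t *: xi1 + (1 - t) *: xi2) < t * Phi x xi1 + (1 - t) * Phi x xi2} ;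
  pot_gradient : {ae mu, forall x, forall xi,
    differentiable (Phi x) xi /\
    forall i, partial i (Phi x) xi = p * a x xi 0 i} ;
  pot_0 : {ae mu, forall x, Phi x 0 = 0}
}.

(* The potential of a, unique up to a null set of x. *)
Definition potential (a : E -> E -> E) : E -> E -> R :=
  get [set Phi | is_potential a Phi].

(* W^{-1,p'}(O) is the set of continuous linear forms on W_0^{1,p}(O). *)
Definition dual_sobolev : set {linear W -> R^o} :=
  [set f | continuous (f : W -> R^o)].

Definition dual_norm (f : W -> R) : \bar R :=
  ereal_sup [set `|f v|%:E | v in [set v : W | sobolev0_norm v <= 1]].

Definition dual_strong_cvg (f_ : R -> {linear W -> R^o})
    (f : {linear W -> R^o}) : Prop :=
  dual_norm (fun v => f_ e v - f v) @[e --> 0^'+] --> 0%E.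

Definition sobolev0_weak_cvg (u_ : R -> W) (u : W) : Prop :=
  forall g : {linear W -> R^o}, dual_sobolev g ->
    g (u_ e) @[e --> 0^'+] --> g u.

Definition vLspace (q : R) (F : E -> E) : Prop :=
  forall i, in_Lspace q%:E (fun x => F x 0 i).

(* Weak convergence in (L^p')^n, tested against its dual (L^p)^n. *)
Definition vLspace_weak_cvg (F_ : R -> E -> E) (F : E -> E) : Prop :=
  forall G : E -> E, vLspace p G ->
    (\int[mu]_x dotr (F_ e x) (G x))%R @[e --> 0^'+] -->
    (\int[mu]_x dotr (F x) (G x))%R.

Definition flux (a : E -> E -> E) (u : W) : E -> E := fun x => a x (grad u x).

(* u solves -div(a(x, grad u)) = f. *)
Definition weak_solution (a : E -> E -> E) (f : {linear W -> R^o})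
    (u : W) : Prop :=
  vLspace p' (flux a u) /\
  forall v : W, (\int[mu]_x dotr (flux a u x) (grad v x))%R = f v.

Definition G_cvg (a_ : R -> E -> E -> E) (a : E -> E -> E) : Prop :=
  forall (f : {linear W -> R^o}) (f_ : R -> {linear W -> R^o}) (u_ : R -> W),
    dual_sobolev f -> (forall e, 0 < e -> dual_sobolev (f_ e)) ->
    dual_strong_cvg f_ f ->
    (forall e, 0 < e -> weak_solution (a_ e) (f_ e) (u_ e)) ->
  exists u : W, [/\ weak_solution a f u,
    sobolev0_weak_cvg u_ u &
    vLspace_weak_cvg (fun e => flux (a_ e) (u_ e)) (flux a u)].

Definition weakstar_cvg (rho_ : R -> E -> R) (rho : E -> R) : Prop :=
  forall g : E -> R, in_Lspace 1 g ->
    (\int[mu]_x (rho_ e x * g x))%R @[e --> 0^'+] -->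
    (\int[mu]_x (rho x * g x))%R.

Definition energy (Phi : E -> E -> R) (v : W) : R :=
  (\int[mu]_x Phi x (grad v x))%R.

Definition weighted_mass (rho : E -> R) (v : W) : R :=
  (\int[mu]_x (rho x * `|sobolev0_fun v x| `^ p))%R.

Definition Mplus (rho : E -> R) : set W := [set v | 0 < weighted_mass rho v].

(* The Krasnoselskii genus, with values in N u {+oo}. *)
Definition genus (A : set W) : \bar R :=
  ereal_inf [set k%:R%:E | k in [set k : nat | exists f : W -> 'rV[R]_k,
    [/\ {within A, continuous f},
        forall u, A u -> f (- u) = - f u &
        forall u, A u -> f u != 0]]].

Definition genus_class (rho : E -> R) (k : nat) : set (set W) :=
  [set C | [/\ compact C, [set - u | u in C] = C, C `<=` Mplus rho &
               (k%:R%:E <= genus C)%E]].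

Definition lambda_plus (a : E -> E -> E) (rho : E -> R) (k : nat) : \bar R :=
  ereal_inf [set
    ereal_sup [set (energy (potential a) v / weighted_mass rho v)%:E | v in C]
    | C in genus_class rho k].

End eigenvalue_problem.

(* Main.v *)
(* Write E_e u for the energy of u, which equals the pairing of
   A_e u = -div(a_e(x, grad u)) with u (Euler's identity for the p-homogeneous
   potential), and B_e u for the integral of rho_e |u|^p. Cyclic monotonicity
   makes p A_e a subgradient of E_e, and the strict monotonicity and
   equi-continuity conditions give estimates on A_e that are uniform in e. By an
   Ehrling inequality (from a Poincare inequality on small cubes) the L^p norm
   on bounded sets of W_0^{1,p} is controlled by finitely many linear forms l_i,
   so B_e converges to B uniformly on bounded sets.
   Upper bound: for an admissible compact set C of the limit problem, the odd
   map T_e = A_e^{-1} A sends C to an admissible set of the e-problem and E_e, B_e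
   on T_e(C) converge uniformly to E, B on C.
   Lower bound: the sets admissible for the e-problem are not contained in a
   common compact set, so they are sent to the limit problem by the odd map
   u |-> w solving A w = kappa sum_i l_i(u - w) l_i, whose right-hand sides lie
   in a fixed compact set of linear forms. *)
Require Import Defs.
From HB Require Import structures.
From mathcomp Require Import all_boot all_order all_algebra.
From mathcomp Require Import all_classical all_reals all_analysis.
From mathcomp Require Import measurable_realfun ess_sup_inf.
From mathcomp Require Import ring lra.

Set Implicit Arguments.
Unset Strict Implicit.
Unset Printing Implicit Defensive.

Import Order.TTheory GRing.Theory Num.Theory.
Import numFieldNormedType.Exports HBNNSimple.

Local Open Scope classical_set_scope.
Local Open Scope ring_scope.

(** * Inequalities between real powers *)

Section power_inequalities.
Context (R : realType).
Implicit Types (x y p eta : R).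

(** The estimates must not depend on [e], and the exponents in the structure conditions change form
    at [p = 2]. One device handles both: each such condition is rewritten as a bound
    [eta * (energies) + K * (small quantity)] with [eta > 0] arbitrary and [K] depending only on
    [eta] and the constants. This form is linear, so it integrates without Hoelder exponents. For a
    fixed right-hand side [f] the energies of the solutions [w_e] converge because
    [A_e w_e w_e = f w_e]: weak convergence is tested on [f] itself. Stability of solutions and
    compactness of the set of right-hand sides give uniformity. Compactness does not see the
    boundary of [Omega]: test functions, extended by zero, are treated on a grid of cubes covering
    [Omega], and the inequalities pass to W_0^{1,p} by density. The bound for the weights in L^oo,
    uniform for small [e], comes from the uniform boundedness principle. Claims (i) and (ii) are one
    convergence in the extended reals: for [rho <= 0] there are no admissible sets and the limit
    eigenvalue is [+oo]. *)

Lemma powR_le x y p : 0 <= p -> 0 <= x -> x <= y -> x `^ p <= y `^ p.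
Proof.
by move=> p0 x0 xy; apply: ge0_ler_powR => //; rewrite nnegrE ?(le_trans x0).
Qed.

Lemma powRK x p : 0 <= x -> p != 0 -> (x `^ p) `^ p^-1 = x.
Proof. by move=> x0 p0; rewrite -powRrM mulfV// powRr1. Qed.

Lemma powRVK x p : 0 <= x -> p != 0 -> (x `^ p^-1) `^ p = x.
Proof. by move=> x0 p0; rewrite -powRrM mulVf// powRr1. Qed.

Lemma powR_split x (r s : R) : 0 <= x -> 0 <= r -> 0 < s ->
  x `^ r * x `^ s = x `^ (r + s).
Proof.
move=> x0 r0 s0; rewrite powRD//; apply/implyP => /eqP rs0.
by move: (ltr_wpDl r0 s0); rewrite rs0 ltxx.
Qed.

(* Young's inequality without its sharp constant: distinguish whether
   [Z <= kappa * P]. *)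
Lemma interpolation_absorb (C theta eta : R) :
  0 <= C -> 0 <= theta < 1 -> 0 < eta ->
  exists2 K, 0 <= K & forall P Z Y, 0 <= P -> 0 <= Z ->
    Y <= C * (P `^ theta * Z `^ (1 - theta)) -> Y <= eta * P + K * Z.
Proof.
move=> C0 /andP[t0 t1] e0.
have t1' : 0 < 1 - theta by rewrite subr_gt0.
have t1n : 1 - theta != 0 by rewrite gt_eqF.
(* The threshold for which [C * k^(1 - theta) <= eta]; [C + 1] keeps the quotient meaningful and
   positive when [C = 0]. *)
pose k := (eta / (C + 1)) `^ (1 - theta)^-1.
have C1 : 0 < C + 1 by rewrite ltr_wpDl.
have k0 : 0 < k by rewrite powR_gt0// divr_gt0.
have kE : k `^ (1 - theta) = eta / (C + 1).
  by rewrite /k powRVK// ltW// divr_gt0.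
exists (C * (k^-1) `^ theta); first by rewrite mulr_ge0// powR_ge0.
move=> P Z Y P0 Z0 YPZ; apply: (le_trans YPZ).
have [ZkP|kPZ] := leP Z (k * P).
  rewrite (@le_trans _ _ (eta * P))//; last first.
    by rewrite lerDl !mulr_ge0// powR_ge0.
  rewrite (@le_trans _ _ (C * (P `^ theta * (k * P) `^ (1 - theta))))//.
    by rewrite ler_wpM2l// ler_wpM2l// ?powR_ge0// powR_le// ltW.
  rewrite powRM ?(ltW k0)// [X in C * X]mulrCA powR_split//.
  rewrite addrCA subrr addr0 powRr1// kE mulrA ler_wpM2r// mulrCA ler_piMr ?(ltW e0)//.
  by rewrite ler_pdivrMr// mul1r lerDl.
rewrite (@le_trans _ _ (C * k^-1 `^ theta * Z))//; last first.
  by rewrite lerDr mulr_ge0// ltW.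
rewrite -mulrA ler_wpM2l//.
rewrite (@le_trans _ _ ((k^-1 * Z) `^ theta * Z `^ (1 - theta)))//.
  rewrite ler_wpM2r// ?powR_ge0// powR_le//.
  by rewrite mulrC ler_pdivlMr// mulrC ltW.
rewrite powRM// ?invr_ge0 ?(ltW k0)// -mulrA powR_split//.
by rewrite addrCA subrr addr0 powRr1.
Qed.

Lemma powRD_le x y p : 0 < p -> 0 <= x -> 0 <= y ->
  (x + y) `^ p <= 2 `^ p * (x `^ p + y `^ p).
Proof.
move=> p0; wlog xy : x y / x <= y.
  move=> h x0 y0; have [xy|/ltW yx] := leP x y; first exact: h.
  by rewrite addrC (addrC (x `^ p)); exact: h.
move=> x0 y0; rewrite (@le_trans _ _ ((2 * y) `^ p))//.
  by rewrite powR_le ?(ltW p0)// ?addr_ge0// mulr_natl mulr2n lerD2r.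
by rewrite powRM// ler_wpM2l ?powR_ge0// lerDr powR_ge0.
Qed.

(** If [|x - y| <= k |y|] then [|x|^p <= (1 + k)^p |y|^p], and [k] is chosen with
    [(1 + k)^p = 1 + eta]; otherwise [|x| <= (1 + 1/k) |x - y|]. Exchanging [x] and [y] gives the
    absolute value. *)
Lemma powR_dist_le p eta : 0 < p -> 0 < eta ->
  exists2 K, 0 <= K & forall x y, `| `|x| `^ p - `|y| `^ p | <=
    eta * (`|x| `^ p + `|y| `^ p) + K * `|x - y| `^ p.
Proof.
move=> p0 e0; have pn0 : p != 0 by rewrite gt_eqF.
pose k := (1 + eta) `^ p^-1 - 1.
have k0 : 0 < k.
  rewrite subr_gt0 -[ltLHS](powRr0 (1 + eta)) /powR gt_eqF ?addr_gt0// ltr_expR.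
  by rewrite mul0r mulr_gt0 ?invr_gt0// ln_gt0// ltrDl.
have kE : (1 + k) `^ p = 1 + eta.
  by rewrite /k addrCA subrr addr0 powRVK// addr_ge0// ltW.
pose K := (1 + k^-1) `^ p; exists K; first exact: powR_ge0.
suff main x y : `|x| `^ p <= (1 + eta) * `|y| `^ p + K * `|x - y| `^ p.
  move=> x y; rewrite ler_norml; apply/andP; split.
    have := main y x; rewrite distrC.
    have := mulr_ge0 (ltW e0) (powR_ge0 `|y| p); lra.
  have := main x y.
  have := mulr_ge0 (ltW e0) (powR_ge0 `|x| p); lra.
have xy : `|x| <= `|y| + `|x - y| by rewrite -{1}(subrK y x) addrC ler_normD.
apply: (le_trans (powR_le (ltW p0) (normr_ge0 x) xy)).
have [h|h] := leP `|x - y| (k * `|y|).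
  rewrite (@le_trans _ _ (((1 + k) * `|y|) `^ p))//.
    rewrite powR_le ?(ltW p0)// ?addr_ge0//; lra.
  rewrite powRM// ?kE ?lerDl ?mulr_ge0 ?powR_ge0//.
  by rewrite addr_ge0// ltW.
rewrite (@le_trans _ _ (((1 + k^-1) * `|x - y|) `^ p))//.
  rewrite powR_le ?(ltW p0)// ?addr_ge0// mulrDl mul1r addrC lerD2l.
  by rewrite ler_pdivlMl// ltW.
rewrite powRM// ?addr_ge0// ?invr_ge0 ?(ltW k0)// lerDr mulr_ge0 ?powR_ge0//.
by rewrite addr_ge0// ltW.
Qed.

Context (p : R) (p1 : 1 < p).
Local Notation p' := (p / (p - 1)).
Let p0 : 0 < p. Proof. exact: lt_trans p1. Qed.
Let q0 : 0 < p - 1. Proof. by rewrite subr_gt0. Qed.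

(** Young's inequality with both constants equal to 1: compare [y] with [x^(1/(p-1))], the point
    where the two powers on the right coincide. *)
Lemma mul_le_powRD x y : 0 <= x -> 0 <= y -> x * y <= x `^ p' + y `^ p.
Proof.
move=> x0 y0; have [h|h] := leP y (x `^ (p - 1)^-1).
  rewrite (@le_trans _ _ (x `^ p'))// ?lerDl ?powR_ge0//.
  apply: (le_trans (ler_wpM2l x0 h)).
  have -> : p' = 1 + (p - 1)^-1 by field; rewrite gt_eqF.
  by rewrite -{1}[x]powRr1// powR_split ?invr_gt0.
rewrite (@le_trans _ _ (y `^ p))// ?lerDr ?powR_ge0//.
rewrite -[leRHS]mulr_powRB1// mulrC ler_wpM2l//.
rewrite -[leLHS](@powRVK _ (p - 1))// ?gt_eqF//.
by apply: powR_le; rewrite ?powR_ge0// ltW.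
Qed.

Lemma mul_le_powRDr eta : 0 < eta -> exists2 K, 0 <= K &
  forall x y, 0 <= x -> 0 <= y -> x * y <= K * x `^ p' + eta * y `^ p.
Proof.
move=> e0; pose s := eta `^ p^-1.
have pn : p != 0 by rewrite gt_eqF.
have s0 : 0 < s by rewrite powR_gt0.
exists (s^-1 `^ p'); first exact: powR_ge0.
move=> x y x0 y0.
have := @mul_le_powRD (s^-1 * x) (s * y).
rewrite mulrACA mulVf ?gt_eqF// mul1r !powRM// ?invr_ge0 ?(ltW s0)//.
rewrite /s (powRVK (ltW e0) pn); apply.
  by rewrite mulr_ge0// invr_ge0 powR_ge0.
by rewrite mulr_ge0// powR_ge0.
Qed.

(** Makes strict monotonicity linear in [P] and [D], where [x], [P], [D] stand for [|xi1 - xi2|],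
    [Psi] and the monotonicity product. For [p >= 2] the weight [P^0] is trivial. For [p < 2] the
    power [p/2] of the inequality reads [x^p <= alpha^(-p/2) P^(1-p/2) D^(p/2)], to which
    [interpolation_absorb] applies. *)
Lemma strict_monotone_absorb (alpha eta C : R) : 0 < alpha -> 0 < eta ->
  exists2 K, 0 <= K & forall x P D, 0 <= x -> 0 <= P -> 0 <= D ->
    x `^ p <= C * P ->
    alpha * x `^ Num.max 2 p * P `^ (1 - Num.max 2 p / p) <= D ->
    x `^ p <= eta * P + K * D.
Proof.
move=> a0 e0; have pn : p != 0 by rewrite gt_eqF.
have [p2|p2] := leP 2 p.
  exists alpha^-1; first by rewrite invr_ge0 ltW.
  move=> x P D x0 P0 D0 _; rewrite divff// subrr powRr0 mulr1 => h.
  by rewrite ler_wpDl ?mulr_ge0 ?(ltW e0)// ler_pdivlMl.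
have hp : 0 <= 1 - p / 2 < 1.
  rewrite subr_ge0 ler_pdivrMr// mul1r (ltW p2)/= ltrBlDr ltrDl.
  by rewrite divr_gt0.
have [K K0 HK] := interpolation_absorb (powR_ge0 alpha^-1 (p / 2)) hp e0.
exists K => // x P D x0 P0 D0 xCP h.
(* For [P = 0] the power with negative exponent carries no information; the bound [x^p <= C * P]
   settles this case. *)
have := P0; rewrite le_eqVlt => /predU1P[Pe|Pp].
  by rewrite -Pe mulr0 add0r (le_trans xCP)// -Pe mulr0 mulr_ge0.
apply: HK => //.
have -> : 1 - (1 - p / 2) = p / 2 by lra.
have -> : x `^ p = (x `^ 2) `^ (p / 2).
  by rewrite -powRrM mulrCA mulfV// mulr1.
have -> : P `^ (1 - p / 2) = (P `^ (2 / p - 1)) `^ (p / 2).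
  by rewrite -powRrM; congr powR; field.
rewrite -!powRM ?powR_ge0 ?mulr_ge0 ?powR_ge0 ?invr_ge0 ?(ltW a0)//.
rewrite powR_le ?powR_ge0 ?divr_ge0 ?(ltW p0)//.
rewrite ler_pdivlMl// (mulrC (P `^ _)).
rewrite (_ : 2 / p - 1 = - (1 - 2 / p)); last by lra.
by rewrite powRN ler_pdivlMr// powR_gt0.
Qed.

(** [D <= A * x] is Cauchy-Schwarz. Inserted into the equi-continuity bound it puts [A^(d/p)] on the
    right; dividing by it bounds [A^(1-d/p)], and the power [p'/(1-d/p)] turns the bound into a
    product of [P^th] and [(x^p)^(1-th)], ready for [interpolation_absorb]. *)
Lemma equicontinuous_absorb (c eta : R) : 0 < c -> 0 < eta ->
  exists2 K, 0 <= K & forall x P D A, 0 <= x -> 0 <= P -> 0 <= A -> 0 <= D ->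
    D <= A * x ->
    A <= c * P `^ ((p - 1 - Num.min (p / 2) (p - 1)) / p) *
      D `^ (Num.min (p / 2) (p - 1) / p) ->
    A `^ p' <= eta * P + K * x `^ p.
Proof.
move=> c0 e0; have pn : p != 0 by rewrite gt_eqF.
set d := Num.min _ _.
have d0 : 0 < d by rewrite lt_min divr_gt0/=.
have dp1 : d <= p - 1 by rewrite ge_min lexx orbT.
have dp : d < p by rewrite (le_lt_trans dp1)// ltrBlDr ltrDl.
have pd0 : 0 < p - d by rewrite subr_gt0.
have pdn : p - d != 0 by rewrite gt_eqF.
have qn : p - 1 != 0 by rewrite gt_eqF.
pose th := p' * (p - 1 - d) / (p - d).
have thE : 1 - th = d / ((p - 1) * (p - d)).
  by rewrite /th; field; rewrite pdn qn.
have th01 : 0 <= th < 1.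
  rewrite !mulr_ge0 ?invr_ge0 ?(ltW p0) ?(ltW q0) ?subr_ge0 ?(ltW dp)//=.
  by rewrite -subr_gt0 thE divr_gt0// mulr_gt0.
pose r := p' / (1 - d / p).
have tdp : 0 < 1 - d / p by rewrite subr_gt0 ltr_pdivrMr// mul1r.
have r0 : 0 <= r by rewrite divr_ge0 ?divr_ge0// ltW.
have [K K0 HK] := interpolation_absorb (powR_ge0 c r) th01 e0.
exists K => // x P D A x0 P0 A0 D0 DAx h.
apply: HK; rewrite ?powR_ge0//.
have := A0; rewrite le_eqVlt => /predU1P[<-|Ap].
  by rewrite powR0 ?mulr_ge0 ?powR_ge0// gt_eqF// divr_gt0.
have step : A `^ (1 - d / p) <= c * P `^ ((p - 1 - d) / p) * x `^ (d / p).
  rewrite -(ler_pM2r (powR_gt0 (d / p) Ap)) powR_split ?(ltW tdp) ?divr_gt0//.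
  rewrite subrK powRr1// (le_trans h)// -[leRHS]mulrA -[in leRHS]powRM// (mulrC x) ler_wpM2l//.
    by rewrite mulr_ge0 ?powR_ge0// ltW.
  by rewrite powR_le// divr_ge0// ltW.
have := powR_le r0 (powR_ge0 _ _) step.
rewrite -powRrM /r mulrCA mulfV ?gt_eqF// mulr1 => /le_trans; apply.
rewrite -/r !powRM ?mulr_ge0 ?powR_ge0 ?(ltW c0)// -mulrA ler_wpM2l ?powR_ge0//.
have E1 : (p - 1 - d) / p * r = th.
  rewrite /r /th; field; rewrite qn pn/= andbT pdn//.
have E2 : d / p * r = p * (1 - th).
  rewrite thE /r; field; rewrite qn pn/= pdn//.
by rewrite -!powRrM E1 E2.
Qed.

End power_inequalities.

(** * Integration up to null sets *)

Section ae_integration.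
Context d (T : measurableType d) (R : realType).
Variable mu : {measure set T -> \bar R}.
Implicit Types f g h : T -> R.

(** A simple function below [f], multiplied by the indicator of the complement of the null set, lies
    below [g] and keeps its integral. Only the simple functions are measurable here. *)
Lemma ge0_ae_le_integral (f g : T -> \bar R) :
  (forall x, 0 <= f x)%E -> (forall x, 0 <= g x)%E ->
  {ae mu, forall x, f x = g x} -> (\int[mu]_x f x <= \int[mu]_x g x)%E.
Proof.
move=> f0 g0 [N [mN N0 sN]].
rewrite [leLHS]ge0_integralTE// [leRHS]ge0_integralTE//.
apply: ge_ereal_sup => _ [h /= hf <-].
pose k : {nnsfun T >-> R} := mul_nnsfun h (indic_nnsfun R (measurableC mN)).
have kE (x : T) : (k : T -> R) x = h x * \1_(~` N) x by [].
have -> : sintegral mu h = sintegral mu k.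
  rewrite -!integralT_nnsfun; apply: ge0_ae_eq_integral => //.
  - exact/measurable_EFinP.
  - exact/measurable_EFinP.
  - by move=> x _; rewrite lee_fin.
  - by move=> x _; rewrite lee_fin.
  exists N; split => // x /=; apply: contra_notP => xN _.
  by rewrite -[RHS]/((k x)%:E) kE indicE mem_set//= mulr1.
apply: ereal_sup_ubound; exists k => // x.
rewrite kE indicE; case: (boolP (x \in ~` N)) => [/set_mem xN|_]; last first.
  by rewrite mulr0.
rewrite mulr1 (le_trans (hf x))//.
suff -> : f x = g x by [].
by apply: contrapT => fg; apply: xN; apply: sN.
Qed.

(* No measurability is required: the integral of the library is a supremum
   over simple functions. *)
Lemma ae_integral_eq (f g : T -> \bar R) : {ae mu, forall x, f x = g x} ->
  (\int[mu]_x f x = \int[mu]_x g x)%E.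
Proof.
move=> fg; rewrite integralE [RHS]integralE.
have ge0_eq (h k : T -> \bar R) :
    (forall x, 0 <= h x)%E -> (forall x, 0 <= k x)%E ->
    {ae mu, forall x, h x = k x} -> (\int[mu]_x h x = \int[mu]_x k x)%E.
  move=> h0 k0 hk; apply/eqP; rewrite eq_le !ge0_ae_le_integral//.
  by apply: filterS hk => x ->.
congr (_ - _)%E; apply: ge0_eq => //; apply: filterS fg => x fgx.
- by rewrite !funeposE fgx.
- by rewrite !funenegE fgx.
Qed.

Lemma ae_Rintegral_eq f g : {ae mu, forall x, f x = g x} ->
  (\int[mu]_x f x)%R = (\int[mu]_x g x)%R.
Proof.
move=> fg; congr fine; apply: ae_integral_eq.
by apply: filterS fg => x ->.
Qed.

(** The measure lives on the Borel sets, while a Caratheodory function composed with a gradient is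
    only a.e. equal to a Borel function; integration is therefore developed for such functions. *)
Definition ae_mfun f : Prop :=
  exists2 g : T -> R, measurable_fun setT g & {ae mu, forall x, f x = g x}.

Definition ae_integrable f : Prop :=
  exists2 g : T -> R, mu.-integrable setT (EFin \o g) &
    {ae mu, forall x, f x = g x}.

Lemma measurable_ae_mfun f : measurable_fun setT f -> ae_mfun f.
Proof. by move=> mf; exists f => //; exact: aeW. Qed.

Lemma ae_mfun_comp (phi : R -> R) f :
  measurable_fun setT phi -> ae_mfun f -> ae_mfun (fun x => phi (f x)).
Proof.
move=> mphi [g mg fg]; exists (phi \o g); first exact: measurableT_comp.
by apply: filterS fg => x ->.
Qed.

Lemma ae_mfun_comp2 (phi : R -> R -> R) f g :
  (forall f g, measurable_fun [set: T] f -> measurable_fun setT g ->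
    measurable_fun setT (fun x => phi (f x) (g x))) ->
  ae_mfun f -> ae_mfun g -> ae_mfun (fun x => phi (f x) (g x)).
Proof.
move=> mphi [f' mf ff] [g' mg gg]; exists (fun x => phi (f' x) (g' x)).
  exact: mphi.
by apply: filterS2 ff gg => x -> ->.
Qed.

Lemma ae_mfun_cst (r : R) : ae_mfun (fun=> r).
Proof. by apply: measurable_ae_mfun; exact: measurable_cst. Qed.

Lemma ae_mfunD f g : ae_mfun f -> ae_mfun g -> ae_mfun (fun x => f x + g x).
Proof. by apply: ae_mfun_comp2 => *; exact: measurable_funD. Qed.

Lemma ae_mfunM f g : ae_mfun f -> ae_mfun g -> ae_mfun (fun x => f x * g x).
Proof. by apply: ae_mfun_comp2 => *; exact: measurable_funM. Qed.

Lemma ae_mfun_norm f : ae_mfun f -> ae_mfun (fun x => `|f x|).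
Proof.
by apply: (@ae_mfun_comp (fun x => `|x|)); exact: normr_measurable.
Qed.

Lemma ae_mfun_powR (q : R) f : ae_mfun f -> ae_mfun (fun x => f x `^ q).
Proof.
by apply: (@ae_mfun_comp (fun x => x `^ q)); exact: measurable_powR.
Qed.

Lemma ae_mfun_sum I (r : seq I) (P : pred I) (F : I -> T -> R) :
  (forall i, ae_mfun (F i)) -> ae_mfun (fun x => \sum_(i <- r | P i) F i x).
Proof.
move=> mF; elim: r => [|i r IH].
  by under [X in ae_mfun X]eq_fun do rewrite big_nil; exact: ae_mfun_cst.
under [X in ae_mfun X]eq_fun do rewrite big_cons.
by case: (P i) => //; exact: ae_mfunD.
Qed.

Lemma ae_integrable_mfun f : ae_integrable f -> ae_mfun f.
Proof.
by move=> [g /integrableP[mg _] fg]; exists g => //; exact/measurable_EFinP.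
Qed.

Lemma integrable_ae_integrable f :
  mu.-integrable setT (EFin \o f) -> ae_integrable f.
Proof. by move=> intf; exists f => //; exact: aeW. Qed.

Lemma ae_integrableD f g :
  ae_integrable f -> ae_integrable g -> ae_integrable (fun x => f x + g x).
Proof.
move=> [f' intf ff] [g' intg gg]; exists (fun x => f' x + g' x).
  exact: (integrableD measurableT intf intg).
by apply: filterS2 ff gg => x -> ->.
Qed.

Lemma ae_integrableZ (r : R) f :
  ae_integrable f -> ae_integrable (fun x => r * f x).
Proof.
move=> [f' intf ff]; exists (fun x => r * f' x).
  exact: (integrableZl measurableT r intf).
by apply: filterS ff => x ->.
Qed.

Lemma ae_integrableN f : ae_integrable f -> ae_integrable (fun x => - f x).
Proof.
by move=> /(ae_integrableZ (-1)); under eq_fun do rewrite mulN1r.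
Qed.

Lemma ae_integrableB f g :
  ae_integrable f -> ae_integrable g -> ae_integrable (fun x => f x - g x).
Proof. by move=> intf intg; apply: ae_integrableD => //; exact: ae_integrableN. Qed.

Lemma ae_integrable0 : ae_integrable (fun=> 0).
Proof.
by apply: integrable_ae_integrable; exact: integrable0.
Qed.

Lemma ae_integrable_sum I (r : seq I) (P : pred I) (F : I -> T -> R) :
  (forall i, ae_integrable (F i)) ->
  ae_integrable (fun x => \sum_(i <- r | P i) F i x).
Proof.
move=> mF; elim: r => [|i r IH].
  by under [X in ae_integrable X]eq_fun do rewrite big_nil; exact: ae_integrable0.
under [X in ae_integrable X]eq_fun do rewrite big_cons.
by case: (P i) => //; exact: ae_integrableD.
Qed.

Lemma ae_integrable_dom f g : ae_mfun f -> ae_integrable g ->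
  {ae mu, forall x, `|f x| <= g x} -> ae_integrable f.
Proof.
move=> [f' mf ff] [g' ig gg] fg.
have intg : mu.-integrable setT (EFin \o (fun x => `|g' x|)).
  exact: integrable_norm.
exists f' => //; apply/integrableP; split; first exact/measurable_EFinP.
apply: (@le_lt_trans _ _ (\int[mu]_x `|(g' x)%:E|)%E); last first.
  by have /integrableP[_] := ig.
apply: ae_ge0_le_integral => //.
- by apply: measurableT_comp => //; exact/measurable_EFinP.
- apply: measurableT_comp => //; exact: (measurable_int mu).
apply: filterS3 ff gg fg => x -> -> fg _.
by rewrite lee_fin (le_trans fg)// ler_norm.
Qed.

Lemma ae_integrable_norm f :
  ae_integrable f -> ae_integrable (fun x => `|f x|).
Proof.
move=> [g ig fg]; exists (fun x => `|g x|).
  exact: integrable_norm.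
by apply: filterS fg => x ->.
Qed.

Lemma ae_integrable_le f g : ae_mfun f -> ae_integrable g ->
  {ae mu, forall x, 0 <= f x <= g x} -> ae_integrable f.
Proof.
move=> mf ig fg; apply: (ae_integrable_dom mf ig).
by apply: filterS fg => x /andP[f0 fg]; rewrite ger0_norm.
Qed.

Lemma RintD f g : ae_integrable f -> ae_integrable g ->
  (\int[mu]_x (f x + g x))%R = (\int[mu]_x f x)%R + (\int[mu]_x g x)%R.
Proof.
move=> [f' intf ff] [g' intg gg].
rewrite (ae_Rintegral_eq ff) (ae_Rintegral_eq gg) -RintegralD//.
by apply: ae_Rintegral_eq; apply: filterS2 ff gg => x -> ->.
Qed.

Lemma RintZ (r : R) f : ae_integrable f ->
  (\int[mu]_x (r * f x))%R = r * (\int[mu]_x f x)%R.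
Proof.
move=> [f' intf ff].
rewrite (ae_Rintegral_eq ff) -RintegralZl//.
by apply: ae_Rintegral_eq; apply: filterS ff => x ->.
Qed.

Lemma RintN f : ae_integrable f ->
  (\int[mu]_x (- f x))%R = - (\int[mu]_x f x)%R.
Proof.
move=> intf; rewrite -[RHS]mulN1r -RintZ//.
by apply: eq_Rintegral => x _; rewrite mulN1r.
Qed.

Lemma RintB f g : ae_integrable f -> ae_integrable g ->
  (\int[mu]_x (f x - g x))%R = (\int[mu]_x f x)%R - (\int[mu]_x g x)%R.
Proof.
by move=> intf intg; rewrite RintD// ?RintN//; exact: ae_integrableN.
Qed.

Lemma Rint0 : (\int[mu]_x (0 : R))%R = 0.
Proof. by rewrite /Rintegral integral0. Qed.

Lemma Rint_sum I (r : seq I) (P : pred I) (F : I -> T -> R) :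
  (forall i, ae_integrable (F i)) ->
  (\int[mu]_x \sum_(i <- r | P i) F i x)%R =
  \sum_(i <- r | P i) (\int[mu]_x F i x)%R.
Proof.
move=> mF; elim: r => [|i r IH].
  by rewrite big_nil -[RHS]Rint0; apply: eq_Rintegral => x _; rewrite big_nil.
rewrite big_cons -IH; case: ifPn => Pi; last first.
  by apply: eq_Rintegral => x _; rewrite big_cons (negbTE Pi).
rewrite -RintD//; last exact: ae_integrable_sum.
by apply: eq_Rintegral => x _; rewrite big_cons Pi.
Qed.

Lemma Rint_le f g : ae_integrable f -> ae_integrable g ->
  {ae mu, forall x, f x <= g x} ->
  (\int[mu]_x f x)%R <= (\int[mu]_x g x)%R.
Proof.
move=> intf intg fg.
have [h ih hE] := ae_integrableB intg intf.
rewrite -subr_ge0 -RintB// (ae_Rintegral_eq hE).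
rewrite (@ae_Rintegral_eq _ (fun x => `|h x|)); first exact: Rintegral_ge0.
apply: filterS2 hE fg => x <- fg; rewrite ger0_norm// subr_ge0//.
Qed.

Lemma Rint_ge0 f : {ae mu, forall x, 0 <= f x} -> 0 <= (\int[mu]_x f x)%R.
Proof.
move=> f0; rewrite (@ae_Rintegral_eq _ (fun x => `|f x|)).
  exact: Rintegral_ge0.
by apply: filterS f0 => x f0; rewrite ger0_norm.
Qed.

Lemma Rint_norm_le f g : ae_mfun f -> ae_integrable g ->
  {ae mu, forall x, `|f x| <= g x} ->
  `|(\int[mu]_x f x)%R| <= (\int[mu]_x g x)%R.
Proof.
move=> mf intg fg; have intf := ae_integrable_dom mf intg fg.
rewrite ler_norml -RintN//; apply/andP; split; apply: Rint_le => //.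
- exact: ae_integrableN.
- by apply: filterS fg => x; rewrite ler_norml => /andP[].
- by apply: filterS fg => x; rewrite ler_norml => /andP[].
Qed.

Lemma EFin_Rint f : (forall x, 0 <= f x) -> ae_integrable f ->
  ((\int[mu]_x f x)%R)%:E = (\int[mu]_x (f x)%:E)%E.
Proof.
move=> f0 [g ig fg]; rewrite /Rintegral fineK//.
rewrite (@ae_integral_eq _ (EFin \o g)); first exact: integrable_fin_num.
by apply: filterS fg => x ->.
Qed.

(** * Finite L^q norms and integrals of q-th powers *)

Section Lp.
Context (q : R) (q0 : 0 < q).

Lemma Lnorm_powR f : finite_norm mu q%:E f ->
  (fine 'N[mu]_q%:E[EFin \o f]) `^ q = (\int[mu]_x `|f x| `^ q)%R.
Proof.
move=> fin; rewrite /Rintegral.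
have <- : ('N[mu]_q%:E[EFin \o f] `^ q = \int[mu]_x (`|f x| `^ q)%:E)%E.
  by rewrite poweR_Lnorm ?gt_eqF.
have /fineK <- : ('N[mu]_q%:E[EFin \o f])%E \is a fin_num.
  by rewrite ge0_fin_numE ?Lnorm_ge0.
by [].
Qed.

Lemma finite_norm_integrable f : ae_mfun f -> finite_norm mu q%:E f ->
  ae_integrable (fun x => `|f x| `^ q).
Proof.
move=> [g mg fg] fin; exists (fun x => `|g x| `^ q); last first.
  by apply: filterS fg => x ->.
apply/integrableP; split.
  apply/measurable_EFinP; apply: (measurableT_comp (measurable_powR q)).
  exact: measurableT_comp.
under eq_integral do rewrite /= ger0_norm ?powR_ge0//.
rewrite -(@ae_integral_eq (fun x => (`|f x| `^ q)%:E)); last first.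
  by apply: filterS fg => x ->.
have <- : ('N[mu]_q%:E[EFin \o f] `^ q = \int[mu]_x (`|f x| `^ q)%:E)%E.
  by rewrite poweR_Lnorm ?gt_eqF.
exact: poweR_lty.
Qed.

Lemma integrable_finite_norm f : ae_integrable (fun x => `|f x| `^ q) ->
  finite_norm mu q%:E f.
Proof.
move=> intf; rewrite /finite_norm.
have : ('N[mu]_q%:E[EFin \o f] `^ q < +oo)%E.
  rewrite poweR_Lnorm ?gt_eqF//=.
  by rewrite -(EFin_Rint (fun x => powR_ge0 _ _) intf) ltry.
have := Lnorm_ge0 mu q%:E (EFin \o f).
case: ('N[mu]_q%:E[EFin \o f])%E => [r _ _| |].
- exact: ltry.
- by rewrite poweRyr ?gt_eqF.
- by rewrite leNgt ltNye.
Qed.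

End Lp.

Lemma finite_normy_bounded f : finite_norm mu +oo%E f ->
  exists2 L, 0 < L & {ae mu, forall x, `|f x| <= L}.
Proof.
(* The norm for [q = +oo] is 0 by convention when the whole space is null; any bound then holds
   a.e. *)
rewrite /finite_norm unlock; case: ifPn => [_|mu0 _]; last first.
  exists 1 => //; apply: measure0_ae.
  by apply/eqP; rewrite eq_le measure_ge0 andbT leNgt.
move=> fin.
have [L0 fL] : exists L : R, (ess_sup mu (abse \o (EFin \o f)) <= L%:E)%E.
  move: fin; case: (ess_sup _ _) => [r _|//|_]; first by exists r.
  by exists 0; rewrite leNye.
exists (Num.max L0 1); first by rewrite lt_max ltr01 orbT.
have /ess_supP : (ess_sup mu (abse \o (EFin \o f)) <= L0%:E)%E by [].
by apply: filterS => x /=; rewrite lee_fin le_max => ->.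
Qed.

End ae_integration.

(** * The pointwise potential *)

Section euclidean.
Context (R : realType) (n : nat).
Local Notation E := 'rV[R]_n.
Implicit Types (x y z : E) (c : R).

Lemma dotrC x y : dotr x y = dotr y x.
Proof. by apply: eq_bigr => i _; rewrite mulrC. Qed.

Lemma dotrDl x y z : dotr (x + y) z = dotr x z + dotr y z.
Proof. by rewrite -big_split; apply: eq_bigr => i _; rewrite mxE mulrDl. Qed.

Lemma dotrZl c x y : dotr (c *: x) y = c * dotr x y.
Proof. by rewrite /dotr mulr_sumr; apply: eq_bigr => i _; rewrite mxE mulrA. Qed.

Lemma dotrNl x y : dotr (- x) y = - dotr x y.
Proof. by rewrite -scaleN1r dotrZl mulN1r. Qed.

Lemma dotrDr x y z : dotr x (y + z) = dotr x y + dotr x z.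
Proof. by rewrite dotrC dotrDl !(dotrC x). Qed.

Lemma dotrZr c x y : dotr x (c *: y) = c * dotr x y.
Proof. by rewrite dotrC dotrZl dotrC. Qed.

Lemma dotrNr x y : dotr x (- y) = - dotr x y.
Proof. by rewrite dotrC dotrNl dotrC. Qed.

Lemma dotr0l x : dotr 0 x = 0.
Proof. by rewrite -(scale0r 0) dotrZl mul0r. Qed.

Lemma dotr0r x : dotr x 0 = 0.
Proof. by rewrite dotrC dotr0l. Qed.

Definition dotrE := (dotrDl, dotrDr, dotrNl, dotrNr, dotrZl, dotrZr).

Lemma dotr_ge0 x : 0 <= dotr x x.
Proof. by apply: sumr_ge0 => i _; rewrite -expr2 sqr_ge0. Qed.

Lemma dotr_eq0 x : dotr x x = 0 -> x = 0.
Proof.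
move=> /eqP; rewrite psumr_eq0; last by move=> i _; rewrite -expr2 sqr_ge0.
move=> /allP h; apply/rowP => i; rewrite mxE.
have /(_ _)/implyP := h i; rewrite mem_index_enum => /(_ isT isT).
by rewrite -expr2 sqrf_eq0 => /eqP.
Qed.

Lemma enorm_ge0 x : 0 <= enorm x.
Proof. exact: sqrtr_ge0. Qed.

Lemma enorm_sqr x : enorm x ^+ 2 = dotr x x.
Proof. by rewrite sqr_sqrtr// dotr_ge0. Qed.

Lemma enorm_eq0 x : enorm x = 0 -> x = 0.
Proof. by move=> h; apply: dotr_eq0; rewrite -enorm_sqr h expr0n. Qed.

Lemma enorm0 : enorm (0 : E) = 0.
Proof. by rewrite /enorm dotr0l sqrtr0. Qed.

Lemma enormZ c x : enorm (c *: x) = `|c| * enorm x.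
Proof.
rewrite /enorm dotrZl dotrZr mulrA -expr2 sqrtrM ?sqr_ge0//.
by rewrite sqrtr_sqr.
Qed.

Lemma enormN x : enorm (- x) = enorm x.
Proof. by rewrite -scaleN1r enormZ normrN1 mul1r. Qed.

Lemma cauchy_schwarz x y : `|dotr x y| <= enorm x * enorm y.
Proof.
have h : dotr x y ^+ 2 <= dotr x x * dotr y y.
  have := dotr_ge0 y; rewrite le_eqVlt => /predU1P[y0|y0].
    by rewrite -y0 (dotr_eq0 (esym y0)) dotr0r expr0n mulr0.
  have := dotr_ge0 (dotr y y *: x - dotr x y *: y).
  rewrite !dotrE (dotrC y x).
  rewrite (_ : _ + _ = dotr y y * (dotr x x * dotr y y - dotr x y ^+ 2)).
    by rewrite pmulr_rge0// subr_ge0.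
  ring.
rewrite -sqrtr_sqr -sqrtrM ?dotr_ge0//; exact: ler_wsqrtr.
Qed.

Lemma dotr_le x y : dotr x y <= enorm x * enorm y.
Proof. exact: le_trans (ler_norm _) (cauchy_schwarz x y). Qed.

Lemma enormD x y : enorm (x + y) <= enorm x + enorm y.
Proof.
rewrite -(@ler_pXn2r _ 2) ?nnegrE ?addr_ge0 ?enorm_ge0//.
rewrite enorm_sqr sqrrD !enorm_sqr !dotrE (dotrC y x).
have := dotr_le x y; lra.
Qed.

Lemma enormB_le x y : enorm (x - y) <= enorm x + enorm y.
Proof. by rewrite -(enormN y) enormD. Qed.

Lemma coord_le_enorm x i : `|x 0 i| <= enorm x.
Proof.
rewrite -sqrtr_sqr ler_wsqrtr// /dotr (bigD1 i)//= -expr2 lerDl.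
by apply: sumr_ge0 => j _; rewrite -expr2 sqr_ge0.
Qed.

Lemma enorm_le_sum x : enorm x <= \sum_i `|x 0 i|.
Proof.
rewrite -(@ler_pXn2r _ 2) ?nnegrE ?enorm_ge0 ?sumr_ge0// enorm_sqr expr2.
rewrite mulr_suml; apply: ler_sum => i _.
rewrite -[leLHS]ger0_norm -?expr2 ?sqr_ge0// normrX expr2.
by rewrite ler_wpM2l// (bigD1 i)//= lerDl sumr_ge0.
Qed.

Lemma coord_le_norm x i : `|x 0 i| <= `|x|.
Proof.
rewrite [leRHS]/Num.norm/= mx_normrE.
exact: (le_trans _ (le_bigmax _ _ (ord0, i))).
Qed.

Lemma dotr_lin z : linear (dotr z : E -> R^o).
Proof. by move=> c x y; rewrite dotrDr dotrZr. Qed.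

HB.instance Definition _ z :=
  GRing.isLinear.Build R E R^o _ (dotr z : E -> R^o) (dotr_lin z).

Lemma dotr_continuous z : continuous (dotr z : E -> R^o).
Proof.
suff H (s : seq 'I_n) : continuous (fun h : E => (\sum_(i <- s) z 0 i * h 0 i : R^o)).
  exact: H.
elim: s => [|i s IH] x.
  rewrite (_ : (fun _ => _) = cst 0); first exact: (@cst_continuous E R^o 0 x).
  by apply/funext => h; rewrite big_nil.
rewrite (_ : (fun _ => _) =
  (fun h : E => z 0 i * h 0 i + \sum_(j <- s) z 0 j * h 0 j)); last first.
  by apply/funext => h; rewrite big_cons.
apply: (@continuousD R R^o E (fun h : E => z 0 i * h 0 i)); last exact: IH.
exact: (continuousM (@cst_continuous _ _ (z 0 i) x) (@coord_continuous _ _ _ _ _ x)).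
Qed.

Lemma differentiable_littleo (f : E -> R) x z :
  (forall e, 0 < e -> \forall h \near (0 : E),
     `|f (h + x) - f x - dotr z h| <= e * `|h|) ->
  differentiable f x /\ forall v, 'd f x v = dotr z v.
Proof.
move=> fz; pose L : {linear E -> R^o} := (dotr z : E -> R^o).
have fL : (f : E -> R^o) \o shift x = cst (f x : R^o) + L +o_ (0 : E) id.
  apply/eqaddoP => e e0 /=; have := fz e e0; apply: filterS => h /=.
  by rewrite !fctE opprD addrA.
have dL := diff_unique (@dotr_continuous z) fL.
split; last by move=> v; rewrite dL.
apply/diff_locallyP; split; first by rewrite dL; exact: dotr_continuous.
by rewrite dL.
Qed.

Lemma partialE (f : E -> R) x i : differentiable f x ->
  partial i f x = 'd f x (delta_mx 0 i).
Proof. by move=> df; rewrite /partial deriveE. Qed.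

Lemma dotr_delta x i : dotr x (delta_mx 0 i) = x 0 i.
Proof.
rewrite /dotr (bigD1 i)//= mxE !eqxx mulr1 big1 ?addr0// => j ji.
by rewrite mxE eqxx/= (negbTE ji) mulr0.
Qed.

Lemma derive_dotr_partial (f : E -> R) x v : differentiable f x ->
  'D_v f x = \sum_i v 0 i * partial i f x.
Proof.
move=> df; rewrite deriveE// {1}(row_sum_delta v) linear_sum.
by apply: eq_bigr => i _; rewrite linearZ partialE.
Qed.

End euclidean.

(** * The potential of a cyclically monotone homogeneous map *)

Section pointwise_potential.
Context (R : realType) (n : nat) (p : R) (p1 : 1 < p).
Local Notation E := 'rV[R]_n.
Let p0 : 0 < p. Proof. exact: lt_trans p1. Qed.
Let q0 : 0 < p - 1. Proof. by rewrite subr_gt0. Qed.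

(* Comparison of [int_0^1 t^(p-1) dt = 1/p] with its lower and upper Riemann
   sums, whose difference is [1/m]. *)
Lemma riemann_powR (m : nat) : (0 < m)%N ->
  \sum_(j < m) (j%:R / m%:R) `^ (p - 1) / m%:R >= p^-1 - m%:R^-1 :> R /\
  \sum_(j < m) (j.+1%:R / m%:R) `^ (p - 1) / m%:R <= p^-1 + m%:R^-1 :> R.
Proof.
move=> m0; have mr : 0 < m%:R :> R by rewrite ltr0n.
pose S (k : nat) : R := \sum_(j < k) (j%:R / m%:R) `^ (p - 1) / m%:R.
pose U (k : nat) : R := \sum_(j < k) (j.+1%:R / m%:R) `^ (p - 1) / m%:R.
(* The tangent line inequality of the convex function [t^p], derived from Young's inequality;
   applied in both directions between neighbouring nodes it gives both Riemann sums by induction. *)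
have tangent (s t : R) : 0 <= s -> 0 <= t ->
    p * s `^ (p - 1) * (t - s) <= t `^ p - s `^ p.
  move=> s0 t0.
  have [C] : exists C, C = p / (p - 1) by eexists.
  have := @conjugate_powR R t (s `^ (p - 1)) p (p / (p - 1)) t0 (powR_ge0 _ _).
  rewrite !invfM !invrK => /(_ p0 (divr_gt0 p0 q0)).
  have -> : p^-1 + p^-1 * (p - 1) = 1 by rewrite mulrBr mulVf ?gt_eqF// mulr1 addrC subrK.
  move=> /(_ erefl); rewrite -powRrM (mulrC (p - 1)) divfK ?gt_eqF// => H _.
  have E1 : s `^ (p - 1) * s = s `^ p by rewrite mulrC mulr_powRB1.
  rewrite -mulrA mulrBr E1.
  have := ler_wpM2l (ltW p0) H.
  rewrite mulrDr (_ : p * (t `^ p / p) = t `^ p); last by rewrite mulrC divfK ?gt_eqF.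
  have -> : p * (s `^ p * (p^-1 * (p - 1))) = (p - 1) * s `^ p.
    by field; rewrite gt_eqF.
  rewrite mulrBr (mulrC t); lra.
have le (k : nat) : p * S k <= (k%:R / m%:R) `^ p /\ (k%:R / m%:R) `^ p <= p * U k.
  elim: k => [|k [IH1 IH2]].
    by rewrite /S /U !big_ord0 mulr0 mul0r powR0 ?gt_eqF.
  rewrite /S /U !big_ord_recr/= !mulrDr.
  have k0 : 0 <= k%:R / m%:R :> R by rewrite divr_ge0.
  have k1 : 0 <= k.+1%:R / m%:R :> R by rewrite divr_ge0.
  have d : k.+1%:R / m%:R - k%:R / m%:R = m%:R^-1 :> R.
    by rewrite -mulrBl -natrB// subSnn mul1r.
  have := tangent _ _ k0 k1; have := tangent _ _ k1 k0.
  rewrite -[k%:R / _ - _]opprB d -/(S k) -/(U k); move: IH1 IH2; rewrite -/(S k) -/(U k).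
  set a := _ `^ p; set b := _ `^ p; set u := _ `^ (p - 1); set v := _ `^ (p - 1).
  set w := m%:R^-1; rewrite !mulrA; lra.
have SU : U m = S m + m%:R^-1.
  rewrite /U /S; case: m m0 mr @S @U le => // k _ kr _ _ _.
  rewrite big_ord_recr [in RHS]big_ord_recl/= mul0r powR0 ?gt_eqF// mul0r add0r.
  by rewrite divff ?gt_eqF// powR1 mul1r.
have [] := le m; rewrite divff ?gt_eqF// powR1 => h1 h2.
have pS : S m <= p^-1 by rewrite -[p^-1]mul1r ler_pdivlMr// mulrC.
have pU : p^-1 <= U m by rewrite -[p^-1]mul1r ler_pdivrMr// mulrC.
by rewrite -/(S m) -/(U m); split; lra.
Qed.

Context (a : E -> E).
Context (a_cont : forall i, continuous (fun xi => a xi 0 i : R)).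
Context (a_hom : forall xi t, 0 < t -> a (t *: xi) = t `^ (p - 1) *: a xi).
Context (a_odd : forall xi, a (- xi) = - a xi).
Context (a0 : a 0 = 0).
Context (a_cyc : forall (k : nat) (xi : nat -> E),
    (0 < k)%N -> xi k = xi 0%N ->
    \sum_(i < k) dotr (a (xi i)) (xi i.+1 - xi i) <= 0).
Context (a_strict : forall xi1 xi2, xi1 != xi2 ->
  0 < dotr (a xi1 - a xi2) (xi1 - xi2)).

Local Notation Phi := (fun xi => dotr (a xi) xi).

Let a_scale xi t : 0 <= t -> a (t *: xi) = t `^ (p - 1) *: a xi.
Proof.
rewrite le_eqVlt => /predU1P[<-|/a_hom//].
by rewrite scale0r a0 powR0 ?gt_eqF// scale0r.
Qed.

Let Phi_ge0 xi : 0 <= dotr (a xi) xi.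
Proof.
have [->|xi0] := eqVneq xi 0; first by rewrite dotr0r.
by have := a_strict xi0; rewrite a0 !subr0 => /ltW.
Qed.

(* Rockafellar's argument: cyclic monotonicity along a polygon which goes up
   the segment [0, xi], jumps to eta and comes back to 0. *)
Lemma potential_subgradient xi eta :
  p * dotr (a xi) (eta - xi) <= dotr (a eta) eta - dotr (a xi) xi.
Proof.
have main (m : nat) : (0 < m)%N ->
    dotr (a xi) (eta - xi) + (p^-1 - m%:R^-1) * dotr (a xi) xi <=
    (p^-1 + m%:R^-1) * dotr (a eta) eta.
  move=> m0; have mn : m%:R != 0 :> R by rewrite pnatr_eq0 -lt0n.
  (* Vertices 0 to [m] climb from 0 to [xi], vertices [m+1] to [2m+1] descend from [eta] to 0. The
     jump is the edge from [m] to [m+1], so the cycle has [m + m.+1] edges. *)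
  pose pt (i : nat) : E := if (i <= m)%N then (i%:R / m%:R) *: xi
    else ((m + m.+1 - i)%:R / m%:R) *: eta.
  have ptK : pt (m + m.+1)%N = pt 0%N.
    by rewrite /pt leq0n leqNgt ltn_addl//= subnn !mul0r !scale0r.
  have := a_cyc (ltn_addl m (ltn0Sn m)) ptK.
  rewrite -(big_mkord xpredT (fun i => dotr (a (pt i)) (pt i.+1 - pt i))).
  rewrite (big_cat_nat (n := m))//= ?leq_addr//.
  rewrite (big_ltn (m := m))/=; last by rewrite addnS ltnS leq_addr.
  have -> : pt m = xi by rewrite /pt leqnn divff// scale1r.
  have -> : pt m.+1 = eta by rewrite /pt ltnn addnK divff// scale1r.
  rewrite -{1}[m.+1]add0n big_addn.
  rewrite (_ : (m + m.+1 - m.+1 = m)%N) ?addnK//.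
  rewrite big_mkord (eq_bigr (fun i : 'I_m => (i%:R / m%:R) `^ (p - 1) / m%:R *
      dotr (a xi) xi)); last first.
    move=> i _; rewrite /pt (ltnW (ltn_ord i)) ltn_ord -scalerBl -mulrBl.
    rewrite -natrB// subSnn mul1r a_scale ?divr_ge0// dotrZl dotrZr mulrA.
    by rewrite mulrAC.
  set S1 := (X in X + _ <= 0).
  rewrite big_nat_rev/= big_mkord add0n.
  rewrite (eq_bigr (fun i : 'I_m => - ((i.+1%:R / m%:R) `^ (p - 1) / m%:R *
      dotr (a eta) eta))); last first.
    move=> i _; rewrite /pt.
    have im : (i < m)%N by [].
    have -> : (m - i.+1 + m.+1 <= m)%N = false.
      by apply/negbTE; rewrite -ltnNge leq_addl.
    have -> : ((m - i.+1 + m.+1).+1 <= m)%N = false.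
      by apply/negbTE; rewrite -ltnNge ltnW// ltnS leq_addl.
    rewrite (_ : (m + m.+1 - (m - i.+1 + m.+1) = i.+1)%N); last first.
      by rewrite subnDr subKn.
    rewrite (_ : (m + m.+1 - (m - i.+1 + m.+1).+1 = i)%N); last first.
      by rewrite -addSn subnDr subnS subKn.
    rewrite -scalerBl -mulrBl -opprB -natrB// subSnn mulNr mul1r.
    rewrite a_scale ?divr_ge0// dotrZl dotrZr !mulNr mulrN mulrA.
    by rewrite mulrAC.
  rewrite sumrN /S1 -!mulr_suml.
  have [h1 h2] := riemann_powR m0.
  have := ler_wpM2r (Phi_ge0 xi) h1; have := ler_wpM2r (Phi_ge0 eta) h2.
  rewrite !mulr_suml; lra.
rewrite leNgt; apply/negP => gap.
pose g := dotr (a xi) (eta - xi) + p^-1 * dotr (a xi) xi - p^-1 * dotr (a eta) eta.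
have g0 : 0 < g.
  rewrite -(pmulr_rgt0 _ p0) /g !mulrDr mulrN !mulrA mulfV ?gt_eqF// !mul1r; lra.
(* Fine enough that the Riemann sum error [(Phi xi + Phi eta) / m] is smaller than the supposed gap
   [g]. *)
pose m := (Num.truncn ((dotr (a xi) xi + dotr (a eta) eta) / g)).+1.
have mg : (dotr (a xi) xi + dotr (a eta) eta) / g < m%:R by exact: truncnS_gt.
have := main m isT; move: mg; rewrite ltr_pdivrMr// => mg.
have mr : 0 < m%:R :> R by [].
have : m%:R^-1 * (dotr (a xi) xi + dotr (a eta) eta) < g.
  by rewrite ltr_pdivrMl.
rewrite /g; lra.
Qed.

(** The subgradient inequalities at [xi] and at [xi + h] enclose the increment of the potential
    between [p a(xi).h] and [p a(xi + h).h]; continuity of [a] does the rest. *)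
Lemma potential_differentiable xi : differentiable (Phi : E -> R) xi /\
  forall i, partial i (Phi : E -> R) xi = p * a xi 0 i.
Proof.
have [] := @differentiable_littleo _ _ (Phi : E -> R) xi (p *: a xi).
  move=> e e0; pose d := e / (p * n.+1%:R).
  have d0 : 0 < d by rewrite divr_gt0// mulr_gt0.
  have : \forall h \near (0 : E), forall i, `|a (h + xi) 0 i - a xi 0 i| <= d.
    apply: (@filter_forall _ _ (fun i => [set h : E | `|a (h + xi) 0 i - a xi 0 i| <= d]) (nbhs (0 : E))) => i.
    have : (fun h : E => a (h + xi) 0 i) h @[h --> (0 : E)] --> a xi 0 i.
      rewrite -[X in X @ _]/((fun y : E => a y 0 i) \o shift xi).
      by rewrite cvg_comp_shift add0r; exact: a_cont.
    by move=> /cvgrPdist_le /(_ d d0); apply: filterS => h; rewrite distrC.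
  apply: filterS => h hd; rewrite dotrZl.
  have l := potential_subgradient xi (h + xi).
  have u := potential_subgradient (h + xi) xi.
  rewrite addrK in l; rewrite opprD addrCA subrr addr0 dotrNr in u.
  rewrite ger0_norm; last by lra.
  have : p * (dotr (a (h + xi)) h - dotr (a xi) h) <= e * `|h|.
    rewrite -dotrNl -dotrDl -ler_pdivlMl// (le_trans (ler_norm _))//.
    rewrite (le_trans (ler_norm_sum _ _ _))//.
    rewrite (@le_trans _ _ (\sum_(i < n) d * `|h|))//.
      apply: ler_sum => i _; rewrite normrM ler_pM//.
        by rewrite !mxE; exact: hd.
      exact: coord_le_norm.
    rewrite sumr_const card_ord -mulr_natr /d.
    rewrite (_ : _ * _ = p^-1 * (e * `|h|) * (n%:R / n.+1%:R)).
      rewrite ler_piMr//; first by rewrite !mulr_ge0 ?invr_ge0// ltW.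
      by rewrite ler_pdivrMr// mul1r ler_nat.
    have : n.+1%:R != 0 :> R by rewrite pnatr_eq0.
    by move: n.+1%:R => N1 N0; field; rewrite ?N0 ?(gt_eqF p0).
  by lra.
move=> df dE; split => // i; rewrite partialE// dE dotr_delta mxE//.
Qed.

(** Passing from [m] to [eta] through their midpoint makes the subgradient inequality strict,
    because [a] is strictly monotone between [m] and the midpoint. The strict inequalities for [xi1]
    and [xi2] are then averaged. *)
Lemma potential_strictly_convex xi1 xi2 t : xi1 != xi2 -> 0 < t < 1 ->
  Phi (t *: xi1 + (1 - t) *: xi2) < t * Phi xi1 + (1 - t) * Phi xi2.
Proof.
move=> x12 /andP[t0 t1]; set m := _ + _ *: _.
have strict eta : eta != m ->
    p * dotr (a m) (eta - m) < dotr (a eta) eta - dotr (a m) m.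
  move=> em; pose w := 2^-1 *: (eta + m).
  have e1 : eta - w = 2^-1 *: (eta - m).
    by rewrite /w; apply/rowP => i; rewrite !mxE; field.
  have e2 : w - m = 2^-1 *: (eta - m).
    by rewrite /w; apply/rowP => i; rewrite !mxE; field.
  have wm : w != m by rewrite -subr_eq0 e2 scaler_eq0 negb_or invr_eq0 pnatr_eq0 subr_eq0.
  have h1 := potential_subgradient w eta; have h2 := potential_subgradient m w.
  have h3 := a_strict wm; move: h1 h2 h3.
  rewrite e1 e2 dotrDl dotrNl !dotrZr => h1 h2 h3.
  have := mulr_gt0 p0 h3; rewrite mulrBr; lra.
have s0 : 0 < 1 - t by rewrite subr_gt0.
have d1 : xi1 - m = (1 - t) *: (xi1 - xi2).
  by rewrite /m; apply/rowP => i; rewrite !mxE; ring.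
have d2 : xi2 - m = (- t) *: (xi1 - xi2).
  by rewrite /m; apply/rowP => i; rewrite !mxE; ring.
have n1 : xi1 != m.
  by rewrite -subr_eq0 d1 scaler_eq0 negb_or (gt_eqF s0)/= subr_eq0.
have n2 : xi2 != m.
  by rewrite -subr_eq0 d2 scaler_eq0 negb_or oppr_eq0 (gt_eqF t0)/= subr_eq0.
have := strict _ n1; have := strict _ n2; rewrite d1 d2 !dotrZr.
rewrite -(ltr_pM2l s0) => h2; rewrite -(ltr_pM2l t0) => h1.
move: h1 h2; set X := dotr (a m) (xi1 - xi2).
rewrite !mulrBr; lra.
Qed.

Lemma potential_homogeneous xi t :
  dotr (a (t *: xi)) (t *: xi) = `|t| `^ p * dotr (a xi) xi.
Proof.
wlog t0 : t / 0 <= t.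
  move=> h; have [/h//|/ltW t0] := leP 0 t.
  have := h (- t); rewrite oppr_ge0 => /(_ t0).
  by rewrite scaleNr a_odd dotrNl dotrNr opprK normrN.
by rewrite a_scale// dotrZl dotrZr mulrA (mulrC _ t) mulr_powRB1// ger0_norm.
Qed.

(* Euler's identity for homogeneous functions. *)
Lemma potential_unique (F : E -> R) xi :
  (forall xi t, F (t *: xi) = `|t| `^ p * F xi) -> differentiable F xi ->
  (forall i, partial i F xi = p * a xi 0 i) -> F xi = dotr (a xi) xi.
Proof.
move=> Fh dF Fi; apply: (@mulfI _ p); first by rewrite gt_eqF.
have := derive_dotr_partial xi dF.
rewrite (eq_bigr (fun i => p * (a xi 0 i * xi 0 i))); last first.
  by move=> i _; rewrite Fi mulrCA (mulrC (xi 0 i)).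
rewrite -mulr_sumr -/(dotr (a xi) xi) => <-.
pose g (h : R) : R := F (h *: xi).
have -> : 'D_xi F xi = 'D_1 g 1.
  rewrite /derive (_ : (fun h : R => h^-1 *: ((F \o shift xi) (h *: xi) - F xi)) =
    (fun h : R => h^-1 *: ((g \o shift 1) (h *: 1) - g 1)))//.
  apply/funext => h /=; rewrite /g [_%:A]mulr1 scalerDl.
  by rewrite !scale1r.
pose k (h : R) : R := h `^ p * F xi.
have -> : 'D_1 g 1 = 'D_1 k 1.
  apply: near_eq_derive => //; near=> h.
  rewrite /g /k Fh ger0_norm// ltW//; near: h.
  exact: lt_nbhsr.
rewrite -[k]/(F xi \o* (fun h : R => h `^ p)) deriveMr; last by apply: derivable_powR; rewrite in_itv/= ltr01.
have := @is_derive1_powR R p 1 ltr01.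
by move=> [_ ->]; rewrite powR1 mulr1 mulrC.
Unshelve. all: by end_near. Qed.

End pointwise_potential.

(** * Poincare inequality on cubes *)

Lemma ge0_le_integralT d (T : measurableType d) (R : realType)
    (m : {measure set T -> \bar R}) (f g : T -> \bar R) :
  measurable_fun setT f -> measurable_fun setT g -> (forall x, 0 <= f x)%E ->
  (forall x, f x <= g x)%E -> (\int[m]_x f x <= \int[m]_x g x)%E.
Proof. by move=> mf mg f0 fg; apply: ge0_le_integral. Qed.

Lemma ge0_integralDT d (T : measurableType d) (R : realType)
    (m : {measure set T -> \bar R}) (f g : T -> \bar R) :
  measurable_fun setT f -> measurable_fun setT g -> (forall x, 0 <= f x)%E ->
  (forall x, 0 <= g x)%E ->
  (\int[m]_x (f x + g x) = \int[m]_x f x + \int[m]_x g x)%E.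
Proof. by move=> mf mg f0 g0; apply: ge0_integralD. Qed.

(** * Mean oscillation over pairs of points *)

Section variation.
Local Open Scope ereal_scope.
Context (R : realType) (p : R) (p0 : (0 < p)%R).

(** The oscillation over pairs controls the distance to the mean and, unlike that distance, splits
    along the factors of a product measure. *)
Definition variation d (T : measurableType d) (m : set T -> \bar R)
    (f : T -> R) : \bar R :=
  \int[m]_x \int[m]_y (`|f x - f y| `^ p)%:E.

Lemma measurable_dist_powR d (T : measurableType d) (f g : T -> R) :
  measurable_fun setT f -> measurable_fun setT g ->
  measurable_fun setT (fun x => (`|f x - g x| `^ p)%:E).
Proof.
move=> mf mg; apply/measurable_EFinP.
apply: (measurableT_comp (measurable_powR p)).
apply: measurableT_comp => //; exact: measurable_funB.
Qed.

Context d1 d2 (X : measurableType d1) (Y : measurableType d2).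
Context (m1 : {finite_measure set X -> \bar R})
        (m2 : {finite_measure set Y -> \bar R}).

(* To go from (t, x) to (r, y), change one coordinate at a time. *)
Lemma variation_prod (F : X * Y -> R) : measurable_fun setT F ->
  variation (m1 \x m2) F <= (2 `^ p)%:E *
    (m2 setT * \int[m2]_x variation m1 (fun t => F (t, x)) +
     m1 setT * \int[m1]_t variation m2 (fun x => F (t, x))).
Proof.
move=> mF.
have ge0 (x : R) : 0 <= (x `^ p)%:E by rewrite lee_fin powR_ge0.
have iter (g : X * Y -> \bar R) : measurable_fun setT g -> (forall z, 0 <= g z) ->
    \int[m1 \x m2]_z g z = \int[m1]_t \int[m2]_x g (t, x).
  by move=> mg g0; rewrite fubini_tonelli1.
pose g1 (t : X) (x : Y) (r : X) : \bar R := (`|F (t, x) - F (r, x)| `^ p)%:E.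
pose g2 (r : X) (x y : Y) : \bar R := (`|F (r, x) - F (r, y)| `^ p)%:E.
have g10 t x r : 0 <= g1 t x r by exact: ge0.
have g20 r x y : 0 <= g2 r x y by exact: ge0.
have mg1 : measurable_fun setT (fun z : (X * Y) * X => g1 z.1.1 z.1.2 z.2).
  apply: measurable_dist_powR; apply: (measurableT_comp mF).
    apply/measurable_fun_pairP; split.
      exact: (measurableT_comp measurable_fst measurable_fst).
    exact: (measurableT_comp measurable_snd measurable_fst).
  apply/measurable_fun_pairP; split; first exact: measurable_snd.
  exact: (measurableT_comp measurable_snd measurable_fst).
have mg2 : measurable_fun setT (fun z : (X * Y) * Y => g2 z.1.1 z.1.2 z.2).
  apply: measurable_dist_powR; apply: (measurableT_comp mF).
    apply/measurable_fun_pairP; split.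
      exact: (measurableT_comp measurable_fst measurable_fst).
    exact: (measurableT_comp measurable_snd measurable_fst).
  apply/measurable_fun_pairP; split; last exact: measurable_snd.
  exact: (measurableT_comp measurable_fst measurable_fst).
pose H1 (z : X * Y) := \int[m1]_r g1 z.1 z.2 r.
pose H2 (z : X * Y) := \int[m2]_y g2 z.1 z.2 y.
have mH1 : measurable_fun setT H1.
  exact: (measurable_fun_fubini_tonelli_F (fun z : (X * Y) * X => g1 z.1.1 z.1.2 z.2) mg1 (fun=> ge0 _)).
have mH2 : measurable_fun setT H2.
  exact: (measurable_fun_fubini_tonelli_F (fun z : (X * Y) * Y => g2 z.1.1 z.1.2 z.2) mg2 (fun=> ge0 _)).
have H10 z : 0 <= H1 z by apply: integral_ge0 => r _; exact: ge0.
have H20 z : 0 <= H2 z by apply: integral_ge0 => r _; exact: ge0.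
pose K (x : Y) := \int[m1]_r H2 (r, x).
have mK : measurable_fun setT K.
  exact: (measurable_fun_fubini_tonelli_G H2 mH2 H20).
have K0 x : 0 <= K x by apply: integral_ge0.
have inner (z : X * Y) : \int[m1 \x m2]_w (`|F z - F w| `^ p)%:E <=
    (2 `^ p)%:E * (m2 setT * H1 z + K z.2).
  rewrite iter//; last by apply: measurable_dist_powR => //; exact: measurable_cst.
  have msec (r : X) : measurable_fun setT (fun y : Y => F (r, y)).
    exact: measurableT_comp.
  have mH2z : measurable_fun setT (fun r => H2 (r, z.2)).
    exact: (measurableT_comp mH2).
  have mg1z : measurable_fun setT (fun r => g1 z.1 z.2 r).
    by apply: measurable_dist_powR; [exact: measurable_cst|exact: measurableT_comp].
  rewrite (@le_trans _ _ (\int[m1]_r ((2 `^ p)%:E * (m2 setT * g1 z.1 z.2 r + H2 (r, z.2)))))//.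
    apply: ge0_le_integralT.
    - apply: (measurable_fun_fubini_tonelli_F (fun w : X * Y => (`|F z - F w| `^ p)%:E)) => //.
      by apply: measurable_dist_powR => //; exact: measurable_cst.
    - apply: measurable_funeM; apply: emeasurable_funD => //.
      exact: measurable_funeM.
    - by move=> r; apply: integral_ge0 => x _; exact: ge0.
    move=> r.
    have mg2r : measurable_fun setT (fun y => g2 r z.2 y).
      by apply: measurable_dist_powR; [exact: measurable_cst|exact: msec].
    rewrite (@le_trans _ _ (\int[m2]_y ((2 `^ p)%:E * (g1 z.1 z.2 r + g2 r z.2 y))))//.
      apply: ge0_le_integralT => //.
      - by apply: measurable_dist_powR; [exact: measurable_cst|exact: msec].
      - by apply: measurable_funeM; apply: emeasurable_funD => //; exact: measurable_cst.
      move=> y; rewrite -EFinD -EFinM lee_fin.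
      rewrite -(surjective_pairing z).
      apply: (le_trans _ (powRD_le p0 (normr_ge0 _) (normr_ge0 _))).
      rewrite powR_le ?(ltW p0)//.
      by rewrite -{1}(subrK (F (r, z.2)) (F z)) -addrA ler_normD.
    rewrite ge0_integralZl//; last 2 first.
    - by apply: emeasurable_funD => //; exact: measurable_cst.
    - by move=> y _; apply: adde_ge0; exact: ge0.
    rewrite lee_wpmul2l ?lee_fin ?powR_ge0//.
    rewrite ge0_integralD//.
    by rewrite integral_cst// muleC.
  rewrite ge0_integralZl//; last 2 first.
  - by apply: emeasurable_funD => //; exact: measurable_funeM.
  - by move=> y _; rewrite adde_ge0// mule_ge0.
  rewrite lee_wpmul2l ?lee_fin ?powR_ge0//.
  rewrite ge0_integralD//; last 2 first.
  - by move=> y _; rewrite mule_ge0.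
  - exact: measurable_funeM.
  by rewrite ge0_integralZl.
rewrite /variation (@le_trans _ _ (\int[m1 \x m2]_z ((2 `^ p)%:E * (m2 setT * H1 z + K z.2))))//.
  apply: ge0_le_integralT => //.
  - pose G3 (w : ((X * Y) * X) * Y) := (`|F w.1.1 - F (w.1.2, w.2)| `^ p)%:E.
    have mG3 : measurable_fun setT G3.
      apply: measurable_dist_powR; apply: (measurableT_comp mF).
        exact: (measurableT_comp measurable_fst measurable_fst).
      apply/measurable_fun_pairP; split; last exact: measurable_snd.
      exact: (measurableT_comp measurable_snd measurable_fst).
    pose G2 (w : (X * Y) * X) := \int[m2]_y G3 (w, y).
    have mG2 : measurable_fun setT G2.
      exact: (measurable_fun_fubini_tonelli_F G3 mG3 (fun=> ge0 _)).
    have G20 w : 0 <= G2 w by apply: integral_ge0 => y _; exact: ge0.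
    rewrite (_ : (fun z => _) = (fun z => \int[m1]_r G2 (z, r))).
      exact: (measurable_fun_fubini_tonelli_F G2 mG2 G20).
    apply/funext => z; rewrite iter//.
    by apply: measurable_dist_powR => //; exact: measurable_cst.
  - apply: measurable_funeM; apply: emeasurable_funD; first exact: measurable_funeM.
    exact: (measurableT_comp mK).
  - by move=> z; apply: integral_ge0 => x _; exact: ge0.
rewrite ge0_integralZl//; last 2 first.
- apply: emeasurable_funD; first exact: measurable_funeM.
  exact: (measurableT_comp mK).
- by move=> z _; rewrite adde_ge0// mule_ge0.
rewrite lee_wpmul2l ?lee_fin ?powR_ge0//.
have mH1c : measurable_fun setT (fun z : X * Y => m2 setT * H1 z).
  exact: measurable_funeM.
have H1c0 z : 0 <= m2 setT * H1 z by rewrite mule_ge0.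
have mKz : measurable_fun setT (fun z : X * Y => K z.2).
  exact: (measurableT_comp mK measurable_snd).
rewrite (ge0_integralDT (m1 \x m2) mH1c mKz H1c0 (fun z => K0 z.2)).
apply: leeD.
  rewrite ge0_integralZl//; apply: lee_wpmul2l => //.
  by rewrite (fubini_tonelli2 (m1 := m1) (m2 := m2) H1 mH1 H10).
rewrite (iter (fun z => K z.2) mKz (fun z => K0 z.2)) /=.
rewrite (integral_cst m1 measurableT (\int[m2]_x K x)) muleC.
apply: lee_wpmul2l => //.
rewrite -(fubini_tonelli2 (m1 := m1) (m2 := m2) H2 mH2 H20).
by rewrite (fubini_tonelli1 (m1 := m1) (m2 := m2) H2 mH2 H20).
Qed.

End variation.

Section hoelder_finite.
Local Open Scope ereal_scope.
Context d (T : measurableType d) (R : realType).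
Context (m : {finite_measure set T -> \bar R}) (p : R) (p1 : (1 < p)%R).

(** Hoelder's inequality against the constant 1. *)
Lemma integral_poweR_le (h : T -> R) : measurable_fun setT h ->
  (\int[m]_x (`|h x|)%:E) `^ p <=
  m setT `^ (p - 1) * \int[m]_x (`|h x| `^ p)%:E.
Proof.
move=> mh; have p0 : (0 < p)%R by exact: lt_trans p1.
have q0 : (0 < p - 1)%R by rewrite subr_gt0.
have pq : (p^-1 + (p / (p - 1))^-1 = 1)%R by field; rewrite !gt_eqF.
have q1 : (0 < p / (p - 1))%R by rewrite divr_gt0.
have := hoelder m mh (@measurable_cst _ _ _ _ setT (1%R : R)) p0 q1 pq.
rewrite Lnorm1.
have -> : \int[m]_x `|(EFin \o (h \* cst 1)%R) x| = \int[m]_x (`|h x|)%:E.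
  by apply: eq_integral => x _ /=; rewrite mulr1.
have -> : 'N[m]_(p / (p - 1))%:E[EFin \o cst (1%R : R)] = m setT `^ (p / (p - 1))^-1.
  by rewrite -Lnorm_cst1; apply: eq_Lnorm.
move=> H.
have H' := @gt0_ler_poweR R p (ltW p0) (\int[m]_x (`|h x|)%:E).
have I0 : 0 <= \int[m]_x (`|h x|)%:E by apply: integral_ge0 => x _; rewrite lee_fin.
apply: (le_trans (H' _ _ _ H)).
- by rewrite in_itv/= I0 leey.
- by rewrite in_itv/= leey andbT mule_ge0 ?Lnorm_ge0 ?poweR_ge0.
rewrite poweRM ?Lnorm_ge0 ?poweR_ge0// muleC poweR_Lnorm ?gt_eqF//.
rewrite -poweRrM (_ : (p / (p - 1))^-1 * p = p - 1)%R//.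
by field; rewrite !gt_eqF.
Qed.

End hoelder_finite.

Section variation1.
Context (R : realType) (p : R) (p1 : 1 < p).
Notation leb := (@lebesgue_measure R).

Definition segment (c s : R) : set (measurableTypeR R) := `[c, c + s[%classic.

Lemma measurable_segment (c s : R) : measurable (segment c s).
Proof. exact: measurable_itv. Qed.

Lemma lebesgue_segment (c s : R) : 0 <= s -> leb (segment c s) = s%:E.
Proof.
move=> s0; rewrite /segment lebesgue_measure_itv/= lte_fin ltrDl.
have [//|s0'] := ltP 0 s; first by rewrite -EFinB addrAC subrr add0r.
by congr EFin; apply/eqP; rewrite eq_le s0 s0'.
Qed.

Lemma lebesgue_segment_fin (c s : R) : (leb (segment c s) < +oo)%E.
Proof.
have [s0|s0] := leP 0 s; first by rewrite lebesgue_segment// ltry.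
rewrite /segment set_itv_ge ?measure0//.
by rewrite bnd_simp -leNgt gerDl ltW.
Qed.

Definition segment_measure (c s : R) :=
  mfrestr (measurable_segment c s) (lebesgue_segment_fin c s).

Lemma mrestr_integral d (T : measurableType d)
    (m : {measure set T -> \bar R}) (D : set T) (mD : measurable D)
    (g : T -> \bar R) : measurable_fun setT g -> (forall x, 0 <= g x)%E ->
  (\int[mrestr m mD]_x g x = \int[m]_(x in D) g x)%E.
Proof.
move=> mg g0; rewrite (@ge0_negligible_integral _ _ _ _ setT (~` D))//.
- rewrite setTD setCK; apply: eq_measure_integral => A mA AD.
  by rewrite /= /mrestr setIidl.
- exact: measurableC.
- by rewrite -[LHS]/(m (~` D `&` D)) setICl measure0.
Qed.

(** The fundamental theorem of calculus between [r] and [t], then Hoelder on the whole segment,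
    whose length produces [s^(p-1)]. *)
Lemma dist_powR_le_integral (g dg : R -> R) (c s t r : R) :
  (forall x : R, is_derive x 1 g (dg x)) -> continuous dg -> 0 < s ->
  c <= r < c + s -> c <= t < c + s ->
  ((`|g t - g r| `^ p)%:E <= (s `^ (p - 1))%:E *
    \int[segment_measure c s]_x (`|dg x| `^ p)%:E)%E.
Proof.
move=> gd cdg s0.
wlog : r t / r <= t.
  move=> h hr ht; have [rt|/ltW tr] := leP r t; first exact: h.
  by rewrite distrC; apply: h.
rewrite le_eqVlt => /predU1P[->|rt] /andP[cr rs] /andP[ct ts].
  rewrite subrr normr0 powR0 ?gt_eqF ?(lt_trans _ p1)//.
  by rewrite mule_ge0 ?lee_fin ?powR_ge0// integral_ge0.
have mdg : measurable_fun setT dg by exact: continuous_measurable_fun.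
have ftc : (\int[leb]_(x in `[r, t]) (dg x)%:E = (g t)%:E - (g r)%:E)%E.
  apply: continuous_FTC2 => //.
  - exact: continuous_subspaceT.
  - have cg : continuous g.
      move=> x; apply: differentiable_continuous; apply/derivable1_diffP.
      exact: (@ex_derive _ _ _ _ _ _ _ (gd x)).
    split.
    + by move=> x _; apply: (@ex_derive _ _ _ _ _ _ _ (gd x)).
    + by apply: cvg_at_right_filter; exact: cg.
    + by apply: cvg_at_left_filter; exact: cg.
  - by move=> x _; rewrite derive1E (@derive_val _ _ _ _ _ _ _ (gd x)).
have sub : [set` `[r, t]] `<=` segment c s.
  move=> x /=; rewrite /segment /= !in_itv/= => /andP[rx xt].
  by rewrite (le_trans cr)//= (le_lt_trans xt).
have mdgE : measurable_fun setT (fun x : measurableTypeR R => (`|dg x|)%:E).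
  by apply/measurable_EFinP; exact: measurableT_comp.
have bound : ((`|g t - g r|)%:E <= \int[segment_measure c s]_x (`|dg x|)%:E)%E.
  rewrite -abse_EFin EFinB -ftc.
  apply: (@le_trans _ _ (\int[leb]_(x in `[r, t]) (`|dg x|)%:E)%E).
    apply: (le_abse_integral leb) => //.
    by apply/measurable_EFinP; apply: measurable_funS mdg.
  rewrite mrestr_integral//.
  apply: ge0_subset_integral => //.
  - exact: measurable_segment.
  - exact: measurable_funS mdgE.
apply: (@le_trans _ _ ((\int[segment_measure c s]_x (`|dg x|)%:E) `^ p)%E).
  rewrite -poweR_EFin; apply: gt0_ler_poweR => //.
  - by rewrite ltW// (lt_trans _ p1).
  - by rewrite in_itv/= lee_fin normr_ge0 leey.
  - by rewrite in_itv/= leey andbT integral_ge0.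
apply: (le_trans (integral_poweR_le (segment_measure c s) p1 mdg)).
rewrite [X in (X `^ _ * _)%E](_ : _ = s%:E) ?poweR_EFin//.
by rewrite -[LHS]/(leb (setT `&` segment c s)) setTI lebesgue_segment// ltW.
Qed.

End variation1.

(** * Cubes in R^n and slicing along the first coordinate *)

Section boxes.
Context (R : realType).
Notation leb := (@lebesgue_measure R).

Lemma continuous_rV (T : topologicalType) n (phi : T -> 'rV[R]_n) :
  (forall i, continuous (fun x => phi x 0 i : R)) -> continuous phi.
Proof.
move=> cphi x A /= [B mB BA].
have : \forall y \near x, forall i, B ord0 i (phi y ord0 i).
  apply: (@filter_forall _ _ (fun i => [set y | B ord0 i (phi y ord0 i)]) (nbhs x)) => i.
  by apply: (cphi i x); exact: (mB ord0 i).
apply: filterS => y hy; apply: BA => /= i j; rewrite (ord1 i); exact: hy.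
Qed.

Lemma continuous_measurable_rV n (f : 'rV[R]_n -> R) :
  continuous f -> measurable_fun setT f.
Proof.
move=> cf; apply: (measurability _ (RGenOpens.measurableE R)) => //.
move=> _ [_ [a [b ->] <-]]; rewrite setTI; apply: open_measurable_rV.
by apply: open_comp => // *; exact: cf.
Qed.

Lemma addscale_deltaE n (h : R) (x : 'rV[R]_n) i j :
  (h *: delta_mx 0 i + x) 0 j = h * (j == i)%:R + x 0 j.
Proof. by rewrite !mxE. Qed.

Lemma rV_cons_head n (t h : R) (y : 'rV[R]_n) :
  rV_cons ((h *: (1 : R) + t : R), y) = h *: delta_mx 0 ord0 + rV_cons (t, y).
Proof.
apply/rowP => i; rewrite addscale_deltaE.
case: (unliftP ord0 i) => [j ->|->].
  by rewrite !rV_consES /= mulr0 add0r.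
by rewrite !rV_consE0 /=.
Qed.

Lemma rV_cons_tail n (t h : R) (y : 'rV[R]_n) i :
  rV_cons (t, h *: delta_mx 0 i + y) =
  h *: delta_mx 0 (lift ord0 i) + rV_cons (t, y).
Proof.
apply/rowP => j; rewrite addscale_deltaE.
case: (unliftP ord0 j) => [k ->|->].
  by rewrite !rV_consES /= addscale_deltaE (inj_eq (@lift_inj _ ord0)).
by rewrite !rV_consE0 /= mulr0 add0r.
Qed.

Lemma continuous_rV_cons_head n (y : 'rV[R]_n) :
  continuous (fun t : R => rV_cons (t, y)).
Proof.
apply: continuous_rV => i; case: (unliftP ord0 i) => [j ->|->].
  under eq_fun do rewrite rV_consES; exact: cst_continuous.
by under eq_fun do rewrite rV_consE0; move=> x.
Qed.

Lemma continuous_rV_cons_tail n (t : R) :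
  continuous (fun y : 'rV[R]_n => rV_cons (t, y)).
Proof.
apply: continuous_rV => i; case: (unliftP ord0 i) => [j ->|->].
  under eq_fun do rewrite rV_consES /=; exact: coord_continuous.
under eq_fun do rewrite rV_consE0 /=; exact: cst_continuous.
Qed.

(** Only derivatives along the axes are involved, so the class is visibly stable under freezing the
    first coordinate, as the induction on the dimension requires. *)
Definition C1 n (f : 'rV[R]_n -> R) : Prop :=
  continuous f /\ forall i, (forall x, derivable f x (delta_mx 0 i)) /\
    continuous (partial i f).

Lemma is_derive_head n (f : 'rV[R]_n.+1 -> R) (y : 'rV[R]_n) (t : R) :
  C1 f ->
  is_derive t 1 (fun r : R => f (rV_cons (r, y)))
    (partial ord0 f (rV_cons (t, y))).
Proof.
move=> [_ /(_ ord0) [df _]].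
set G := (fun r : R => f (rV_cons (r, y))).
have e : (fun h : R => h^-1 *: ((G \o shift t) (h *: 1) - G t)) =
  (fun h : R => h^-1 *: ((f \o shift (rV_cons (t, y))) (h *: delta_mx 0 ord0) - f (rV_cons (t, y)))).
  by apply/funext => h /=; rewrite -rV_cons_head.
split; first by rewrite /derivable e; exact: df.
by rewrite /derive e.
Qed.

Lemma partial_tail n (f : 'rV[R]_n.+1 -> R) (t : R) i :
  partial i (fun y : 'rV[R]_n => f (rV_cons (t, y))) =
  (fun y => partial (lift ord0 i) f (rV_cons (t, y))).
Proof.
apply/funext => y; rewrite /partial /derive.
rewrite (_ : (fun h : R => _) = (fun h : R =>
  h^-1 *: ((f \o shift (rV_cons (t, y))) (h *: delta_mx 0 (lift ord0 i)) - f (rV_cons (t, y)))))//.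
by apply/funext => h /=; rewrite rV_cons_tail.
Qed.

Lemma C1_tail n (f : 'rV[R]_n.+1 -> R) (t : R) :
  C1 f -> C1 (fun y : 'rV[R]_n => f (rV_cons (t, y))).
Proof.
move=> [cf df]; split.
  by move=> y; apply: continuous_comp; [exact: continuous_rV_cons_tail|exact: cf].
move=> i; have [dfi cfi] := df (lift ord0 i); split.
  move=> y; set G := (fun y => f (rV_cons (t, y))).
  have e : (fun h : R => h^-1 *: ((G \o shift y) (h *: delta_mx 0 i) - G y)) =
    (fun h : R => h^-1 *: ((f \o shift (rV_cons (t, y)))
      (h *: delta_mx 0 (lift ord0 i)) - f (rV_cons (t, y)))).
    by apply/funext => h /=; rewrite /G rV_cons_tail.
  by rewrite /derivable e; exact: dfi.
rewrite partial_tail => y.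
by apply: continuous_comp; [exact: continuous_rV_cons_tail|exact: cfi].
Qed.

(** Half-open, so that the cells of a grid are pairwise disjoint. *)
Definition box n (c : 'I_n -> R) (s : R) : set 'rV[R]_n :=
  [set x | forall i, c i <= x 0 i < c i + s].

Lemma measurable_box n (c : 'I_n -> R) s : measurable (box c s).
Proof.
have -> : box c s = \big[setI/setT]_(i < n)
    ((fun x : 'rV[R]_n => x 0 i) @^-1` (segment (c i) s)).
  rewrite -bigcap_seq; apply/seteqP; split => [x xq i _|x xq i].
    by rewrite /segment /= in_itv/=; exact: xq.
  have := xq i; rewrite /segment /= in_itv/=; apply.
  by rewrite mem_index_enum.
apply: bigsetI_measurable => i _; rewrite -[X in measurable X]setTI.
by apply: measurable_coor => //; exact: measurable_segment.
Qed.

Lemma box_cons n (c : 'I_n.+1 -> R) s t (y : 'rV[R]_n) :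
  box c s (rV_cons (t, y)) <->
  segment (c ord0) s t /\ box (c \o lift ord0) s y.
Proof.
split=> [h|[]]; last first.
  rewrite /segment /= in_itv/= => h0 h1 i; case: (unliftP ord0 i) => [j ->|->].
    by rewrite rV_consES; exact: h1.
  by rewrite rV_consE0.
split; first by have := h ord0; rewrite rV_consE0 /segment /= in_itv.
by move=> i; have := h (lift ord0 i); rewrite rV_consES.
Qed.

Lemma lebesgue_box n (c : 'I_n -> R) s : 0 <= s ->
  (lebesgue_rV R n (box c s) = (s ^+ n)%:E)%E.
Proof.
move=> s0; elim: n c => [|n IH] c.
  rewrite /= diracE mem_set//; by move=> [].
rewrite -[LHS]/((leb \x (lebesgue_rV R n))%E (@rV_cons R n @^-1` box c s)).
have -> : @rV_cons R n @^-1` box c s =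
    segment (c ord0) s `*` box (c \o lift ord0) s.
  by apply/seteqP; split => -[t y] /box_cons.
rewrite product_measure1E//; last 2 first.
- exact: measurable_segment.
- exact: measurable_box.
by rewrite [X in (X * _)%E](lebesgue_segment _ s0) IH -EFinM exprS.
Qed.

Lemma lebesgue_box_fin n (c : 'I_n -> R) s : 0 <= s ->
  (lebesgue_rV R n (box c s) < +oo)%E.
Proof. by move=> s0; rewrite lebesgue_box// ltry. Qed.

Definition box_measure n (c : 'I_n -> R) s (s0 : 0 <= s) :=
  mfrestr (measurable_box c s) (lebesgue_box_fin c s0).

Lemma box_measureT n (c : 'I_n -> R) s (s0 : 0 <= s) :
  box_measure c s0 setT = (s ^+ n)%:E.
Proof.
by rewrite -[LHS]/(lebesgue_rV R n (setT `&` box c s)) setTI lebesgue_box.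
Qed.

Lemma segment_measureT (c s : R) : 0 <= s -> segment_measure c s setT = s%:E.
Proof.
by move=> s0; rewrite -[LHS]/(leb (setT `&` segment c s)) setTI lebesgue_segment.
Qed.

Local Open Scope ereal_scope.

Lemma integral_rVS n (g : 'rV[R]_n.+1 -> \bar R) :
  measurable_fun setT g -> (forall x, 0 <= g x) ->
  \int[lebesgue_rV R n.+1]_x g x =
  \int[leb]_t \int[lebesgue_rV R n]_y g (rV_cons (t, y)).
Proof.
move=> mg g0.
have -> : \int[lebesgue_rV R n.+1]_x g x =
  \int[pushforward (leb \x (lebesgue_rV R n)) (@rV_cons R n)]_x g x by [].
rewrite (ge0_integral_pushforward (@measurable_rV_cons R n))//.
rewrite preimage_setT.
rewrite (fubini_tonelli1 (m1 := leb) (m2 := lebesgue_rV R n) (g \o @rV_cons R n))//.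
  by apply: (measurableT_comp mg); exact: measurable_rV_cons.
by move=> z; exact: g0.
Qed.

Lemma integral_box_prod n (c : 'I_n.+1 -> R) s (s0 : (0 <= s)%R)
    (g : 'rV[R]_n.+1 -> \bar R) :
  measurable_fun setT g -> (forall x, 0 <= g x) ->
  \int[box_measure c s0]_x g x =
  \int[segment_measure (c ord0) s \x box_measure (c \o lift ord0) s0]_z
    g (rV_cons z).
Proof.
move=> mg g0.
have mgc : measurable_fun setT (g \o @rV_cons R n).
  by apply: (measurableT_comp mg); exact: measurable_rV_cons.
have mgt t : measurable_fun setT (fun y : 'rV[R]_n => g (rV_cons (t, y))).
  exact: (measurableT_comp mgc).
rewrite (fubini_tonelli1 (m1 := segment_measure (c ord0) s)
  (m2 := box_measure (c \o lift ord0) s0) (g \o @rV_cons R n) mgc (fun=> g0 _)).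
rewrite (mrestr_integral _ (measurable_box c s) mg g0).
rewrite (mrestr_integral _ (measurable_segment (c ord0) s)); last 2 first.
- exact: (measurable_fun_fubini_tonelli_F (m2 := box_measure (c \o lift ord0) s0) (g \o @rV_cons R n) mgc (fun=> g0 _)).
- by move=> t; apply: integral_ge0 => y _; exact: g0.
rewrite [LHS]integral_mkcond [RHS]integral_mkcond.
rewrite integral_rVS; last 2 first.
- by apply/(measurable_restrictT _ (measurable_box c s)); exact: measurable_funS mg.
- by move=> x; rewrite patchE; case: ifP.
apply: eq_integral => t _; rewrite [RHS]patchE.
case: ifPn => [/set_mem ts|tNs].
  rewrite /fubini_F (mrestr_integral _ (measurable_box _ _) (mgt t) (fun=> g0 _)).
  rewrite [RHS]integral_mkcond; apply: eq_integral => y _; rewrite !patchE.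
  congr (if _ then _ else _); apply/idP/idP => /set_mem h; apply/mem_set.
    by move/box_cons : h => [].
  exact/box_cons.
apply: integral0_eq => y _; rewrite patchE ifN//.
by apply: contra tNs => /set_mem /box_cons[h _]; exact/mem_set.
Qed.

Lemma mrestr_le_integral d (T : measurableType d)
    (m : {measure set T -> \bar R}) (D : set T) (mD : measurable D)
    (f g : T -> \bar R) :
  measurable_fun setT f -> measurable_fun setT g -> (forall x, 0 <= f x) ->
  (forall x, 0 <= g x) -> (forall x, D x -> f x <= g x) ->
  \int[mrestr m mD]_x f x <= \int[mrestr m mD]_x g x.
Proof.
move=> mf mg f0 g0 fg; rewrite !mrestr_integral//.
by apply: ge0_le_integral => //; exact: measurable_funTS.
Qed.

Section variation_box.
Context (p : R) (p1 : (1 < p)%R).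
Let p0 : (0 < p)%R. Proof. exact: lt_trans p1. Qed.

(** The recursion of [variation_prod]: the factor [2^p] pays for changing the coordinates in two
    stages, 1 accounts for the new coordinate and [box_constant n'] for the others. *)
Fixpoint box_constant (n : nat) : R :=
  if n is n'.+1 then (2 `^ p * (1 + box_constant n'))%R else 0%R.

Lemma box_constant_ge0 n : (0 <= box_constant n)%R.
Proof.
by elim: n => //= n IH; rewrite mulr_ge0 ?powR_ge0// addr_ge0.
Qed.

Lemma variation_segment (g dg : R -> R) (c s : R) :
  (forall x : R, is_derive x 1%R g (dg x)) -> continuous dg -> (0 < s)%R ->
  variation p (segment_measure c s) g <=
  (s * s `^ p)%:E * \int[segment_measure c s]_x (`|dg x| `^ p)%:E.
Proof.
move=> gd cdg s0.
have cg : continuous g.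
  move=> x; apply: differentiable_continuous; apply/derivable1_diffP.
  exact: (@ex_derive _ _ _ _ _ _ _ (gd x)).
have mg : measurable_fun setT (g : measurableTypeR R -> R).
  exact: continuous_measurable_fun.
pose K := \int[segment_measure c s]_x (`|dg x| `^ p)%:E.
have K0 : 0 <= K by apply: integral_ge0 => x _; rewrite lee_fin powR_ge0.
have sp0 : 0 <= (s `^ (p - 1))%:E :> \bar R by rewrite lee_fin powR_ge0.
have pos (x : R) : 0 <= (x `^ p)%:E :> \bar R by rewrite lee_fin powR_ge0.
pose G (z : measurableTypeR R * measurableTypeR R) := (`|g z.1 - g z.2| `^ p)%:E.
have mG : measurable_fun setT G.
  by apply: measurable_dist_powR; exact: measurableT_comp.
rewrite /variation.
apply: (@le_trans _ _ (\int[segment_measure c s]_t (s%:E * ((s `^ (p - 1))%:E * K)))).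
  apply: mrestr_le_integral.
  - exact: (measurable_fun_fubini_tonelli_F (m2 := segment_measure c s) G mG (fun=> pos _)).
  - exact: measurable_cst.
  - by move=> x; apply: integral_ge0 => y _; exact: pos.
  - by move=> x; rewrite !mule_ge0// lee_fin ltW.
  move=> t; rewrite /segment /= in_itv/= => tcs.
  apply: (@le_trans _ _ (\int[segment_measure c s]_r ((s `^ (p - 1))%:E * K))).
    apply: mrestr_le_integral.
    - by apply: measurable_dist_powR; [exact: measurable_cst|].
    - exact: measurable_cst.
    - by move=> x; exact: pos.
    - by move=> x; rewrite mule_ge0.
    move=> r; rewrite /segment /= in_itv/= => rcs.
    exact: (dist_powR_le_integral p1 gd cdg s0 rcs tcs).
  rewrite (integral_cst (segment_measure c s) measurableT) muleC.
  by rewrite [X in X * _ <= _](segment_measureT c (ltW s0)).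
rewrite (integral_cst (segment_measure c s) measurableT) muleC.
rewrite [X in X * _ <= _](segment_measureT c (ltW s0)) !muleA -!EFinM.
by rewrite -mulrA (mulr_powRB1 (ltW s0) p0).
Qed.

Lemma measurable_partial_powR n (f : 'rV[R]_n -> R) i : C1 f ->
  measurable_fun setT (fun x => (`|partial i f x| `^ p)%:E).
Proof.
move=> [_ /(_ i)[_ cf]]; apply/measurable_EFinP.
apply: (measurableT_comp (measurable_powR p)).
by apply: measurableT_comp => //; exact: continuous_measurable_rV.
Qed.

(** Induction on the dimension by [variation_prod]. The factor [s^p] is the gain from one
    derivative, and [s^n] is the volume left by the second integration. *)
Lemma variation_box n (c : 'I_n -> R) s (s0 : (0 < s)%R)
    (f : 'rV[R]_n -> R) : C1 f ->
  variation p (box_measure c (ltW s0)) f <=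
  (box_constant n * s `^ p * s ^+ n)%:E *
  \sum_(i < n) \int[box_measure c (ltW s0)]_x (`|partial i f x| `^ p)%:E.
Proof.
have pos (x : R) : 0 <= (x `^ p)%:E :> \bar R by rewrite lee_fin powR_ge0.
elim: n c f => [|n IH] c f C1f.
  rewrite big_ord0 mule0 /variation [leLHS](_ : _ = 0)//.
  apply: integral0_eq => x _; apply: integral0_eq => y _.
  by rewrite (thinmx0 x) (thinmx0 y) subrr normr0 powR0// gt_eqF.
pose m1 := segment_measure (c ord0) s.
pose m2 := box_measure (c \o lift ord0) (ltW s0).
have [cf df] := C1f.
have mf : measurable_fun setT f by exact: continuous_measurable_rV.
have mfc : measurable_fun setT (f \o @rV_cons R n).
  by apply: (measurableT_comp mf); exact: measurable_rV_cons.
have varE : variation p (box_measure c (ltW s0)) f =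
    variation p (m1 \x m2) (f \o @rV_cons R n).
  rewrite /variation integral_box_prod.
  - apply: eq_integral => z _; rewrite integral_box_prod//.
    by apply: measurable_dist_powR => //; exact: measurable_cst.
  - rewrite (_ : (fun x => _) = (fun x => \int[m1]_t \int[m2]_y (`|f x - f (rV_cons (t, y))| `^ p)%:E)).
      pose G3 (w : ('rV[R]_n.+1 * measurableTypeR R) * 'rV[R]_n) : \bar R :=
        (`|f w.1.1 - f (rV_cons (w.1.2, w.2))| `^ p)%:E.
      have mG3 : measurable_fun setT G3.
        apply: measurable_dist_powR.
          apply: (measurableT_comp mf).
          exact: (measurableT_comp measurable_fst measurable_fst).
        apply: (measurableT_comp mfc).
        apply/measurable_fun_pairP; split; last exact: measurable_snd.
        exact: (measurableT_comp measurable_snd measurable_fst).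
      pose G2 w := \int[m2]_y G3 (w, y).
      have mG2 : measurable_fun setT G2.
        exact: (measurable_fun_fubini_tonelli_F G3 mG3 (fun=> pos _)).
      have G20 w : 0 <= G2 w by apply: integral_ge0 => y _; exact: pos.
      exact: (measurable_fun_fubini_tonelli_F (m2 := m1) G2 mG2 G20).
    apply/funext => x; rewrite integral_box_prod//; last first.
      by apply: measurable_dist_powR => //; exact: measurable_cst.
    rewrite (fubini_tonelli1 (m1 := m1) (m2 := m2) (fun z => (`|f x - f (rV_cons z)| `^ p)%:E))//.
    by apply: measurable_dist_powR => //; exact: measurable_cst.
  - by move=> x; apply: integral_ge0 => y _; exact: pos.
rewrite varE; apply: (le_trans (variation_prod p0 m1 m2 mfc)).
have bc := box_constant_ge0 n.
have sn0 : (0 <= s ^+ n)%R by rewrite exprn_ge0// ltW.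
pose I i := \int[box_measure c (ltW s0)]_x (`|partial i f x| `^ p)%:E.
have I0 i : 0 <= I i by apply: integral_ge0 => x _; exact: pos.
have IE1 i : I i = \int[m1]_t \int[m2]_y (`|partial i f (rV_cons (t, y))| `^ p)%:E.
  rewrite /I integral_box_prod//; last exact: measurable_partial_powR.
  rewrite (fubini_tonelli1 (m1 := m1) (m2 := m2) (fun z => (`|partial i f (rV_cons z)| `^ p)%:E))//.
  apply: (measurableT_comp (measurable_partial_powR i C1f)).
  exact: measurable_rV_cons.
have IE2 i : I i = \int[m2]_y \int[m1]_t (`|partial i f (rV_cons (t, y))| `^ p)%:E.
  rewrite /I integral_box_prod//; last exact: measurable_partial_powR.
  rewrite (fubini_tonelli2 (m1 := m1) (m2 := m2) (fun z => (`|partial i f (rV_cons z)| `^ p)%:E))//.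
  apply: (measurableT_comp (measurable_partial_powR i C1f)).
  exact: measurable_rV_cons.
have mpc i : measurable_fun setT (fun z => (`|partial i f (@rV_cons R n z)| `^ p)%:E).
  apply: (measurableT_comp (measurable_partial_powR i C1f)).
  exact: measurable_rV_cons.
have mvar1 : measurable_fun setT (fun y : 'rV[R]_n =>
    variation p m1 (fun t => (f \o @rV_cons R n) (t, y))).
  pose G3 (w : ('rV[R]_n * measurableTypeR R) * measurableTypeR R) : \bar R :=
    (`|f (rV_cons (w.1.2, w.1.1)) - f (rV_cons (w.2, w.1.1))| `^ p)%:E.
  have mG3 : measurable_fun setT G3.
    apply: measurable_dist_powR; apply: (measurableT_comp mfc).
      apply/measurable_fun_pairP; split.
        exact: (measurableT_comp measurable_snd measurable_fst).
      exact: (measurableT_comp measurable_fst measurable_fst).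
    apply/measurable_fun_pairP; split; first exact: measurable_snd.
    exact: (measurableT_comp measurable_fst measurable_fst).
  pose G2 w := \int[m1]_y G3 (w, y).
  have mG2 : measurable_fun setT G2.
    exact: (measurable_fun_fubini_tonelli_F (m2 := m1) G3 mG3 (fun=> pos _)).
  have G20 w : 0 <= G2 w by apply: integral_ge0 => y _; exact: pos.
  exact: (measurable_fun_fubini_tonelli_F (m2 := m1) G2 mG2 G20).
have mvar2 : measurable_fun setT (fun t : measurableTypeR R =>
    variation p m2 (fun y => (f \o @rV_cons R n) (t, y))).
  pose G3 (w : (measurableTypeR R * 'rV[R]_n) * 'rV[R]_n) : \bar R :=
    (`|f (rV_cons (w.1.1, w.1.2)) - f (rV_cons (w.1.1, w.2))| `^ p)%:E.
  have mG3 : measurable_fun setT G3.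
    apply: measurable_dist_powR; apply: (measurableT_comp mfc).
      apply/measurable_fun_pairP; split.
        exact: (measurableT_comp measurable_fst measurable_fst).
      exact: (measurableT_comp measurable_snd measurable_fst).
    apply/measurable_fun_pairP; split; last exact: measurable_snd.
    exact: (measurableT_comp measurable_fst measurable_fst).
  pose G2 w := \int[m2]_y G3 (w, y).
  have mG2 : measurable_fun setT G2.
    exact: (measurable_fun_fubini_tonelli_F G3 mG3 (fun=> pos _)).
  have G20 w : 0 <= G2 w by apply: integral_ge0 => y _; exact: pos.
  exact: (measurable_fun_fubini_tonelli_F (m2 := m2) G2 mG2 G20).
have vp d (T : measurableType d) (m : {measure set T -> \bar R}) (h : T -> R) : 0 <= variation p m h.
  by apply: integral_ge0 => x _; apply: integral_ge0 => y _; exact: pos.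
have A1 : \int[m2]_y variation p m1 (fun t => (f \o @rV_cons R n) (t, y)) <=
    (s * s `^ p)%:E * I ord0.
  rewrite IE2 -ge0_integralZl//; last 3 first.
  - exact: (measurable_fun_fubini_tonelli_G (m1 := m1) _ (mpc ord0) (fun=> pos _)).
  - by move=> y _; apply: integral_ge0 => t _; exact: pos.
  - by rewrite lee_fin mulr_ge0 ?powR_ge0// ltW.
  apply: ge0_le_integralT => //.
  - apply: measurable_funeM.
    exact: (measurable_fun_fubini_tonelli_G (m1 := m1) _ (mpc ord0) (fun=> pos _)).
  - by move=> y; exact: vp.
  move=> y; apply: (variation_segment (dg := fun t => partial ord0 f (rV_cons (t, y)))) => //.
    by move=> t; exact: is_derive_head.
  move=> t; apply: continuous_comp; first exact: continuous_rV_cons_head.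
  exact: (df ord0).2.
have A2 : \int[m1]_t variation p m2 (fun y => (f \o @rV_cons R n) (t, y)) <=
    (box_constant n * s `^ p * s ^+ n)%:E * \sum_(i < n) I (lift ord0 i).
  have -> : \sum_(i < n) I (lift ord0 i) = \int[m1]_t \sum_(i < n)
      \int[m2]_y (`|partial (lift ord0 i) f (rV_cons (t, y))| `^ p)%:E.
    rewrite ge0_integral_sum//.
    - by apply: eq_bigr => i _; rewrite IE1.
    - by move=> i; exact: (measurable_fun_fubini_tonelli_F (m2 := m2) _ (mpc (lift ord0 i)) (fun=> pos _)).
    - by move=> i t _; apply: integral_ge0 => y _; exact: pos.
  have mS : measurable_fun setT (fun t : measurableTypeR R => \sum_(i < n)
      \int[m2]_y (`|partial (lift ord0 i) f (rV_cons (t, y))| `^ p)%:E).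
    apply: emeasurable_sum => i.
    exact: (measurable_fun_fubini_tonelli_F (m2 := m2) _ (mpc (lift ord0 i)) (fun=> pos _)).
  have S0 (t : measurableTypeR R) : 0 <= \sum_(i < n)
      \int[m2]_y (`|partial (lift ord0 i) f (rV_cons (t, y))| `^ p)%:E.
    by apply: sume_ge0 => i _; apply: integral_ge0 => y _; exact: pos.
  rewrite -ge0_integralZl//; last first.
    by rewrite lee_fin !mulr_ge0 ?powR_ge0.
  apply: ge0_le_integralT => //; [exact: measurable_funeM|by move=> t; exact: vp|].
  move=> t; apply: (le_trans (IH _ _ (C1_tail t C1f))).
  apply: lee_wpmul2l; first by rewrite lee_fin !mulr_ge0 ?powR_ge0.
  by apply: lee_sum => i _; rewrite partial_tail.
rewrite [X in _ <= _ * X](_ : _ = I ord0 + \sum_(i < n) I (lift ord0 i)); last exact: big_ord_recl.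
rewrite [X in _ * (_ + X * _)](segment_measureT _ (ltW s0)).
rewrite [X in _ * (X * _ + _)](box_measureT _ (ltW s0)).
set S := \sum_(i < n) I (lift ord0 i) in A2 *.
have S0 : 0 <= S by apply: sume_ge0.
have H1 : (s ^+ n)%:E * \int[m2]_y variation p m1 (fun t => (f \o @rV_cons R n) (t, y)) <=
    ((1 + box_constant n) * s `^ p * s ^+ n.+1)%:E * I ord0.
  apply: (@le_trans _ _ ((s ^+ n)%:E * ((s * s `^ p)%:E * I ord0))).
    by rewrite lee_wpmul2l ?lee_fin.
  rewrite muleA -EFinM lee_wpmul2r// lee_fin.
  rewrite (_ : (_ * (s * _))%R = (s `^ p * s ^+ n.+1)%R); last by rewrite exprS; ring.
  rewrite -mulrA; apply: ler_peMl; last by rewrite lerDl.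
  by rewrite mulr_ge0 ?powR_ge0// exprn_ge0// ltW.
have H2 : s%:E * \int[m1]_t variation p m2 (fun y => (f \o @rV_cons R n) (t, y)) <=
    ((1 + box_constant n) * s `^ p * s ^+ n.+1)%:E * S.
  apply: (@le_trans _ _ (s%:E * ((box_constant n * s `^ p * s ^+ n)%:E * S))).
    by rewrite lee_wpmul2l ?lee_fin// ltW.
  rewrite muleA -EFinM lee_wpmul2r// lee_fin.
  rewrite (_ : (s * _)%R = (box_constant n * (s `^ p * s ^+ n.+1))%R); last by rewrite exprS; ring.
  rewrite -mulrA; apply: ler_wpM2r; last by rewrite lerDr.
  by rewrite mulr_ge0 ?powR_ge0// exprn_ge0// ltW.
have -> : (box_constant n.+1 * s `^ p * s ^+ n.+1)%:E = (2 `^ p)%:E *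
    ((1 + box_constant n) * s `^ p * s ^+ n.+1)%:E.
  by rewrite -EFinM /= !mulrA.
rewrite -muleA; apply: lee_wpmul2l; first exact: pos.
by rewrite (ge0_muleDr _ (I0 ord0) S0); apply: leeD; [exact: H1|exact: H2].
Qed.

End variation_box.
End boxes.

(** * Distance to the mean value *)

Section mean_value.
Local Open Scope ereal_scope.
Context (R : realType) (p : R) (p1 : (1 < p)%R).
Let p0 : (0 < p)%R. Proof. exact: lt_trans p1. Qed.
Context d (T : measurableType d).
Context (m : {finite_measure set T -> \bar R}) (V : R) (V0 : (0 < V)%R).
Context (mV : m setT = V%:E).

Lemma bounded_integrable (f : T -> R) (M : R) : measurable_fun setT f ->
  (forall x, `|f x| <= M)%R -> m.-integrable setT (EFin \o f).
Proof.
move=> mf fM; apply: measurable_bounded_integrable => //.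
  by rewrite [X in X < _](_ : _ = V%:E) ?ltry.
exists M; split; first exact: num_real.
by move=> N MN x _ /=; rewrite (le_trans (fM x))// ltW.
Qed.

(** [V (f x - mean)] is the integral of [f x - f y] over [y], so the claim is Jensen's inequality,
    obtained from Hoelder. *)
Lemma dist_mean_le (f : T -> R) (M : R) x : measurable_fun setT f ->
  (forall x, `|f x| <= M)%R ->
  (`|f x - V^-1 * \int[m]_y f y| `^ p)%:E <=
  V^-1%:E * \int[m]_y (`|f x - f y| `^ p)%:E.
Proof.
move=> mf fM; set A := (V^-1 * _)%R.
have intf := bounded_integrable mf fM.
have intc : m.-integrable setT (EFin \o cst (f x)).
  by apply: (@bounded_integrable _ `|f x|) => //; exact: measurable_cst.
have mfx : measurable_fun setT (fun y => f x - f y)%R.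
  by apply: measurable_funB => //; exact: measurable_cst.
have VA : (V * (f x - A) = \int[m]_y (f x - f y))%R.
  rewrite RintegralB// Rintegral_cst// [X in (_ * fine X - _)%R](_ : _ = V%:E)//=.
  rewrite /A mulrBr mulrA mulfV ?gt_eqF//.
  by rewrite mul1r mulrC.
have int_le : ((V * `|f x - A|)%R)%:E <= \int[m]_y (`|f x - f y|)%:E.
  have -> : (V * `|f x - A| = `|V * (f x - A)|)%R by rewrite normrM gtr0_norm.
  rewrite VA EFin_normr_Rintegral//; last first.
    exact: (integrableB measurableT intc intf).
  apply: (le_abse_integral m) => //.
  exact/measurable_EFinP.
have pow : ((V * `|f x - A|) `^ p)%:E <=
    (V `^ (p - 1))%:E * \int[m]_y (`|f x - f y| `^ p)%:E.
  apply: (@le_trans _ _ ((\int[m]_y (`|f x - f y|)%:E) `^ p)).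
    rewrite -poweR_EFin; apply: gt0_ler_poweR => //.
    - by rewrite ltW.
    - by rewrite in_itv/= lee_fin mulr_ge0 ?(ltW V0)//= leey.
    - by rewrite in_itv/= leey andbT integral_ge0.
  apply: (le_trans (integral_poweR_le m p1 mfx)).
  by rewrite [X in X `^ _ * _ <= _](_ : _ = V%:E) ?poweR_EFin.
have Vp : (0 < V `^ p)%R by rewrite powR_gt0.
have -> : (`|f x - A| `^ p)%:E = ((V `^ p)^-1)%:E * ((V * `|f x - A|) `^ p)%:E.
  by rewrite -EFinM powRM ?(ltW V0)// mulrA mulVf ?gt_eqF// mul1r.
have -> : (V^-1)%:E = ((V `^ p)^-1)%:E * (V `^ (p - 1))%:E.
  rewrite -EFinM; congr EFin; rewrite -(mulr_powRB1 (ltW V0) p0) invfM -mulrA mulVf ?mulr1//.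
  by rewrite gt_eqF ?powR_gt0.
by rewrite -muleA lee_wpmul2l// lee_fin invr_ge0 ltW.
Qed.

(** The Poincare-Wirtinger inequality with the mean moved to the right-hand side: the means over
    cubes will be the finitely many linear forms of the Ehrling inequality. *)
Lemma integral_powR_mean (f : T -> R) (M : R) : measurable_fun setT f ->
  (forall x, `|f x| <= M)%R ->
  \int[m]_x (`|f x| `^ p)%:E <= (2 `^ p)%:E *
    (V^-1%:E * variation p m f + (V `^ (1 - p) * `|\int[m]_x f x| `^ p)%:E).
Proof.
move=> mf fM; set A := (V^-1 * \int[m]_x f x)%R.
have pos (x : R) : 0 <= (x `^ p)%:E :> \bar R by rewrite lee_fin powR_ge0.
pose G (z : T * T) := (`|f z.1 - f z.2| `^ p)%:E.
have mG : measurable_fun setT G.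
  by apply: measurable_dist_powR; exact: measurableT_comp.
have mH : measurable_fun setT (fun x => \int[m]_y (`|f x - f y| `^ p)%:E).
  exact: (measurable_fun_fubini_tonelli_F (m2 := m) G mG (fun=> pos _)).
have H0 x : 0 <= \int[m]_y (`|f x - f y| `^ p)%:E.
  by apply: integral_ge0 => y _; exact: pos.
have Vi : 0 <= (V^-1)%:E :> \bar R by rewrite lee_fin invr_ge0 ltW.
apply: (@le_trans _ _ (\int[m]_x ((2 `^ p)%:E * (V^-1%:E * (\int[m]_y (`|f x - f y| `^ p)%:E) + (`|A| `^ p)%:E)))).
  apply: ge0_le_integralT.
  - apply/measurable_EFinP; apply: (measurableT_comp (measurable_powR p)).
    exact: measurableT_comp.
  - apply: measurable_funeM; apply: emeasurable_funD; last exact: measurable_cst.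
    exact: measurable_funeM.
  - by move=> x; exact: pos.
  move=> x; apply: (@le_trans _ _ ((2 `^ p)%:E * ((`|f x - A| `^ p)%:E + (`|A| `^ p)%:E))).
    rewrite -EFinD -EFinM lee_fin.
    apply: (le_trans _ (powRD_le p0 (normr_ge0 _) (normr_ge0 _))).
    by rewrite powR_le ?(ltW p0)// -{1}(subrK A (f x)) ler_normD.
  rewrite lee_wpmul2l// leeD2r//; exact: (dist_mean_le _ mf fM).
rewrite ge0_integralZl//; last 2 first.
- by apply: emeasurable_funD; [exact: measurable_funeM|exact: measurable_cst].
- by move=> x _; rewrite adde_ge0// mule_ge0.
rewrite lee_wpmul2l// ge0_integralDT//; last 2 first.
- exact: measurable_funeM.
- by move=> x; rewrite mule_ge0.
rewrite leeD//; first by rewrite ge0_integralZl.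
rewrite integral_cst// [X in _ * X <= _](_ : _ = V%:E)// -EFinM lee_fin.
rewrite /A normrM powRM// gtr0_norm ?invr_gt0// mulrAC ler_wpM2r ?powR_ge0//.
rewrite -powR_inv1 ?(ltW V0)// -powRrM mulN1r mulrC -{1}[V]powRr1 ?(ltW V0)//.
by rewrite [leRHS]powRD//; apply/implyP => _; rewrite gt_eqF.
Qed.

End mean_value.

(** * Grids of small cubes *)

Section grid.
Local Open Scope ereal_scope.
Context (R : realType) (n : nat) (L : R) (L0 : (0 < L)%R) (M : nat) (M0 : (0 < M)%N).
Local Notation leb := (lebesgue_rV R n).
Let s : R := (L *+ 2 / M%:R)%R.
Let Mr0 : (0 < M%:R :> R)%R. Proof. by rewrite ltr0n. Qed.
Lemma grid_step_gt0 : (0 < L *+ 2 / M%:R :> R)%R.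
Proof. by rewrite divr_gt0// pmulrn_rgt0. Qed.
Let s0 : (0 < s)%R. Proof. exact: grid_step_gt0. Qed.

(** The cells with these corners are the [M^n] half-open cubes of side [2L/M] that partition
    [[-L, L)^n]. *)
Definition grid_corner (k : {ffun 'I_n -> 'I_M}) (i : 'I_n) : R :=
  (- L + (k i)%:R * (L *+ 2 / M%:R))%R.

Lemma grid_disjoint (k l : {ffun 'I_n -> 'I_M}) x :
  box (grid_corner k) s x -> box (grid_corner l) s x -> k = l.
Proof.
move=> kx lx; apply/ffunP => i; apply/val_inj/eqP; rewrite eqn_leq.
have le_of (a b : {ffun 'I_n -> 'I_M}) : box (grid_corner a) s x ->
    box (grid_corner b) s x -> (a i <= b i)%N.
  move=> /(_ i)/andP[ax _] /(_ i)/andP[_ xb].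
  have := le_lt_trans ax xb; rewrite /grid_corner -/s -addrA ltrD2l.
  by rewrite -[X in (_ < _ + X)%R]mul1r -mulrDl ltr_pM2r// natr1 ltr_nat ltnS.
by rewrite !le_of.
Qed.

Lemma grid_cover (x : 'rV[R]_n) : (forall i, `|x 0 i| < L)%R ->
  exists k, box (grid_corner k) s x.
Proof.
move=> xL.
have pos i : (0 <= (x 0 i + L) / s)%R.
  by rewrite divr_ge0 ?(ltW s0)//; have := xL i; rewrite ltr_norml => /andP[]; lra.
have lt i : (Num.truncn ((x 0 i + L) / s)%R < M)%N.
  have h : ((Num.truncn ((x 0 i + L) / s)%R)%:R <= (x 0 i + L) / s)%R.
    by rewrite truncn_le.
  rewrite -(ltr_nat R) (le_lt_trans h)//.
  rewrite ltr_pdivrMr// /s mulrCA mulfV ?gt_eqF// mulr1.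
  by have := xL i; rewrite ltr_norml => /andP[]; lra.
exists [ffun i => Ordinal (lt i)] => i; rewrite /grid_corner ffunE/= -/s.
have h1 : ((Num.truncn ((x 0 i + L) / s)%R)%:R <= (x 0 i + L) / s)%R.
  by rewrite truncn_le.
have h2 := truncnS_gt ((x 0 i + L) / s)%R.
rewrite ler_pdivlMr// in h1; rewrite ltr_pdivrMr// -natr1 mulrDl mul1r in h2.
apply/andP; split; lra.
Qed.

Lemma grid_integral_le (g : 'rV[R]_n -> \bar R) :
  measurable_fun setT g -> (forall x, 0 <= g x) ->
  \sum_(k : {ffun 'I_n -> 'I_M}) \int[box_measure (grid_corner k) (ltW s0)]_x g x <=
  \int[leb]_x g x.
Proof.
move=> mg g0.
have E k : \int[box_measure (grid_corner k) (ltW s0)]_x g x =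
    \int[leb]_x (g \_ (box (grid_corner k) s)) x.
  by rewrite (mrestr_integral _ (measurable_box _ _) mg g0) integral_mkcond.
have mp k : measurable_fun setT (g \_ (box (grid_corner k) s)).
  apply/(measurable_restrictT _ (measurable_box _ s)); exact: measurable_funS mg.
have p0 k x : 0 <= (g \_ (box (grid_corner k) s)) x.
  by rewrite patchE; case: ifP.
rewrite (eq_bigr _ (fun k _ => E k)) -ge0_integral_sum//.
apply: ge0_le_integralT => //.
- exact: emeasurable_sum.
- by move=> x; apply: sume_ge0.
move=> x; have [[k kx]|nk] := pselect (exists k, box (grid_corner k) s x).
  rewrite (bigD1 k)//= big1 ?adde0; last first.
    move=> l lk; rewrite patchE ifN//; apply/negP => /set_mem lx.
    by move/eqP: lk; apply; exact: grid_disjoint lx kx.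
  by rewrite patchE mem_set.
rewrite big1// => k _; rewrite patchE ifN//; apply/negP => /set_mem kx.
by apply: nk; exists k.
Qed.

Lemma grid_integral_ge (g : 'rV[R]_n -> \bar R) :
  measurable_fun setT g -> (forall x, 0 <= g x) ->
  (forall x, g x != 0 -> forall i, `|x 0%R i| < L)%R ->
  \int[leb]_x g x <=
  \sum_(k : {ffun 'I_n -> 'I_M}) \int[box_measure (grid_corner k) (ltW s0)]_x g x.
Proof.
move=> mg g0 gL.
have E k : \int[box_measure (grid_corner k) (ltW s0)]_x g x =
    \int[leb]_x (g \_ (box (grid_corner k) s)) x.
  by rewrite (mrestr_integral _ (measurable_box _ _) mg g0) integral_mkcond.
have mp k : measurable_fun setT (g \_ (box (grid_corner k) s)).
  apply/(measurable_restrictT _ (measurable_box _ s)); exact: measurable_funS mg.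
have p0 k x : 0 <= (g \_ (box (grid_corner k) s)) x.
  by rewrite patchE; case: ifP.
rewrite (eq_bigr _ (fun k _ => E k)) -ge0_integral_sum//.
apply: ge0_le_integralT => //; first exact: emeasurable_sum.
move=> x; have [->|gx0] := eqVneq (g x) 0; first by apply: sume_ge0.
have [k kx] := grid_cover (gL x gx0).
by rewrite (bigD1 k)//= patchE mem_set// leeDl// sume_ge0.
Qed.

Context (p : R) (p1 : (1 < p)%R).
Let p0 : (0 < p)%R. Proof. exact: lt_trans p1. Qed.

(** On each cell the volume [s^n] from [variation_box] cancels the normalisation of the mean. What
    remains in front of the gradient is a multiple of [s^p], small for a fine grid. *)
Lemma grid_estimate (f : 'rV[R]_n -> R) (B : R) : C1 f ->
  (forall x, `|f x| <= B)%R ->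
  (forall x, f x != 0%R -> forall i, `|x 0%R i| < L)%R ->
  \int[leb]_x (`|f x| `^ p)%:E <=
  (2 `^ p * box_constant p n * s `^ p)%:E *
     (\sum_(i < n) \int[leb]_x (`|partial i f x| `^ p)%:E) +
  (2 `^ p * (s ^+ n) `^ (1 - p) * \sum_(k : {ffun 'I_n -> 'I_M})
     `|\int[box_measure (grid_corner k) (ltW s0)]_x f x| `^ p)%:E.
Proof.
move=> C1f fB fL.
have pos (x : R) : 0 <= (x `^ p)%:E :> \bar R by rewrite lee_fin powR_ge0.
have mf : measurable_fun setT f by apply: continuous_measurable_rV; have [] := C1f.
have V0 : (0 < s ^+ n)%R by rewrite exprn_gt0.
have bc := box_constant_ge0 p n.
have C0 : 0 <= (2 `^ p * box_constant p n * s `^ p)%:E :> \bar R.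
  by rewrite lee_fin !mulr_ge0 ?powR_ge0.
have mp i := measurable_partial_powR p i C1f.
apply: (le_trans (grid_integral_ge _ _ _)) => //.
- apply/measurable_EFinP; apply: (measurableT_comp (measurable_powR p)).
  exact: measurableT_comp.
- move=> x fx0; apply: fL; apply: contra fx0 => /eqP ->.
  by rewrite normr0 powR0// gt_eqF.
pose I k i := \int[box_measure (grid_corner k) (ltW s0)]_x (`|partial i f x| `^ p)%:E.
have I0 k i : 0 <= I k i by apply: integral_ge0 => x _; exact: pos.
pose a k := (2 `^ p * (s ^+ n) `^ (1 - p) *
  `|\int[box_measure (grid_corner k) (ltW s0)]_x f x| `^ p)%R.
apply: (@le_trans _ _ (\sum_(k : {ffun 'I_n -> 'I_M})
    ((2 `^ p * box_constant p n * s `^ p)%:E * \sum_(i < n) I k i + (a k)%:E))).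
  apply: lee_sum => k _.
  apply: (le_trans (integral_powR_mean p1 V0 (box_measureT _ (ltW s0)) mf fB)).
  have S0 : 0 <= \sum_(i < n) I k i by apply: sume_ge0.
  apply: (@le_trans _ _ ((2 `^ p)%:E * ((box_constant p n * s `^ p)%:E * (\sum_(i < n) I k i) +
    ((s ^+ n) `^ (1 - p) * `|\int[box_measure (grid_corner k) (ltW s0)]_x f x| `^ p)%:E))).
    apply: lee_wpmul2l; first exact: pos.
    apply: leeD2r.
    apply: (@le_trans _ _ (((s ^+ n)^-1)%:E * ((box_constant p n * s `^ p * s ^+ n)%:E * \sum_(i < n) I k i))).
      apply: lee_wpmul2l; first by rewrite lee_fin invr_ge0 ltW.
      exact: (variation_box p1 _ s0 C1f).
    rewrite muleA -EFinM [X in X%:E * _ <= _](_ : _ = box_constant p n * s `^ p)%R//.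
    by rewrite mulrC mulfK// gt_eqF.
  rewrite ge0_muleDr; last 2 first.
  - by rewrite mule_ge0// lee_fin mulr_ge0 ?powR_ge0.
  - by rewrite lee_fin mulr_ge0 ?powR_ge0.
  by rewrite muleA -!EFinM /a !mulrA.
rewrite big_split/=; apply: leeD.
  rewrite -ge0_sume_distrr; last by move=> k _; apply: sume_ge0.
  apply: lee_wpmul2l => //; rewrite exchange_big/=; apply: lee_sum => i _.
  by apply: grid_integral_le => // x; exact: pos.
by rewrite sumEFin /a -mulr_sumr.
Qed.

End grid.

Section poincare.
Local Open Scope ereal_scope.
Context (R : realType) (p : R) (p1 : (1 < p)%R) (L : R) (L0 : (0 < L)%R).

(** On each line parallel to the first axis [f] vanishes at the endpoint [-L], so its values are
    controlled by the first partial derivative along a segment of length [2L]. *)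
Lemma poincare_rV n (f : 'rV[R]_n.+1 -> R) : C1 f ->
  (forall x, f x != 0%R -> forall i, `|x 0%R i| < L)%R ->
  \int[lebesgue_rV R n.+1]_x (`|f x| `^ p)%:E <=
  ((L *+ 2) `^ p)%:E * \int[lebesgue_rV R n.+1]_x (`|partial ord0 f x| `^ p)%:E.
Proof.
move=> C1f fL; set s := (L *+ 2)%R.
have s0 : (0 < s)%R by rewrite pmulrn_rgt0.
have p0 : (0 < p)%R by exact: lt_trans p1.
have pos (x : R) : 0 <= (x `^ p)%:E :> \bar R by rewrite lee_fin powR_ge0.
have [cf df] := C1f.
have mf : measurable_fun setT f by exact: continuous_measurable_rV.
have mfc : measurable_fun setT (f \o @rV_cons R n).
  by apply: (measurableT_comp mf); exact: measurable_rV_cons.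
have mfp : measurable_fun setT (fun x => (`|f x| `^ p)%:E).
  apply/measurable_EFinP; apply: (measurableT_comp (measurable_powR p)).
  exact: measurableT_comp.
have mdp := measurable_partial_powR p ord0 C1f.
have mdpc : measurable_fun setT (fun z => (`|partial ord0 f (@rV_cons R n z)| `^ p)%:E).
  by apply: (measurableT_comp mdp); exact: measurable_rV_cons.
have mfpc : measurable_fun setT (fun z => (`|f (@rV_cons R n z)| `^ p)%:E).
  by apply: (measurableT_comp mfp); exact: measurable_rV_cons.
pose seg := segment_measure (- L) s.
pose K (y : 'rV[R]_n) := \int[seg]_t (`|partial ord0 f (rV_cons (t, y))| `^ p)%:E.
have mK : measurable_fun setT K.
  exact: (measurable_fun_fubini_tonelli_G (m1 := seg) _ mdpc (fun=> pos _)).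
have K0 y : 0 <= K y by apply: integral_ge0 => t _; exact: pos.
have fseg t y : f (rV_cons (t, y)) != 0%R -> segment (- L) s t.
  move=> /fL /(_ ord0); rewrite rV_consE0/= ltr_norml => /andP[h1 h2].
  by rewrite /segment /= in_itv/= (ltW h1)/= /s mulr2n addrA addNr add0r.
rewrite (integral_rVS mfp (fun=> pos _)) (integral_rVS mdp (fun=> pos _)).
rewrite (fubini_tonelli (m1 := @lebesgue_measure R) (m2 := lebesgue_rV R n)
  (fun z => (`|f (@rV_cons R n z)| `^ p)%:E) mfpc (fun=> pos _)).
rewrite (fubini_tonelli (m1 := @lebesgue_measure R) (m2 := lebesgue_rV R n)
  (fun z => (`|partial ord0 f (@rV_cons R n z)| `^ p)%:E) mdpc (fun=> pos _)).
rewrite -ge0_integralZl//; last 2 first.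
- exact: (measurable_fun_fubini_tonelli_G (m1 := @lebesgue_measure R) _ mdpc (fun=> pos _)).
- by move=> y _; apply: integral_ge0 => t _; exact: pos.
apply: ge0_le_integralT.
- exact: (measurable_fun_fubini_tonelli_G (m1 := @lebesgue_measure R) _ mfpc (fun=> pos _)).
- apply: measurable_funeM.
  exact: (measurable_fun_fubini_tonelli_G (m1 := @lebesgue_measure R) _ mdpc (fun=> pos _)).
- by move=> y; apply: integral_ge0 => t _; exact: pos.
move=> y.
have mfy : measurable_fun setT (fun t : measurableTypeR R => (`|f (rV_cons (t, y))| `^ p)%:E).
  exact: (measurableT_comp mfpc).
have mdy : measurable_fun setT (fun t : measurableTypeR R => (`|partial ord0 f (rV_cons (t, y))| `^ p)%:E).
  exact: (measurableT_comp mdpc).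
apply: (@le_trans _ _ ((s `^ p)%:E * K y)); last first.
  apply: lee_wpmul2l; first exact: pos.
  rewrite /K (mrestr_integral _ (measurable_segment _ _) mdy (fun=> pos _)).
  by apply: ge0_subset_integral => //; exact: measurable_segment.
have -> : \int[@lebesgue_measure R]_t (`|f (rV_cons (t, y))| `^ p)%:E =
    \int[seg]_t (`|f (rV_cons (t, y))| `^ p)%:E.
  rewrite (mrestr_integral _ (measurable_segment _ _) mfy (fun=> pos _)).
  rewrite [RHS]integral_mkcond; apply: eq_integral => t _; rewrite patchE.
  case: ifPn => // tN; have [->|/fseg h] := eqVneq (f (rV_cons (t, y))) 0%R.
    by rewrite normr0 powR0// gt_eqF.
  by move/negP : tN; rewrite mem_set.
have fL0 : f (rV_cons (- L, y)%R) = 0%R.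
  apply: contrapT => /eqP/fL/(_ ord0); rewrite rV_consE0/= normrN gtr0_norm//.
  by rewrite ltxx.
apply: (@le_trans _ _ (\int[seg]_t ((s `^ (p - 1))%:E * K y))).
  apply: mrestr_le_integral => //.
  - by move=> x; rewrite mule_ge0// lee_fin powR_ge0.
  move=> t; rewrite /segment /= in_itv/= => ts.
  rewrite -[X in (`|X| `^ _)%R]subr0 -fL0.
  have cd : continuous (fun t : R => partial ord0 f (rV_cons (t, y))).
    move=> x; apply: continuous_comp; first exact: continuous_rV_cons_head.
    exact: (df ord0).2.
  have Lseg : (- L <= - L < - L + s)%R by rewrite lexx/= ltrDl.
  exact: (dist_powR_le_integral p1 (fun x => is_derive_head y x C1f) cd s0 Lseg ts).
rewrite (integral_cst seg measurableT) muleC.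
rewrite [X in X * _ <= _](segment_measureT _ (ltW s0)) muleA -EFinM.
by rewrite mulr_powRB1// ltW.
Qed.

End poincare.

(** * Sobolev inequalities *)

Lemma mrestr_integralT d (T : measurableType d) (R : realType)
    (m : {measure set T -> \bar R}) (D : set T) (mD : measurable D)
    (g : T -> \bar R) :
  (\int[mrestr m mD]_x g x = \int[m]_(x in D) g x)%E.
Proof.
rewrite (@ae_integral_eq _ _ _ _ g (g \_ D)).
  rewrite -integral_mkcond; apply: eq_measure_integral => A mA AD.
  by rewrite /= /mrestr setIidl.
exists (~` D); split; first exact: measurableC.
  by rewrite -[LHS]/(m (~` D `&` D)) setICl measure0.
by move=> x /=; rewrite patchE; apply: contra_not => Dx; rewrite mem_set.
Qed.

(** * Test functions on a bounded open set *)

Section test_functions.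
Context (R : realType) (n : nat) (O : set 'rV[R]_n) (oO : open O).
Local Notation mu := (lebesgue_on oO).
Local Notation leb := (lebesgue_rV R n).

Lemma bounded_set_coord : bounded_set O ->
  exists2 L : R, 0 < L & forall x, O x -> forall i, `|x 0 i| < L.
Proof.
move=> [M [_ hM]]; pose L := `|M| + 1; exists (L + 1).
  by rewrite ltr_pwDr// addr_ge0.
move=> x Ox i; rewrite (@le_lt_trans _ _ L)//; last by rewrite ltrDl.
apply: (le_trans (coord_le_norm x i)); apply: hM => //.
by rewrite /L (le_lt_trans (ler_norm M))// ltrDl.
Qed.

Lemma test_function_eq0 f x : test_function O f -> ~ O x -> f x = 0.
Proof.
move=> [_ _ sO] nOx; apply: contrapT => /eqP fx; apply: nOx; apply: sO.
exact: subset_closure.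
Qed.

Lemma test_function_C1 f : test_function O f -> C1 f.
Proof.
move=> [sf _ _]; split; first exact: (sf 0%N).
move=> i; have [df /(_ i) cf] := sf 1%N; split; last exact: cf.
by move=> x; apply: diff_derivable; exact: df.
Qed.

Lemma test_partial_eq0 f x i : test_function O f -> ~ O x -> partial i f x = 0.
Proof.
move=> [_ _ sO] nOx; have nS : (~` Defs.support f) x by move=> /sO.
have oS : open (~` Defs.support f).
  by apply: closed_openC; exact: closed_closure.
rewrite /partial (@near_eq_derive _ _ _ f (cst 0)) ?derive_cst//.
have : nbhs x (~` Defs.support f) by exact: open_nbhs_nbhs.
apply: filterS => y nSy; apply: contrapT => /eqP fy; apply: nSy.
exact: subset_closure.
Qed.

Lemma test_function_bounded f : test_function O f ->
  exists B : R, forall x, `|f x| <= B.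
Proof.
move=> [sf cs _].
have : compact (f @` Defs.support f).
  by apply: continuous_compact => //; apply: continuous_subspaceT; exact: (sf 0%N).
move=> /compact_bounded[M [_ hM]]; exists (`|M| + 1) => x.
have [->|fx] := eqVneq (f x) 0; first by rewrite normr0 addr_ge0.
apply: hM; first by rewrite (le_lt_trans (ler_norm M))// ltrDl.
by exists x => //; exact: subset_closure.
Qed.

Lemma integral_mu_leb (g : 'rV[R]_n -> \bar R) :
  (forall x, ~ O x -> g x = 0%E) -> (\int[mu]_x g x = \int[leb]_x g x)%E.
Proof.
move=> g0; rewrite mrestr_integralT integral_mkcond; apply: eq_integral => x _.
rewrite patchE; case: ifPn => // /negP xO; rewrite g0// => Ox; apply: xO.
exact: mem_set.
Qed.

Lemma leb_finite : bounded_set O -> (leb O < +oo)%E.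
Proof.
move=> /bounded_set_coord[L L0 OL].
have s0 : 0 <= L *+ 2 by rewrite mulrn_wge0// ltW.
apply: (@le_lt_trans _ _ (leb (box (fun=> - L) (L *+ 2)))); last first.
  exact: lebesgue_box_fin.
apply: le_measure.
- by rewrite inE; exact: open_measurable_rV.
- by rewrite inE; exact: measurable_box.
move=> x Ox i; have := OL x Ox i; rewrite ltr_norml => /andP[]; lra.
Qed.

Lemma mu_finite : bounded_set O -> (mu setT < +oo)%E.
Proof.
by move=> bO; rewrite -[ltLHS]/(leb (setT `&` O)) setTI; exact: leb_finite.
Qed.

End test_functions.

Lemma poincare_coord (R : realType) (p : R) (p1 : 1 < p) (L : R) (L0 : 0 < L)
    n (f : 'rV[R]_n -> R) : (0 < n)%N -> C1 f ->
  (forall x, f x != 0 -> forall i, `|x 0 i| < L) ->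
  exists i, (\int[lebesgue_rV R n]_x (`|f x| `^ p)%:E <=
    ((L *+ 2) `^ p)%:E * \int[lebesgue_rV R n]_x (`|partial i f x| `^ p)%:E)%E.
Proof. by case: n f => // n f _ C1f fL; exists ord0; exact: poincare_rV. Qed.

(** * Poincare and Ehrling inequalities on W_0^{1,p} *)

Section sobolev_inequalities.
Context (R : realType) (n : nat) (n_gt0 : (0 < n)%N) (O : set 'rV[R]_n)
  (oO : open O) (bO : bounded_set O) (p : R) (p1 : 1 < p).
Local Notation mu := (lebesgue_on oO).
Local Notation leb := (lebesgue_rV R n).
Local Notation Lp := (LfunType mu (lt1_le1E p1)).
Local Notation W := (sobolev0 oO p1).
Local Notation G := (Lp_graph oO p1).
Local Notation N f := (fine 'N[mu]_p%:E[EFin \o f]).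
Let p0 : 0 < p. Proof. exact: lt_trans p1. Qed.
Let pn0 : p != 0. Proof. by rewrite gt_eqF. Qed.

Lemma Lp_integrable (f : Lp) : ae_integrable mu (fun x => `|f x| `^ p).
Proof.
exact: (finite_norm_integrable p0 (measurable_ae_mfun _ (measurable_funP f))
  (@Lfunction_finite _ _ _ _ _ _ f)).
Qed.

Lemma Lp_normE (f : Lp) : N f `^ p = (\int[mu]_x `|f x| `^ p)%R.
Proof. exact: (Lnorm_powR p0 (@Lfunction_finite _ _ _ _ _ _ f)). Qed.

Lemma Lp_norm_ge0 (f : Lp) : 0 <= N f.
Proof. exact/fine_ge0/Lnorm_ge0. Qed.

Lemma Lp_norm_dist (f g : Lp) : `|N f - N g| <= N (f - g).
Proof.
have tri (h k : Lp) : N h <= N (h - k) + N k.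
  by rewrite -{1}(subrK k h); exact: ler_LnormD.
have sym : N (g - f) = N (f - g).
  by rewrite -opprB; exact: LnormrN.
have h1 := tri f g; have h2 := tri g f; rewrite sym in h2.
by rewrite ler_norml; apply/andP; split; lra.
Qed.

Lemma graph_norm_fun (w : G) : N w.1 <= graph_norm w.
Proof.
by rewrite lerDl sumr_ge0// => i _; exact/fine_ge0/Lnorm_ge0.
Qed.

Lemma graph_norm_grad (w : G) i : N (w.2 i) <= graph_norm w.
Proof.
rewrite /graph_norm (bigD1 i)//= addrCA lerDl addr_ge0//.
  exact/fine_ge0/Lnorm_ge0.
by rewrite sumr_ge0// => j _; exact/fine_ge0/Lnorm_ge0.
Qed.

(** Coordinatewise substitute for the energy with the Euclidean norm: it is read off the pair of
    functions, and the two are comparable up to constants in [n] and [p]. *)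
Definition graph_energy (w : G) : R := \sum_i N (w.2 i) `^ p.

Lemma cvg_norm_sub (u_ : nat -> R) (l : R) (d_ : nat -> R) :
  (forall j, `|u_ j - l| <= d_ j) -> d_ @ \oo --> 0 -> u_ @ \oo --> l.
Proof.
move=> ud d0; apply/cvgrPdist_le => e e0.
move/cvgrPdist_le : d0 => /(_ e e0); apply: filterS => j.
rewrite sub0r normrN distrC => h; apply: (le_trans (ud j)).
exact: (le_trans (ler_norm _)).
Qed.

Lemma cvg_sum_seq (I : Type) (r : seq I) (u_ : I -> nat -> R) (l : I -> R) :
  (forall i, u_ i @ \oo --> l i) ->
  (fun j => \sum_(i <- r) u_ i j) @ \oo --> \sum_(i <- r) l i.
Proof.
move=> ul; elim: r => [|i r IH].
  rewrite big_nil (_ : (fun _ => _) = cst 0); first exact: cvg_cst.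
  by apply/funext => j; rewrite big_nil.
rewrite big_cons (_ : (fun _ => _) = (fun j => u_ i j + \sum_(i <- r) u_ i j)).
  by apply: cvgD; [exact: ul|exact: IH].
by apply/funext => j; rewrite big_cons.
Qed.

Lemma cvg_powR (u_ : nat -> R) (l : R) : u_ @ \oo --> l -> (forall j, 0 <= u_ j) ->
  0 <= l -> (fun j => u_ j `^ p) @ \oo --> l `^ p.
Proof.
move=> ul u0 l0; apply/cvgrPdist_le => e e0.
(* [C *+ 2] will bound [l^p + u_j^p]: with [eta <= 1/2] and the other term at most [1/2],
   [powR_dist_le] gives [u_j^p <= 3 l^p + 1]. *)
pose C := l `^ p *+ 2 + 1.
have C0 : 0 < C by rewrite ltr_wpDl// mulrn_wge0// powR_ge0.
have eta0 : 0 < Num.min 2^-1 (e / (C *+ 4)).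
  by rewrite lt_min invr_gt0 ltr0n/= divr_gt0// pmulrn_rgt0.
have [K K0 HK] := powR_dist_le p0 eta0.
pose d := (Num.min (e / 2) 2^-1 / (K + 1)) `^ p^-1.
have K1 : 0 < K + 1 by rewrite ltr_wpDl.
have m0 : 0 < Num.min (e / 2) 2^-1 by rewrite lt_min divr_gt0//= invr_gt0.
have d0 : 0 < d by rewrite powR_gt0// divr_gt0.
have dE : d `^ p = Num.min (e / 2) 2^-1 / (K + 1).
  by rewrite /d powRVK// divr_ge0// ltW.
move/cvgrPdist_le : ul => /(_ d d0); apply: filterS => j ujd.
have := HK l (u_ j); rewrite (ger0_norm l0) (ger0_norm (u0 j)).
set a := l `^ p; set b := u_ j `^ p.
have small : K * `|l - u_ j| `^ p <= Num.min (e / 2) 2^-1.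
  apply: (@le_trans _ _ (K * d `^ p)).
    by rewrite ler_wpM2l// powR_le// ltW.
  rewrite dE mulrCA ler_piMr ?(ltW m0)// ler_pdivrMr// mul1r lerDl//.
have s1 : K * `|l - u_ j| `^ p <= e / 2 by rewrite (le_trans small)// ge_min lexx.
have s2 : K * `|l - u_ j| `^ p <= 2^-1 by rewrite (le_trans small)// ge_min lexx orbT.
set m := Num.min 2^-1 (e / (C *+ 4)).
have m1 : m <= 2^-1 by rewrite ge_min lexx.
have m2 : m <= e / (C *+ 4) by rewrite ge_min lexx orbT.
have a0 : 0 <= a by exact: powR_ge0.
have b0 : 0 <= b by exact: powR_ge0.
move=> h.
have h1 : b - a <= 2^-1 * (a + b) + 2^-1.
  rewrite (le_trans _ (le_trans h _))//; first by rewrite distrC ler_norm.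
  by rewrite lerD// ler_wpM2r// addr_ge0.
have bC : a + b <= C *+ 2.
  have -> : C = a *+ 2 + 1 by [].
  rewrite !mulr2n; lra.
apply: (le_trans h); rewrite [leRHS](splitr e) lerD//.
apply: (@le_trans _ _ (e / (C *+ 4) * (C *+ 2))).
  by rewrite ler_pM// ?addr_ge0// ltW.
have -> : e / (C *+ 4) * (C *+ 2) = e / 2.
  by rewrite -[C *+ 4]mulr_natr -[C *+ 2]mulr_natr; field; rewrite gt_eqF.
by [].
Qed.

(* Inequalities between continuous functions of the graph norm extend from
   test functions to W_0^{1,p}. *)
Lemma sobolev0_density (F H : G -> R) (w : G) : w \in in_sobolev0 (oO := oO) (p1 := p1) ->
  (forall t, test_graph t -> F t <= H t) ->
  (forall t_ : nat -> G, (fun j => graph_norm (t_ j - w)) @ \oo --> 0 ->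
     (fun j => F (t_ j)) @ \oo --> F w) ->
  (forall t_ : nat -> G, (fun j => graph_norm (t_ j - w)) @ \oo --> 0 ->
     (fun j => H (t_ j)) @ \oo --> H w) -> F w <= H w.
Proof.
move=> /set_mem hw FH cF cH.
have /choice[t_ t_P] : forall j : nat, exists t : G, test_graph t /\
    graph_norm (w - t) < j.+1%:R^-1.
  move=> j; have [|t tt wt] := hw j.+1%:R^-1; first by rewrite invr_gt0.
  by exists t.
have tw : (fun j => graph_norm (t_ j - w)) @ \oo --> 0.
  apply: (@cvg_norm_sub _ _ (fun j => j.+1%:R^-1)).
    move=> j; rewrite subr0 ger0_norm ?graph_norm_ge0//.
    by rewrite -graph_normN opprB ltW//; have [] := t_P j.
  exact: cvg_harmonic.
apply: (ler_cvg_to (cF _ tw) (cH _ tw)).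
by apply: nearW => j; apply: FH; have [] := t_P j.
Qed.

Lemma cvg_Lp_fun (t_ : nat -> G) (w : G) :
  (fun j => graph_norm (t_ j - w)) @ \oo --> 0 ->
  (fun j => N (t_ j).1 `^ p) @ \oo --> N w.1 `^ p.
Proof.
move=> tw; apply: cvg_powR.
- apply: (cvg_norm_sub _ tw) => j; apply: (le_trans (Lp_norm_dist _ _)).
  exact: (graph_norm_fun (t_ j - w)).
- by move=> j; exact/fine_ge0/Lnorm_ge0.
- exact/fine_ge0/Lnorm_ge0.
Qed.

Lemma cvg_graph_energy (t_ : nat -> G) (w : G) :
  (fun j => graph_norm (t_ j - w)) @ \oo --> 0 ->
  (fun j => graph_energy (t_ j)) @ \oo --> graph_energy w.
Proof.
move=> tw; rewrite /graph_energy.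
apply: cvg_sum_seq => i; apply: cvg_powR.
- apply: (cvg_norm_sub _ tw) => j; apply: (le_trans (Lp_norm_dist _ _)).
  have := graph_norm_grad (t_ j - w) i.
  by rewrite (_ : (t_ j - w).2 i = (t_ j).2 i - w.2 i)//= !ffunE.
- by move=> j; exact/fine_ge0/Lnorm_ge0.
- exact/fine_ge0/Lnorm_ge0.
Qed.

Lemma test_graph_fun (t : G) f : test_function O f -> graph_fun t =1 f ->
  ((N t.1 `^ p)%:E = \int[leb]_x (`|f x| `^ p)%:E)%E.
Proof.
move=> tf e; rewrite Lp_normE EFin_Rint; last 2 first.
- by move=> x; exact: powR_ge0.
- exact: Lp_integrable.
rewrite -(integral_mu_leb oO); last first.
  by move=> x nOx; rewrite (test_function_eq0 tf nOx) normr0 powR0.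
by apply: eq_integral => x _; rewrite -e.
Qed.

Lemma test_graph_grad (t : G) f i : test_function O f ->
  graph_grad t i =1 partial i f ->
  ((N (t.2 i) `^ p)%:E = \int[leb]_x (`|partial i f x| `^ p)%:E)%E.
Proof.
move=> tf e; rewrite Lp_normE EFin_Rint; last 2 first.
- by move=> x; exact: powR_ge0.
- exact: Lp_integrable.
rewrite -(integral_mu_leb oO); last first.
  by move=> x nOx; rewrite (test_partial_eq0 i tf nOx) normr0 powR0.
by apply: eq_integral => x _; rewrite -e.
Qed.

Lemma poincare_test : exists2 C : R, 0 <= C &
  forall t : G, test_graph t -> N t.1 `^ p <= C * graph_energy t.
Proof.
have [L L0 OL] := bounded_set_coord bO.
exists ((L *+ 2) `^ p); first exact: powR_ge0.
move=> t [f tf [e1 e2]].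
have fL x : f x != 0 -> forall i, `|x 0%R i| < L.
  move=> fx; apply: OL; apply: contrapT => nOx.
  by move/eqP: fx; apply; exact: (test_function_eq0 tf nOx).
have [i] := poincare_coord p1 L0 n_gt0 (test_function_C1 tf) fL.
rewrite -(test_graph_fun tf e1) -(test_graph_grad tf (e2 i)) -EFinM lee_fin.
move=> /le_trans; apply.
rewrite ler_wpM2l ?powR_ge0// /graph_energy (bigD1 i)//= lerDl.
by apply: sumr_ge0 => j _; exact: powR_ge0.
Qed.

Lemma poincare_graph : exists2 C : R, 0 <= C &
  forall w : G, w \in in_sobolev0 (oO := oO) (p1 := p1) ->
    N w.1 `^ p <= C * graph_energy w.
Proof.
have [C C0 HC] := poincare_test; exists C => // w hw.
apply: (sobolev0_density (F := fun w => N w.1 `^ p)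
  (H := fun w => C * graph_energy w) hw HC).
- by move=> t_; exact: cvg_Lp_fun.
- by move=> t_ tw; apply: cvgMr; exact: cvg_graph_energy.
Qed.

Definition cell_integral (Q : set 'rV[R]_n) (w : G) : R :=
  (\int[mu]_x (\1_Q x * w.1 x))%R.

Lemma Lp_integrable1 (f : Lp) : ae_integrable mu f.
Proof.
apply: (@ae_integrable_dom _ _ _ _ _ (fun x => 1 + `|f x| `^ p)).
- by apply: measurable_ae_mfun; exact: measurable_funP.
- apply: ae_integrableD; last exact: Lp_integrable.
  apply: integrable_ae_integrable.
  apply: (measurable_bounded_integrable measurableT (mu_finite oO bO)).
    exact: measurable_cst.
  exists 1; split; first exact: num_real.
  by move=> M M1 x _; rewrite /= normr1 ltW.
- apply: aeW => x; have [h|h] := leP `|f x| 1.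
    by rewrite (le_trans h)// lerDl powR_ge0.
  by rewrite (le_trans (le1r_powR (ltW h) (ltW p1)))// lerDr.
Qed.

Lemma cell_integrable Q (f : Lp) : measurable Q ->
  ae_integrable mu (fun x => \1_Q x * f x).
Proof.
move=> mQ; apply: (ae_integrable_dom _ (ae_integrable_norm (Lp_integrable1 f))).
  apply: ae_mfunM; first by apply: measurable_ae_mfun; exact: measurable_indic.
  exact: (ae_integrable_mfun (Lp_integrable1 f)).
apply: aeW => x; rewrite normrM ler_piMl//.
by rewrite indicE; case: (_ \in _); rewrite ?normr1 ?normr0.
Qed.

Lemma Lp_norm1_le : exists2 C : R, 0 <= C & forall f : Lp,
  (\int[mu]_x `|f x|)%R <= C * N f.
Proof.
pose m : {finite_measure set 'rV[R]_n -> \bar R} :=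
  mfrestr (open_measurable_rV oO) (leb_finite oO bO).
have mfin : m setT \is a fin_num by exact: fin_num_measure.
pose c := fine (m setT).
exists ((c `^ (p - 1)) `^ p^-1); first exact: powR_ge0.
move=> f; have I0 : 0 <= (\int[mu]_x `|f x|)%R by apply: Rintegral_ge0.
have h : ((\int[mu]_x `|f x|)%R) `^ p <= c `^ (p - 1) * N f `^ p.
  have := integral_poweR_le m p1 (measurable_funP f).
  have -> : (\int[m]_x (`|f x|)%:E = ((\int[mu]_x `|f x|)%R)%:E)%E.
    by rewrite EFin_Rint//; exact: (ae_integrable_norm (Lp_integrable1 f)).
  have -> : (\int[m]_x (`|f x| `^ p)%:E = (N f `^ p)%:E)%E.
    by rewrite Lp_normE EFin_Rint//; exact: Lp_integrable.
  by rewrite -(fineK mfin) !poweR_EFin -EFinM lee_fin.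
have ip : 0 <= p^-1 by rewrite invr_ge0 ltW.
have := powR_le ip (powR_ge0 _ _) h.
by rewrite powRM ?powR_ge0// !powRK// Lp_norm_ge0.
Qed.

Lemma cell_integral_le : exists2 C : R, 0 <= C & forall Q (w : G), measurable Q ->
  `|cell_integral Q w| <= C * graph_norm w.
Proof.
have [C C0 HC] := Lp_norm1_le; exists C => // Q w mQ.
apply: (@le_trans _ _ (C * N w.1)); last by rewrite ler_wpM2l// graph_norm_fun.
apply: (le_trans _ (HC w.1)).
apply: (@Rint_norm_le _ _ _ mu (fun x => \1_Q x * w.1 x) (fun x => `|w.1 x|)).
- exact: (ae_integrable_mfun (cell_integrable _ mQ)).
- exact: (ae_integrable_norm (Lp_integrable1 w.1)).
apply: aeW => x; rewrite normrM ler_piMl//.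
by rewrite indicE; case: (_ \in _); rewrite ?normr1 ?normr0.
Qed.

Lemma cell_integral_linear Q (a : R) (w z : G) : measurable Q ->
  cell_integral Q (a *: w + z) = a * cell_integral Q w + cell_integral Q z.
Proof.
move=> mQ; rewrite /cell_integral -RintZ; last exact: cell_integrable.
rewrite -RintD; last 2 first.
- exact/ae_integrableZ/cell_integrable.
- exact: cell_integrable.
by apply: eq_Rintegral => x _ /=; rewrite mulrDr mulrCA.
Qed.

Lemma cell_integralB Q (w z : G) : measurable Q ->
  cell_integral Q (w - z) = cell_integral Q w - cell_integral Q z.
Proof.
move=> mQ; rewrite (_ : w - z = (-1) *: z + w); last by rewrite scaleN1r addrC.
by rewrite cell_integral_linear// mulN1r addrC.
Qed.

Lemma cvg_cell_integral Q (t_ : nat -> G) (w : G) : measurable Q ->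
  (fun j => graph_norm (t_ j - w)) @ \oo --> 0 ->
  (fun j => `|cell_integral Q (t_ j)| `^ p) @ \oo --> `|cell_integral Q w| `^ p.
Proof.
move=> mQ tw; have [C C0 HC] := cell_integral_le.
apply: cvg_powR => //; apply: cvg_norm.
apply: (@cvg_norm_sub _ _ (fun j => C * graph_norm (t_ j - w))).
  by move=> j; rewrite -cell_integralB//; exact: HC.
by rewrite -[X in _ --> X](mulr0 C); exact: cvgMr.
Qed.

(** The forms are the integrals over the cells of a grid whose mesh makes the gradient coefficient
    in [grid_estimate] at most [eta]. *)
Lemma ehrling_test (eta : R) : 0 < eta ->
  exists (I : finType) (Q : I -> set 'rV[R]_n) (K : R), [/\ 0 <= K,
    (forall k, measurable (Q k)) & forall t : G, test_graph t ->
    N t.1 `^ p <= eta * graph_energy t +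
      K * \sum_k `|cell_integral (Q k) t| `^ p].
Proof.
move=> e0; have [L L0 OL] := bounded_set_coord bO.
pose A := 2 `^ p * box_constant p n + 1.
have A1 : 2 `^ p * box_constant p n <= A by rewrite lerDl.
have A0 : 0 < A.
  by rewrite ltr_wpDl// mulr_ge0 ?powR_ge0// box_constant_ge0.
(* The largest admissible side: [A * sm^p = eta], and [M] is then taken with [2L/M <= sm]. *)
pose sm := (eta / A) `^ p^-1.
have sm0 : 0 < sm by rewrite powR_gt0// divr_gt0.
pose M := (Num.truncn (L *+ 2 / sm)).+1.
have M0 : (0 < M)%N by [].
have Mr0 : 0 < M%:R :> R by rewrite ltr0n.
pose s := L *+ 2 / M%:R.
have s0 : 0 < s by exact: grid_step_gt0.
have ssm : s <= sm.
  rewrite ler_pdivrMr// mulrC -ler_pdivrMr//.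
  by rewrite ltW//; exact: truncnS_gt.
have sp : 2 `^ p * box_constant p n * s `^ p <= eta.
  apply: (@le_trans _ _ (A * (sm `^ p))).
    rewrite ler_pM// ?powR_ge0//.
    - by rewrite mulr_ge0 ?powR_ge0// box_constant_ge0.
    - by rewrite powR_le// ltW.
  by rewrite /sm powRVK// ?divr_ge0 ?(ltW e0) ?(ltW A0)// mulrC divfK// gt_eqF.
exists {ffun 'I_n -> 'I_M}, (fun k => box (grid_corner L k) s).
exists (2 `^ p * (s ^+ n) `^ (1 - p)); split.
- by rewrite mulr_ge0 ?powR_ge0.
- by move=> k; exact: measurable_box.
move=> t [f tf [e1 e2]].
have fL x : f x != 0 -> forall i, `|x 0%R i| < L.
  move=> fx; apply: OL; apply: contrapT => nOx.
  by move/eqP: fx; apply; exact: (test_function_eq0 tf nOx).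
have [B fB] := test_function_bounded tf.
have := grid_estimate L0 M0 p1 (test_function_C1 tf) fB fL.
rewrite -(test_graph_fun tf e1).
have -> : (\sum_(i < n) \int[leb]_x (`|partial i f x| `^ p)%:E)%E = (graph_energy t)%:E.
  by rewrite -sumEFin; apply: eq_bigr => i _; rewrite (test_graph_grad tf (e2 i)).
rewrite -EFinM -EFinD lee_fin => h; apply: (le_trans h).
apply: lerD; first by rewrite ler_wpM2r// sumr_ge0// => i _; exact: powR_ge0.
rewrite ler_wpM2l ?mulr_ge0 ?powR_ge0//; apply: ler_sum => k _.
suff -> : (\int[box_measure (grid_corner L k) (ltW (grid_step_gt0 L0 M0))]_x f x)%R =
  cell_integral (box (grid_corner L k) s) t by [].
(* A test function vanishes off [O], so integrating it over a cell against Lebesgue measure or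
   against its restriction to [O] gives the same value. *)
congr fine; rewrite [LHS]mrestr_integralT integral_mkcond.
rewrite (integral_mu_leb oO); last first.
  move=> x nOx; rewrite (_ : t.1 x = f x); last exact: e1.
  by rewrite (test_function_eq0 tf nOx) mulr0.
apply: eq_integral => x _; rewrite patchE indicE (_ : t.1 x = f x); last exact: e1.
by case: (x \in _); rewrite ?mul1r ?mul0r.
Qed.

Lemma ehrling_graph (eta : R) : 0 < eta ->
  exists (I : finType) (Q : I -> set 'rV[R]_n) (K : R), [/\ 0 <= K,
    (forall k, measurable (Q k)) & forall w : G, w \in in_sobolev0 (oO := oO) (p1 := p1) ->
    N w.1 `^ p <= eta * graph_energy w +
      K * \sum_k `|cell_integral (Q k) w| `^ p].
Proof.
move=> e0; have [I [Q [K [K0 mQ HQ]]]] := ehrling_test e0.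
exists I, Q, K; split => // w hw.
apply: (sobolev0_density (F := fun w => N w.1 `^ p)
  (H := fun w => eta * graph_energy w + K * \sum_k `|cell_integral (Q k) w| `^ p) hw HQ).
- by move=> t_; exact: cvg_Lp_fun.
- move=> t_ tw; apply: cvgD; apply: cvgMr; first exact: cvg_graph_energy.
  by apply: cvg_sum_seq => k; exact: cvg_cell_integral.
Qed.

End sobolev_inequalities.

(** * Completeness of L^p and of W_0^{1,p} *)

Lemma fatou_le d (T : measurableType d) (R : realType)
    (mu : {measure set T -> \bar R}) (h_ : nat -> T -> R) (h : T -> R) (c : \bar R) :
  (forall j, measurable_fun setT (h_ j)) -> (forall j x, 0 <= h_ j x) ->
  {ae mu, forall x, h_ ^~ x @ \oo --> h x} ->
  (forall j, (\int[mu]_x (h_ j x)%:E <= c)%E) -> (\int[mu]_x (h x)%:E <= c)%E.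
Proof.
move=> mh h0 hh hc.
have mh' j : measurable_fun setT (fun x => (h_ j x)%:E) by exact/measurable_EFinP.
have fat := fatou mu measurableT mh' (fun j x _ => h0 j x).
have -> : (\int[mu]_x (h x)%:E = \int[mu]_x limn_einf (fun j => (h_ j x)%:E))%E.
  apply: ae_integral_eq; apply: filterS hh => x hx.
  have : (fun j => (h_ j x)%:E) @ \oo --> (h x)%:E.
    by apply: cvg_EFin; [exact: nearW|exact: hx].
  by move=> /cvg_limn_einf_sup[].
apply: (le_trans fat); rewrite limn_einf_lim; apply: lime_le.
  exact: is_cvg_einfs.
apply: nearW => j; apply: (le_trans _ (hc j)).
by apply: ereal_inf_lbound; exists j => /=.
Qed.

Lemma cvg_of_summable (R : realType) (u_ : nat -> R) :
  (\sum_(0 <= j <oo) `|u_ j.+1 - u_ j|%:E < +oo)%E -> cvgn u_.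
Proof.
move=> sfin.
have : cvgn (series (fun j => u_ j.+1 - u_ j)).
  apply: normed_cvg; apply: nondecreasing_is_cvgn.
    by apply: nondecreasing_series => j _ _; exact: normr_ge0.
  have s0 : (0 <= \sum_(0 <= j <oo) `|u_ j.+1 - u_ j|%:E)%E.
    by apply: nneseries_ge0 => j _ _; rewrite lee_fin.
  exists (fine (\sum_(0 <= j <oo) `|u_ j.+1 - u_ j|%:E)%E) => _ [k _ <-].
  rewrite -lee_fin fineK ?ge0_fin_numE// /series/= -sumEFin.
  by apply: nneseries_lim_ge => j _ _; rewrite lee_fin.
move=> /cvg_ex[l sl]; apply/cvg_ex; exists (l + u_ 0%N).
have E : (fun j => series (fun j => u_ j.+1 - u_ j) j + u_ 0%N) = u_.
  by apply/funext => j; rewrite /series/= telescope_sumr// subrK.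
have : (fun j => series (fun j => u_ j.+1 - u_ j) j + u_ 0%N) @ \oo --> l + u_ 0%N.
  by apply: cvgD; [exact: sl|exact: cvg_cst].
by rewrite E.
Qed.

(** The Riesz-Fischer argument: the series of absolute increments has finite integral, hence is
    finite a.e., and the sequence converges wherever it is finite. *)
Lemma ae_limit_of_summable d (T : measurableType d) (R : realType)
    (mu : {measure set T -> \bar R}) (f_ : nat -> T -> R) (C q : R) :
  0 <= q < 1 -> (forall j, measurable_fun setT (f_ j)) ->
  (forall j, \int[mu]_x `|f_ j.+1 x - f_ j x|%:E <= (C * q ^+ j)%:E)%E ->
  exists2 f : T -> R, measurable_fun setT f &
    {ae mu, forall x, f_ ^~ x @ \oo --> f x}.
Proof.
move=> /andP[q0 q1] mf fC.
pose g x := (\sum_(0 <= j <oo) `|f_ j.+1 x - f_ j x|%:E)%E.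
have mterm j : measurable_fun setT (fun x => (`|f_ j.+1 x - f_ j x|%:E)%E).
  apply/measurable_EFinP; apply: measurableT_comp; first exact: normr_measurable.
  exact: measurable_funB.
have mg : measurable_fun setT g.
  by apply: ge0_emeasurable_sum => // j x _ _; rewrite lee_fin.
have ig : (\int[mu]_x g x < +oo)%E.
  rewrite /g integral_nneseries//.
  apply: (@le_lt_trans _ _ (\sum_(0 <= j <oo) (geometric C q j)%:E)%E).
    by apply: lee_nneseries => [j _ _|j _]; first by apply: integral_ge0 => x _; rewrite lee_fin.
  have cg : cvgn (series (geometric C q)).
    by apply: is_cvg_geometric_series; rewrite ger0_norm.
  have /cvg_ex[l sl] := cg.
  have : (fun k => (\sum_(0 <= j < k) (geometric C q j)%:E)%E) @ \oo --> l%:E.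
    under eq_fun do rewrite sumEFin.
    by apply: cvg_EFin; [exact: nearW|exact: sl].
  by move=> /cvg_lim ->//; exact: ltry.
pose A := [set x | (g x < +oo)%E].
have mA : measurable A.
  by rewrite -[A]setTI; apply: emeasurable_fun_infty_o.
have g0 x : (0 <= g x)%E by apply: nneseries_ge0 => j _ _; rewrite lee_fin.
have aeA : {ae mu, forall x, A x}.
  have : mu.-integrable setT g.
    apply/integrableP; split => //.
    by under eq_integral do rewrite gee0_abs//.
  move=> /integrable_ae => /(_ measurableT).
  by apply: filterS => x /(_ I); rewrite /A/= ge0_fin_numE.
(* Cutting off outside [A] makes the sequence converge everywhere, so that its limit is Borel
   measurable. *)
pose h_ j x := f_ j x * \1_A x.
have mh j : measurable_fun setT (h_ j).
  by apply: measurable_funM => //; exact: measurable_indic.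
have ch x : cvgn (h_ ^~ x).
  rewrite /h_ indicE; have [Ax|Ax] := boolP (x \in A).
    by apply: is_cvgM; [exact/cvg_of_summable/(set_mem Ax)|exact: is_cvg_cst].
  by under eq_fun do rewrite mulr0; apply: is_cvg_cst.
exists (fun x => limn (h_ ^~ x)); first by apply: (measurable_fun_cvg mh) => x _; exact: ch.
apply: filterS aeA => x Ax.
have -> : f_ ^~ x = h_ ^~ x; last exact: ch.
by apply/funext => j; rewrite /h_ indicE mem_set// mulr1.
Qed.

Section completeness.
Context (R : realType) (n : nat) (O : set 'rV[R]_n)
  (oO : open O) (bO : bounded_set O) (p : R) (p1 : 1 < p).
Local Notation mu := (lebesgue_on oO).
Local Notation Lp := (LfunType mu (lt1_le1E p1)).
Local Notation W := (sobolev0 oO p1).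
Local Notation G := (Lp_graph oO p1).
Local Notation N f := (fine 'N[mu]_p%:E[EFin \o f]).
Let p0 : 0 < p. Proof. exact: lt_trans p1. Qed.

Lemma Lp_of_function (f : 'rV[R]_n -> R) : measurable_fun setT f ->
  ae_integrable mu (fun x => `|f x| `^ p) ->
  exists g : Lp, g = f :> ('rV[R]_n -> R).
Proof.
move=> mf intf.
have fL : f \in Lfun mu p%:E.
  apply/andP; split; rewrite inE//=.
  exact: (integrable_finite_norm p0 intf).
by exists (Lfun_Sub (lt1_le1E p1) fL).
Qed.

Lemma geometric_tail (V : zmodType) (nrm : V -> R) (v_ : nat -> V) :
  (forall u v, nrm (u + v) <= nrm u + nrm v) -> nrm 0 = 0 ->
  (forall j, nrm (v_ j.+1 - v_ j) <= 2^-1 ^+ j) ->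
  forall k j, nrm (v_ (j + k)%N - v_ k) <= 2 * 2^-1 ^+ k.
Proof.
move=> nD n0 vj k j.
have : nrm (v_ (j + k)%N - v_ k) <= 2 * 2^-1 ^+ k - 2 * 2^-1 ^+ (j + k).
  elim: j => [|j IH]; first by rewrite add0n !subrr n0.
  rewrite addSn -(subrKA (v_ (j + k)%N)).
  apply: (le_trans (nD _ _)).
  have := vj (j + k)%N; rewrite exprS; lra.
move=> /le_trans; apply; rewrite gerBl mulr_ge0// exprn_ge0// invr_ge0//.
Qed.

(** On a bounded domain L^p increments control L^1 increments, which yields an a.e. limit [f].
    Fatou's lemma transfers the tail bound to [f - f_k]; in particular [f - f_0] is in L^p, and
    adding [f_0] gives the limit as an element of L^p. *)
Lemma Lp_complete (f_ : nat -> Lp) :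
  (forall j, N (f_ j.+1 - f_ j) <= 2^-1 ^+ j) ->
  exists f : Lp, forall j, N (f - f_ j) <= 2 * 2^-1 ^+ j.
Proof.
move=> fj.
have tail k j : N (f_ (j + k)%N - f_ k) <= 2 * 2^-1 ^+ k.
  apply: (@geometric_tail Lp (fun f => N f)) => //.
  - by move=> u v; exact: ler_LnormD.
  - by have := @Lnorm0 _ _ _ mu p%:E (lt0r_neq0 p0); move=> /(congr1 fine).
have mf j : measurable_fun setT (f_ j) by exact: measurable_funP.
have [C C0 HC] := Lp_norm1_le oO bO p1.
have half : 0 <= (2^-1 : R) < 1 by rewrite invr_ge0 ler0n/= invf_lt1// ltr1n.
have [f mfl hf] : exists2 f : 'rV[R]_n -> R, measurable_fun setT f &
    {ae mu, forall x, (fun j => f_ j x) @ \oo --> f x}.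
  apply: (ae_limit_of_summable (C := C) half mf) => j.
  have -> : (\int[mu]_x `|f_ j.+1 x - f_ j x|%:E =
    ((\int[mu]_x `|(f_ j.+1 - f_ j : Lp) x|)%R)%:E)%E.
    by rewrite EFin_Rint//; exact: (ae_integrable_norm (Lp_integrable1 bO (f_ j.+1 - f_ j))).
  by rewrite lee_fin (le_trans (HC _))// ler_wpM2l.
have bound k : (\int[mu]_x (`|f x - f_ k x| `^ p)%:E <= ((2 * 2^-1 ^+ k) `^ p)%:E)%E.
  apply: (@fatou_le _ _ _ mu (fun j x => `|f_ (j + k)%N x - f_ k x| `^ p)).
  - by move=> j; apply/measurable_EFinP; exact: measurable_dist_powR.
  - by move=> j x; exact: powR_ge0.
  - apply: filterS hf => x hf; apply: (cvg_powR p1) => //.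
    apply: cvg_norm; apply: cvgB; last exact: cvg_cst.
    by rewrite (cvg_shiftn k (fun j => f_ j x)).
  - move=> j.
    have -> : (\int[mu]_x (`|f_ (j + k)%N x - f_ k x| `^ p)%:E =
      (N (f_ (j + k)%N - f_ k) `^ p)%:E)%E.
      rewrite Lp_normE EFin_Rint; last 2 first.
      - by move=> x; exact: powR_ge0.
      - exact: Lp_integrable.
      by [].
    rewrite lee_fin powR_le// ?(ltW p0)// Lp_norm_ge0//.
have id0 : ae_integrable mu (fun x => `|f x - f_ 0%N x| `^ p).
  apply: integrable_ae_integrable; apply/integrableP; split.
    exact: measurable_dist_powR.
  under eq_integral do rewrite gee0_abs ?lee_fin ?powR_ge0//.
  by rewrite (le_lt_trans (bound 0%N))// ltry.
have [d dE] := Lp_of_function (measurable_funB mfl (mf 0%N)) id0.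
exists (d + f_ 0%N) => k.
have E x : (d + f_ 0%N - f_ k : Lp) x = f x - f_ k x.
  by rewrite -[LHS]/(d x + f_ 0%N x - f_ k x) dE/= subrK.
have : N (d + f_ 0%N - f_ k) `^ p <= (2 * 2^-1 ^+ k) `^ p.
  rewrite -lee_fin Lp_normE EFin_Rint; last 2 first.
  - by move=> x; exact: powR_ge0.
  - exact: Lp_integrable.
  by under eq_integral do rewrite E; exact: bound.
have ip : 0 <= p^-1 by rewrite invr_ge0 ltW.
move=> /(powR_le ip (powR_ge0 _ _)).
by rewrite !powRK ?gt_eqF ?Lp_norm_ge0 ?mulr_ge0 ?exprn_ge0 ?invr_ge0.
Qed.

Lemma graph_complete (w_ : nat -> G) :
  (forall j, graph_norm (w_ j.+1 - w_ j) <= 2^-1 ^+ j) ->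
  exists w : G, forall j, graph_norm (w - w_ j) <= n.+1%:R * (2 * 2^-1 ^+ j).
Proof.
move=> wj.
have [f Hf] : exists f : Lp, forall j, N (f - (w_ j).1) <= 2 * 2^-1 ^+ j.
  apply: Lp_complete => j.
  exact: (le_trans (graph_norm_fun (w_ j.+1 - w_ j)) (wj j)).
have /choice[g Hg] : forall i : 'I_n, exists g : Lp, forall j,
    N (g - (w_ j).2 i) <= 2 * 2^-1 ^+ j.
  move=> i; apply: Lp_complete => j.
  have := le_trans (graph_norm_grad (w_ j.+1 - w_ j) i) (wj j).
  by rewrite (_ : (w_ j.+1 - w_ j).2 i = (w_ j.+1).2 i - (w_ j).2 i)//= !ffunE.
exists (f, [ffun i => g i]) => j.
rewrite /graph_norm -natr1 mulrDl mul1r addrC; apply: lerD; last exact: Hf.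
apply: (@le_trans _ _ (\sum_(i < n) (2 * 2^-1 ^+ j))).
  apply: ler_sum => i _; have := Hg i j.
  rewrite /graph_grad (_ : ((f, [ffun i0 => g i0]) - w_ j).2 i = g i - (w_ j).2 i)//=.
  by rewrite !ffunE.
by rewrite [leRHS]mulr_natl sumr_const card_ord.
Qed.

Lemma in_sobolev0_closed (w : G) :
  (forall e, 0 < e -> exists2 z, z \in in_sobolev0 (oO := oO) (p1 := p1) &
    graph_norm (w - z) < e) -> w \in in_sobolev0 (oO := oO) (p1 := p1).
Proof.
move=> hw; apply/mem_set => e e0.
have [z /set_mem hz wz] := hw (e / 2) (divr_gt0 e0 (ltr0n _ 2)).
have [t tt zt] := hz (e / 2) (divr_gt0 e0 (ltr0n _ 2)).
exists t => //; rewrite -(subrKA z) (splitr e).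
by rewrite (le_lt_trans (graph_normD _ _))// ltrD.
Qed.

Lemma geometric_half_lt (C e : R) : 0 < e -> exists j : nat, C * 2^-1 ^+ j < e.
Proof.
move=> e0.
have : geometric C (2^-1 : R) @ \oo --> (0 : R).
  by apply: cvg_geometric; rewrite ger0_norm// invf_lt1// ltr1n.
move=> /cvgrPdist_lt => /(_ e e0) [j _ /(_ j (leqnn j))].
rewrite sub0r normrN => h; exists j; exact: (le_lt_trans (ler_norm _)).
Qed.

Lemma sobolev0_complete (u_ : nat -> W) :
  (forall j, sobolev0_norm (u_ j.+1 - u_ j) <= 2^-1 ^+ j) ->
  exists u : W, (fun j => sobolev0_norm (u - u_ j)) @ \oo --> 0.
Proof.
move=> uj.
have [w Hw] := @graph_complete (fun j => \val (u_ j)) uj.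
have ws : w \in in_sobolev0 (oO := oO) (p1 := p1).
  apply: in_sobolev0_closed => e e0.
  have [j hj] := geometric_half_lt (n.+1%:R * 2) e0.
  exists (\val (u_ j)); first exact: valP.
  by rewrite (le_lt_trans (Hw j))// mulrA.
exists (Sobolev0 ws).
apply: (@cvg_norm_sub _ _ _ (geometric (n.+1%:R * 2) 2^-1)).
  move=> j; rewrite subr0 ger0_norm; last exact: graph_norm_ge0.
  by have := Hw j; rewrite mulrA.
by apply: cvg_geometric; rewrite ger0_norm// invf_lt1// ltr1n.
Qed.

End completeness.

Lemma powR_sum_le (R : realType) (p : R) (p1 : 1 < p) (I : finType) (f : I -> R) :
  (forall i, 0 <= f i) -> (\sum_i f i) `^ p <= #|I|%:R `^ p * \sum_i f i `^ p.
Proof.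
move=> f0; have p0 : 0 < p by exact: lt_trans p1.
pose s := (\sum_i f i `^ p) `^ p^-1.
have S0 : 0 <= \sum_i f i `^ p by apply: sumr_ge0 => i _; exact: powR_ge0.
have fs i : f i <= s.
  rewrite -(powRK (f0 i) (lt0r_neq0 p0)) powR_le ?powR_ge0 ?invr_ge0 ?(ltW p0)//.
  by rewrite (bigD1 i)//= lerDl sumr_ge0// => j _; exact: powR_ge0.
have h : \sum_i f i <= #|I|%:R * s.
  by rewrite mulr_natl -sumr_const; apply: ler_sum.
apply: (@le_trans _ _ ((#|I|%:R * s) `^ p)).
  by rewrite powR_le ?(ltW p0)// sumr_ge0.
by rewrite powRM ?powR_ge0// /s powRVK ?lt0r_neq0.
Qed.

(** * Energies and bounded linear forms on W_0^{1,p} *)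

Section sobolev_structure.
Context (R : realType) (n : nat) (n_gt0 : (0 < n)%N) (O : set 'rV[R]_n)
  (oO : open O) (bO : bounded_set O) (p : R) (p1 : 1 < p).
Local Notation mu := (lebesgue_on oO).
Local Notation Lp := (LfunType mu (lt1_le1E p1)).
Local Notation W := (sobolev0 oO p1).
Local Notation N f := (fine 'N[mu]_p%:E[EFin \o f]).
Implicit Types u v w : W.
Let p0 : 0 < p. Proof. exact: lt_trans p1. Qed.

Lemma grad_linear (c : R) u v x : grad (c *: u + v) x = c *: grad u x + grad v x.
Proof. by apply/rowP => i; rewrite !mxE /graph_grad !ffunE. Qed.

Lemma gradZ (c : R) u x : grad (c *: u) x = c *: grad u x.
Proof. by apply/rowP => i; rewrite !mxE /graph_grad !ffunE. Qed.

Lemma gradD u v x : grad (u + v) x = grad u x + grad v x.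
Proof. by apply/rowP => i; rewrite !mxE /graph_grad !ffunE. Qed.

Lemma gradN u x : grad (- u) x = - grad u x.
Proof. by apply/rowP => i; rewrite !mxE /graph_grad !ffunE. Qed.

Lemma gradB u v x : grad (u - v) x = grad u x - grad v x.
Proof. by rewrite gradD gradN. Qed.

Lemma sobolev0_funZ (c : R) u x : sobolev0_fun (c *: u) x = c * sobolev0_fun u x.
Proof. by []. Qed.

Lemma sobolev0_funN u x : sobolev0_fun (- u) x = - sobolev0_fun u x.
Proof. by []. Qed.

Lemma sobolev0_normD u v : sobolev0_norm (u + v) <= sobolev0_norm u + sobolev0_norm v.
Proof. exact: graph_normD. Qed.

Lemma sobolev0_normZ (c : R) u : sobolev0_norm (c *: u) = `|c| * sobolev0_norm u.
Proof. exact: graph_normZ. Qed.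

Lemma sobolev0_normN u : sobolev0_norm (- u) = sobolev0_norm u.
Proof. exact: graph_normN. Qed.

Lemma sobolev0_norm_ge0 u : 0 <= sobolev0_norm u.
Proof. exact: graph_norm_ge0. Qed.

Lemma sobolev0_norm0 : sobolev0_norm (0 : W) = 0.
Proof. exact: graph_norm0. Qed.

Lemma sobolev0_normB u v : sobolev0_norm (u - v) = sobolev0_norm (v - u).
Proof. by rewrite -sobolev0_normN opprB. Qed.

Lemma measurable_grad u : measurable_fun setT (grad u).
Proof.
apply: measurable_fun_coorP => i; under eq_fun do rewrite mxE.
exact: measurable_funP.
Qed.

Lemma measurable_dotr d (T : measurableType d) (f g : T -> 'rV[R]_n) :
  measurable_fun setT f -> measurable_fun setT g ->
  measurable_fun setT (fun x => dotr (f x) (g x)).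
Proof.
move=> mf mg; apply: measurable_sum => i.
by apply: measurable_funM; apply: (measurableT_comp (@measurable_coor R n i)).
Qed.

Lemma measurable_enorm d (T : measurableType d) (f : T -> 'rV[R]_n) :
  measurable_fun setT f -> measurable_fun setT (fun x => enorm (f x)).
Proof.
move=> mf; rewrite (_ : (fun _ => _) = (fun x => dotr (f x) (f x) `^ 2^-1)).
  apply: (measurableT_comp (measurable_powR 2^-1)).
  exact: measurable_dotr.
by apply/funext => x; rewrite powR12_sqrt// dotr_ge0.
Qed.

Definition grad_energy u : R := (\int[mu]_x enorm (grad u x) `^ p)%R.
Definition fun_energy u : R := (\int[mu]_x `|sobolev0_fun u x| `^ p)%R.

Lemma grad_enorm_mfun u : ae_mfun mu (fun x => enorm (grad u x) `^ p).
Proof.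
apply: ae_mfun_powR; apply: measurable_ae_mfun.
by apply: measurable_enorm; exact: measurable_grad.
Qed.

Lemma enorm_powR_le (xi : 'rV[R]_n) :
  enorm xi `^ p <= n%:R `^ p * \sum_i `|xi 0 i| `^ p.
Proof.
apply: (@le_trans _ _ ((\sum_i `|xi 0 i|) `^ p)).
  by rewrite powR_le ?(ltW p0) ?enorm_ge0// enorm_le_sum.
have := @powR_sum_le _ _ p1 'I_n (fun i => `|xi 0 i|) (fun i => normr_ge0 _).
by rewrite card_ord.
Qed.

Lemma grad_coord_integrable u i : ae_integrable mu (fun x => `|grad u x 0 i| `^ p).
Proof.
under eq_fun do rewrite mxE; exact: Lp_integrable.
Qed.

Lemma grad_integrable u : ae_integrable mu (fun x => enorm (grad u x) `^ p).
Proof.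
apply: (@ae_integrable_le _ _ _ _ _ (fun x => n%:R `^ p * \sum_i `|grad u x 0 i| `^ p)).
- exact: grad_enorm_mfun.
- apply: ae_integrableZ; apply: ae_integrable_sum => i.
  exact: grad_coord_integrable.
- by apply: aeW => x; rewrite powR_ge0 enorm_powR_le.
Qed.

Lemma fun_integrable u : ae_integrable mu (fun x => `|sobolev0_fun u x| `^ p).
Proof. exact: Lp_integrable. Qed.

Lemma grad_energy_ge0 u : 0 <= grad_energy u.
Proof. by apply: Rint_ge0; apply: aeW => x; exact: powR_ge0. Qed.

Lemma fun_energy_ge0 u : 0 <= fun_energy u.
Proof. by apply: Rint_ge0; apply: aeW => x; exact: powR_ge0. Qed.

Lemma graph_energyE u : graph_energy (\val u) =
  \sum_i (\int[mu]_x `|grad u x 0 i| `^ p)%R.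
Proof.
apply: eq_bigr => i _; rewrite Lp_normE.
by apply: eq_Rintegral => x _; rewrite mxE.
Qed.

Lemma grad_energy_le_graph u : grad_energy u <= n%:R `^ p * graph_energy (\val u).
Proof.
rewrite graph_energyE -Rint_sum; last by move=> i; exact: grad_coord_integrable.
rewrite -RintZ; last first.
  by apply: ae_integrable_sum => i; exact: grad_coord_integrable.
apply: Rint_le; first exact: grad_integrable.
  by apply/ae_integrableZ/ae_integrable_sum => i; exact: grad_coord_integrable.
by apply: aeW => x; exact: enorm_powR_le.
Qed.

Lemma graph_energy_le_grad u : graph_energy (\val u) <= n%:R * grad_energy u.
Proof.
rewrite graph_energyE mulr_natl -[n in leRHS]card_ord -sumr_const.
apply: ler_sum => i _; apply: Rint_le.
- exact: grad_coord_integrable.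
- exact: grad_integrable.
- apply: aeW => x; rewrite powR_le ?(ltW p0)//; exact: coord_le_enorm.
Qed.

Lemma grad_energy_le_norm : exists2 C : R, 0 < C &
  forall u, grad_energy u <= C * sobolev0_norm u `^ p.
Proof.
exists (n%:R `^ p * n%:R); first by rewrite mulr_gt0 ?powR_gt0 ?ltr0n.
move=> u; apply: (le_trans (grad_energy_le_graph u)).
rewrite -mulrA ler_wpM2l ?powR_ge0//.
apply: (@le_trans _ _ (\sum_(i < n) sobolev0_norm u `^ p)); last first.
  by rewrite sumr_const card_ord mulr_natl.
apply: ler_sum => i _; rewrite powR_le ?(ltW p0) ?Lp_norm_ge0//.
exact: graph_norm_grad.
Qed.

Lemma fun_energyE u : N (\val u).1 `^ p = fun_energy u.
Proof. exact: Lp_normE. Qed.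

Lemma fun_energy_le_grad : exists2 C : R, 0 < C &
  forall u, fun_energy u <= C * grad_energy u.
Proof.
have [C C0 HC] := poincare_graph n_gt0 oO bO p1.
exists (C * n%:R + 1); first by rewrite ltr_wpDl// mulr_ge0.
move=> u; rewrite -fun_energyE; apply: (le_trans (HC _ (valP u))).
apply: (@le_trans _ _ (C * (n%:R * grad_energy u))).
  by rewrite ler_wpM2l// graph_energy_le_grad.
by rewrite mulrA mulrDl lerDl mul1r grad_energy_ge0.
Qed.

Lemma norm_le_grad_energy : exists2 C : R, 0 < C &
  forall u, sobolev0_norm u `^ p <= C * grad_energy u.
Proof.
have [C C0 HC] := fun_energy_le_grad.
exists (2 `^ p * (C + n%:R `^ p * n%:R)).
  by rewrite mulr_gt0 ?powR_gt0// addr_gt0// mulr_gt0 ?powR_gt0 ?ltr0n.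
move=> u; rewrite /sobolev0_norm /graph_norm.
have S0 : 0 <= \sum_i N (graph_grad (\val u) i).
  by apply: sumr_ge0 => i _; exact: Lp_norm_ge0.
apply: (le_trans (powRD_le p0 (Lp_norm_ge0 (\val u).1) S0)).
rewrite -mulrA ler_wpM2l ?powR_ge0// mulrDl; apply: lerD.
  by rewrite fun_energyE.
have := @powR_sum_le _ _ p1 'I_n (fun i => N ((\val u).2 i)) (fun i => Lp_norm_ge0 _).
rewrite card_ord => /le_trans; apply; rewrite -mulrA ler_wpM2l ?powR_ge0//.
exact: graph_energy_le_grad.
Qed.

Lemma grad_energyZ (c : R) u : grad_energy (c *: u) = `|c| `^ p * grad_energy u.
Proof.
rewrite -RintZ; last exact: grad_integrable.
by apply: eq_Rintegral => x _; rewrite gradZ enormZ powRM// enorm_ge0.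
Qed.

Lemma grad_energyN u : grad_energy (- u) = grad_energy u.
Proof. by apply: eq_Rintegral => x _; rewrite gradN enormN. Qed.

Lemma grad_energyD u v :
  grad_energy (u + v) <= 2 `^ p * (grad_energy u + grad_energy v).
Proof.
rewrite -RintD ?grad_integrable//; try exact: grad_integrable.
rewrite -RintZ; last by apply: ae_integrableD; exact: grad_integrable.
apply: Rint_le; first exact: grad_integrable.
  by apply/ae_integrableZ/ae_integrableD; exact: grad_integrable.
apply: aeW => x; rewrite gradD.
apply: (@le_trans _ _ ((enorm (grad u x) + enorm (grad v x)) `^ p)).
  by rewrite powR_le ?(ltW p0) ?enorm_ge0// enormD.
by apply: powRD_le; rewrite // enorm_ge0.
Qed.

(* Stated with values in R rather than R^o, which keeps the arithmetic of the
   values in R. *)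
Definition is_linear (l : W -> R) : Prop :=
  forall (c : R) u v, l (c *: u + v) = c * l u + l v.

Lemma is_linear0 l : is_linear l -> l 0 = 0.
Proof. by move=> /(_ 1 0 0); rewrite scaler0 addr0 mul1r; lra. Qed.

Lemma is_linearZ l (c : R) u : is_linear l -> l (c *: u) = c * l u.
Proof. by move=> ll; rewrite -[c *: u]addr0 ll (is_linear0 ll) addr0. Qed.

Lemma is_linearD l u v : is_linear l -> l (u + v) = l u + l v.
Proof. by move=> ll; rewrite -[u]scale1r ll scale1r mul1r. Qed.

Lemma is_linearN l u : is_linear l -> l (- u) = - l u.
Proof. by move=> ll; rewrite -scaleN1r (is_linearZ _ _ ll) mulN1r. Qed.

Lemma is_linearB l u v : is_linear l -> l (u - v) = l u - l v.
Proof. by move=> ll; rewrite is_linearD// is_linearN. Qed.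

Lemma linear_form (f : W -> R) : is_linear f ->
  exists l : {linear W -> R^o}, l = f :> (W -> R).
Proof.
move=> lf; pose F : W -> R^o := f.
have lF : linear F by move=> c u v; exact: lf.
pose m := GRing.isLinear.Build R W R^o _ F lF.
by exists (HB.pack F m : {linear W -> R^o}).
Qed.

Definition bounded_form (l : W -> R) : Prop :=
  exists2 K : R, 0 <= K & forall u, `|l u| <= K * sobolev0_norm u.

Lemma sobolev0_ballE u (e : R) : ball u e = [set v | sobolev0_norm (u - v) < e].
Proof. by []. Qed.

Lemma bounded_form_dual (l : {linear W -> R^o}) : bounded_form l -> dual_sobolev l.
Proof.
move=> [K K0 lK] u; apply/(@cvgrPdist_lt _ _ _ (nbhs u) (nbhs_filter u)) => e e0.
have K1 : 0 < K + 1 by rewrite ltr_wpDl.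
apply/nbhs_ballP; exists (e / (K + 1)); first exact: divr_gt0.
move=> v; rewrite sobolev0_ballE/= => uv; rewrite -linearB/=.
apply: (le_lt_trans (lK _)); rewrite -(@ltr_pM2l _ (K + 1))// in uv.
rewrite [ltRHS]mulrC divfK ?gt_eqF// in uv.
apply: le_lt_trans uv; rewrite ler_wpM2r ?sobolev0_norm_ge0// lerDl//.
Qed.

Lemma dual_norm_le (f : W -> R) (K : R) : (forall u, `|f u| <= K * sobolev0_norm u) ->
  0 <= K -> (dual_norm f <= K%:E)%E.
Proof.
move=> fK K0; apply: ge_ereal_sup => _ [u /= u1 <-].
by rewrite lee_fin (le_trans (fK u))// ler_piMr.
Qed.

Lemma ehrling (eta : R) : 0 < eta ->
  exists (m : nat) (l : 'I_m -> W -> R) (K : R), [/\ 0 <= K,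
    (forall i, is_linear (l i)), (forall i, bounded_form (l i)) & forall u,
    fun_energy u <= eta * grad_energy u + K * \sum_i `|l i u| `^ p].
Proof.
move=> e0.
(* The division by [n] pays for [graph_energy_le_grad]. *)
have en0 : 0 < eta / n%:R by rewrite divr_gt0// ltr0n.
have [I [Q [K [K0 mQ HQ]]]] := ehrling_graph oO bO p1 en0.
have [C C0 HC] := cell_integral_le oO bO p1.
exists #|I|, (fun i u => cell_integral (Q (enum_val i)) (\val u)), K; split => //.
- by move=> i c u v; exact: cell_integral_linear.
- by move=> i; exists C => // u; exact: HC.
move=> u; rewrite -fun_energyE; apply: (le_trans (HQ _ (valP u))).
apply: lerD.
  apply: (@le_trans _ _ (eta / n%:R * (n%:R * grad_energy u))).
    by rewrite ler_wpM2l ?(ltW en0)// graph_energy_le_grad.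
  by rewrite mulrA divfK// pnatr_eq0 -lt0n.
rewrite ler_wpM2l// (reindex (@enum_val I predT))/=; last first.
  by exists enum_rank => i _; rewrite ?enum_rankK ?enum_valK.
by [].
Qed.

(* P e is meant to be the sublevel set {J <= inf J + e} of a convex functional. *)
Lemma cauchy_family_limit (P : R -> set W) :
  (forall e, 0 < e -> exists u, P e u) ->
  (forall e e', 0 < e -> e <= e' -> P e `<=` P e') ->
  (forall d, 0 < d -> exists2 e, 0 < e &
    forall u v, P e u -> P e v -> grad_energy (u - v) <= d) ->
  exists w, forall d e, 0 < d -> 0 < e ->
    exists2 u, P e u & sobolev0_norm (w - u) <= d.
Proof.
move=> Pe Pm Pc.
have [C C0 HC] := norm_le_grad_energy.
have /choice[e_ e_P] : forall j : nat, exists e, 0 < e /\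
    forall u v, P e u -> P e v -> sobolev0_norm (u - v) <= 2^-1 ^+ j.
  move=> j; have j0 : 0 < (2^-1 ^+ j : R) by rewrite exprn_gt0 ?invr_gt0.
  have [|e ep He] := Pc ((2^-1 ^+ j) `^ p / C); first by rewrite divr_gt0 ?powR_gt0.
  exists e; split => // u v Pu Pv.
  have := le_trans (HC (u - v)) (ler_wpM2l (ltW C0) (He u v Pu Pv)).
  rewrite mulrC divfK ?gt_eqF// => h.
  have ip : 0 <= p^-1 by rewrite invr_ge0 ltW.
  have := powR_le ip (powR_ge0 _ _) h.
  by rewrite !powRK ?gt_eqF ?sobolev0_norm_ge0 ?(ltW j0).
(* A decreasing sequence below [e_ j], so that consecutive choices are [2^-j]-close, and below
   [1/(j+1)], so that every sublevel is eventually reached. *)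
pose d_ := fix d_ j := if j is i.+1 then Num.min (d_ i) (Num.min (e_ j) (j.+1%:R^-1))
  else Num.min (e_ 0%N) 1.
have d0 j : 0 < d_ j.
  elim: j => [|j IH] /=; first by rewrite lt_min ltr01 (e_P 0%N).1.
  by rewrite !lt_min IH (e_P j.+1).1 invr_gt0 ltr0n.
have de j : d_ j <= e_ j.
  by case: j => [|j] /=; rewrite ?ge_min ?lexx ?orbT// ge_min lexx orbT.
have dS j : d_ j.+1 <= d_ j by rewrite /= ge_min lexx.
have dj j : d_ j <= j.+1%:R^-1.
  case: j => [|j]; first by rewrite /= invr1 ge_min lexx orbT.
  by rewrite /= !ge_min lexx !orbT.
have /choice[u_ u_P] : forall j, exists u, P (d_ j) u by move=> j; exact: Pe.
have [w Hw] : exists w : W, (fun j => sobolev0_norm (w - u_ j)) @ \oo --> 0.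
  apply: sobolev0_complete => // j; apply: (e_P j).2.
    apply: (Pm (d_ j.+1)) => //; exact: (le_trans (dS j) (de j)).
  exact: (Pm (d_ j)).
exists w => d e dp ep.
move/cvgrPdist_le : Hw => /(_ d dp) [j1 _ Hj1].
have : (fun j => j.+1%:R^-1 : R) @ \oo --> 0 by exact: cvg_harmonic.
move/cvgrPdist_le => /(_ e ep) [j2 _ Hj2].
exists (u_ (maxn j1 j2)).
  apply: (Pm (d_ (maxn j1 j2))) => //; apply: (le_trans (dj _)).
  have := Hj2 (maxn j1 j2) (leq_maxr _ _).
  by rewrite sub0r normrN ger0_norm// invr_ge0.
have := Hj1 (maxn j1 j2) (leq_maxl _ _).
by rewrite sub0r normrN ger0_norm// sobolev0_norm_ge0.
Qed.

End sobolev_structure.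

(* Unification would otherwise unfold the integrals behind these functions. *)
#[global] Opaque grad_energy fun_energy sobolev0_norm.

(** * Monotone operators *)

Lemma le0_of_le_mul (R : realType) (x S : R) :
  (forall eta, 0 < eta -> x <= eta * S) -> x <= 0.
Proof.
move=> h; have [S0|S0] := leP S 0.
  by have := h 1 ltr01; rewrite mul1r => /le_trans; apply.
apply/ler_addgt0Pr => e e0; rewrite add0r.
by have := h (e / S) (divr_gt0 e0 S0); rewrite divfK ?gt_eqF.
Qed.

Lemma scaler_half (R : realType) (V : lmodType R) (w : V) : 2^-1 *: (w + w) = w.
Proof. by rewrite -mulr2n -[w *+ 2]scaler_nat scalerA mulVf ?scale1r. Qed.

(** The points [u], [m + d], [m], [m - d], [v] are equally spaced on a segment;
    [op_uniformly_convex] compares energies at these five points. *)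
Lemma quarter_points (R : realType) (V : lmodType R) (u v : V) :
  let m := 2^-1 *: (u + v) in let d := 4^-1 *: (u - v) in
  [/\ u - (m + d) = d, v - (m - d) = - d & u - v = 4 *: d].
Proof.
move=> m d.
have dd : d + d = 2^-1 *: (u - v).
  by rewrite -scalerDl; congr (_ *: _); lra.
have E1 : u = m + d + d.
  by rewrite -addrA dd -scalerDr addrACA subrr addr0 scaler_half.
have E2 : v = m - d - d.
  by rewrite -addrA -opprD dd -scalerBr opprD opprK addrACA subrr add0r scaler_half.
split.
- by rewrite {1}E1 [_ + d + d]addrC addrK.
- by rewrite {1}E2 [_ - d - d]addrC addrK.
- by rewrite scalerA mulfV ?scale1r.
Qed.

Section regular_operators.
Context (R : realType) (n : nat) (n_gt0 : (0 < n)%N) (O : set 'rV[R]_n)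
  (oO : open O) (bO : bounded_set O) (p : R) (p1 : 1 < p).
Local Notation W := (sobolev0 oO p1).
Implicit Types u v w z : W.
Let p0 : 0 < p. Proof. exact: lt_trans p1. Qed.

(* The integrated form of the structure conditions on a, for the operator
   A u = -div(a(x, grad u)), whose energy is A u u. *)
Record regular_operator (A : W -> W -> R) (alpha beta : R) (K3 K4 : R -> R) : Prop := {
  op_alpha : 0 < alpha ;
  op_beta : 0 < beta ;
  op_K3 : forall eta, 0 <= K3 eta ;
  op_K4 : forall eta, 0 <= K4 eta ;
  op_linear : forall u, is_linear (A u) ;
  op_coercive : forall u, alpha * grad_energy u <= A u u ;
  op_le : forall u, A u u <= beta * grad_energy u ;
  op_hom : forall (c : R) u, A (c *: u) (c *: u) = `|c| `^ p * A u u ;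
  op_odd : forall u z, A (- u) z = - A u z ;
  op_subgradient : forall u v, A u u + p * A u (v - u) <= A v v ;
  op_strict : forall eta, 0 < eta -> forall u v, grad_energy (u - v) <=
    eta * (A u u + A v v) + K3 eta * (A u (u - v) - A v (u - v)) ;
  op_equi : forall eta, 0 < eta -> forall u v z, `|A u z - A v z| <=
    eta * (grad_energy u + grad_energy v + grad_energy z) +
    K4 eta * grad_energy (u - v) }.

(** The norm may vanish at a nonzero element, so [u] is scaled by the inverse of
    [sobolev0_norm u + e] and [e] is sent to 0. *)
Lemma form_le_of_ball (l : W -> R) (C : R) : is_linear l ->
  (forall u, sobolev0_norm u <= 1 -> `|l u| <= C) ->
  forall u, `|l u| <= C * sobolev0_norm u.
Proof.
move=> ll lC u; have C0 : 0 <= C.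
  by apply: (le_trans (normr_ge0 (l 0))); apply: lC; rewrite sobolev0_norm0.
have h e : 0 < e -> `|l u| <= C * (sobolev0_norm u + e).
  move=> e0; have s0 : 0 < sobolev0_norm u + e by rewrite ltr_wpDl ?sobolev0_norm_ge0.
  have := lC ((sobolev0_norm u + e)^-1 *: u).
  rewrite sobolev0_normZ (is_linearZ _ _ ll) normrM ger0_norm ?invr_ge0 ?(ltW s0)//.
  rewrite !ler_pdivrMl// mulr1 lerDl (ltW e0) => /(_ isT).
  by rewrite mulrC.
apply/ler_addgt0Pr => e e0.
have C1 : 0 < C + 1 by rewrite ltr_wpDl.
apply: (le_trans (h (e / (C + 1)) (divr_gt0 e0 C1))).
rewrite mulrDr lerD2l mulrCA ler_piMr ?(ltW e0)// ler_pdivrMr// mul1r lerDl//.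
Qed.

Lemma grad_energy_bound_of_norm (K : R) (a : R) : 0 <= K -> 0 < a ->
  exists2 M : R, 0 <= M & forall u, K * sobolev0_norm u <= a * grad_energy u + M.
Proof.
move=> K0 a0; have [C C0 HC] := norm_le_grad_energy n_gt0 oO bO p1.
have [L L0 HL] := mul_le_powRDr p1 (divr_gt0 a0 C0).
exists (L * K `^ (p / (p - 1))); first by rewrite mulr_ge0// powR_ge0.
move=> u; apply: (le_trans (HL K (sobolev0_norm u) K0 (sobolev0_norm_ge0 u))).
rewrite addrC lerD2r; apply: (le_trans (ler_wpM2l _ (HC u))).
  by rewrite divr_ge0// ltW.
by rewrite mulrA divfK// gt_eqF.
Qed.

Lemma grad_energy_eq0_norm u : grad_energy u <= 0 -> sobolev0_norm u = 0.
Proof.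
move=> u0; have [C C0 HC] := norm_le_grad_energy n_gt0 oO bO p1.
apply: (@powR_eq0_eq0 _ _ p); apply/eqP; rewrite eq_le powR_ge0 andbT.
apply: (le_trans (HC u)); rewrite mulr_ge0_le0// ltW//.
Qed.

Lemma bounded_form_eq0 (l : W -> R) u :
  bounded_form l -> sobolev0_norm u = 0 -> l u = 0.
Proof.
move=> [K K0 lK] u0; have := lK u; rewrite u0 mulr0 normr_le0 => /eqP//.
Qed.

Lemma grad_energy_norm_small (d : R) : 0 < d -> exists2 e, 0 < e &
  forall u, grad_energy u <= e -> sobolev0_norm u <= d.
Proof.
move=> d0; have [C C0 HC] := norm_le_grad_energy n_gt0 oO bO p1.
exists (d `^ p / C); first by rewrite divr_gt0// powR_gt0.
move=> u ue; have := le_trans (HC u) (ler_wpM2l (ltW C0) ue).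
rewrite mulrC divfK ?gt_eqF// => h.
have ip : 0 <= p^-1 by rewrite invr_ge0 ltW.
have := powR_le ip (powR_ge0 _ _) h.
by rewrite !powRK ?gt_eqF ?sobolev0_norm_ge0 ?(ltW d0).
Qed.

(** The a priori bound: coercivity of degree [p > 1] beats the linear growth of the right-hand
    side. *)
Lemma energy_bound (alpha K : R) : 0 < alpha -> 0 <= K ->
  exists2 Q, 0 <= Q & forall E w, alpha * grad_energy w <= E ->
    E <= K * sobolev0_norm w -> [/\ grad_energy w <= Q, E <= Q & sobolev0_norm w <= Q].
Proof.
move=> a0 K0; have a20 : 0 < alpha / 2 by rewrite divr_gt0.
have [M M0 HM] := grad_energy_bound_of_norm K0 a20.
have [L L0 HL] := grad_energy_bound_of_norm (ler01 : (0 : R) <= 1) ltr01.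
have M1 : 0 <= M / (alpha / 2) by rewrite divr_ge0// ltW.
exists (M / (alpha / 2) + L + 2 * M); first by rewrite !addr_ge0// mulr_ge0.
move=> E w h1 h2; have h3 := HM w; have h4 := HL w.
have g0 := grad_energy_ge0 w.
have h5 : grad_energy w <= M / (alpha / 2).
  by rewrite ler_pdivlMr// mulrC; lra.
have h6 : alpha / 2 * grad_energy w <= M.
  by rewrite mulrC -ler_pdivlMr.
split; lra.
Qed.

(** [r] is fixed before the operator, so it serves all [A_e] at once. The proof applies [op_strict]
    to [w'] and [w]: by the a priori bound [Q] the first term is small through [eta], and the second
    through [r]. The hypotheses are inequalities, so they also hold for problems with an additional
    monotone term. *)
Lemma solution_stability (alpha beta : R) (K3 K4 : R -> R) (K d : R) :
    0 < alpha -> (forall eta, 0 <= K3 eta) -> 0 <= K -> 0 < d ->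
  exists2 r, 0 < r & forall (A : W -> W -> R) (g g' : W -> R) w w',
    regular_operator A alpha beta K3 K4 ->
    (forall z, `|g z| <= K * sobolev0_norm z) ->
    (forall z, `|g' z - g z| <= r * sobolev0_norm z) ->
    A w w <= g w -> A w' w' <= g' w' ->
    A w' (w' - w) - A w (w' - w) <= g' (w' - w) - g (w' - w) ->
    grad_energy (w' - w) <= d.
Proof.
move=> a0 K30 K0 d0.
have K10 : 0 <= K + 1 by rewrite addr_ge0.
have [Q Q0 HQ] := energy_bound a0 K10.
have Q1 : 0 < 2 * Q + 1 by rewrite ltr_wpDl// mulr_ge0.
pose eta := d / 2 / (2 * Q + 1).
have eta0 : 0 < eta by rewrite !divr_gt0.
have k1 : 0 < K3 eta * (2 * Q) + 1 by rewrite ltr_wpDl// !mulr_ge0.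
exists (Num.min 1 (d / 2 / (K3 eta * (2 * Q) + 1))).
  by rewrite lt_min ltr01 !divr_gt0.
move=> A g g' w w' Areg gK gg' Aw Aw' mono.
set r := Num.min _ _ in gg'.
have r0 : 0 <= r by rewrite le_min ler01 !divr_ge0 ?(ltW d0)// ltW.
have r1 : r <= 1 by rewrite ge_min lexx.
have r2 : r * (K3 eta * (2 * Q) + 1) <= d / 2.
  by rewrite -ler_pdivlMr// ge_min lexx orbT.
have [_ Ew nw] : [/\ grad_energy w <= Q, A w w <= Q & sobolev0_norm w <= Q].
  apply: HQ; first exact: (op_coercive Areg).
  apply: (le_trans Aw); apply: (le_trans (ler_norm _)); apply: (le_trans (gK w)).
  by rewrite ler_wpM2r ?sobolev0_norm_ge0// lerDl.
have [_ Ew' nw'] : [/\ grad_energy w' <= Q, A w' w' <= Q & sobolev0_norm w' <= Q].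
  apply: HQ; first exact: (op_coercive Areg).
  apply: (le_trans Aw').
  have -> : g' w' = g w' + (g' w' - g w') by rewrite addrC subrK.
  rewrite mulrDl; apply: lerD; first by apply: (le_trans (ler_norm _)).
  apply: (le_trans (ler_norm _)); apply: (le_trans (gg' w')).
  by rewrite ler_wpM2r ?sobolev0_norm_ge0.
apply: (le_trans (op_strict Areg eta0 w' w)).
have h1 : eta * (A w' w' + A w w) <= d / 2.
  apply: (@le_trans _ _ (eta * (2 * Q + 1))); last by rewrite divfK// gt_eqF.
  by rewrite ler_wpM2l ?(ltW eta0)//; lra.
have h2 : A w' (w' - w) - A w (w' - w) <= r * (2 * Q).
  apply: (le_trans mono); apply: (le_trans (ler_norm _)); apply: (le_trans (gg' _)).
  rewrite ler_wpM2l//; apply: (le_trans (sobolev0_normD _ _)).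
  by rewrite sobolev0_normN; lra.
have h3 := ler_wpM2l (K30 eta) h2.
have h4 : K3 eta * (r * (2 * Q)) <= r * (K3 eta * (2 * Q) + 1).
  by rewrite mulrDr mulr1 mulrCA lerDl.
lra.
Qed.

Section operator.
Variables (A : W -> W -> R) (alpha beta : R) (K3 K4 : R -> R).
Context (Areg : regular_operator A alpha beta K3 K4).

Let a0 : 0 < alpha. Proof. exact: (op_alpha Areg). Qed.
Let lA u : is_linear (A u). Proof. exact: (op_linear Areg). Qed.

Lemma op_energy_ge0 u : 0 <= A u u.
Proof.
by apply: le_trans (op_coercive Areg u); rewrite mulr_ge0 ?(ltW a0)// grad_energy_ge0.
Qed.

Lemma op0 z : A 0 z = 0.
Proof.
have := op_odd Areg 0 z; rewrite oppr0; lra.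
Qed.

Lemma op_bounded u : bounded_form (A u).
Proof.
have [C C0 HC] := grad_energy_le_norm n_gt0 oO p1.
exists (grad_energy u + C + K4 1 * grad_energy u).
  rewrite !addr_ge0 ?(ltW C0) ?grad_energy_ge0// mulr_ge0 ?grad_energy_ge0//.
  exact: (op_K4 Areg).
apply: form_le_of_ball => // z z1.
have := op_equi Areg ltr01 u 0 z; rewrite op0 subr0 mul1r subr0.
have -> : grad_energy (0 : W) = 0.
  by rewrite -(scale0r 0) grad_energyZ normr0 powR0 ?mul0r ?lt0r_neq0.
rewrite addr0 => /le_trans; apply; rewrite lerD2r lerD2l.
apply: (le_trans (HC z)); rewrite ler_piMr ?(ltW C0)//.
have := powR_le (ltW p0) (sobolev0_norm_ge0 z) z1.
by rewrite powR1.
Qed.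

Lemma op_monotone u v : 0 <= A u (u - v) - A v (u - v).
Proof.
have h1 := op_subgradient Areg u v; have h2 := op_subgradient Areg v u.
rewrite -(opprB u v) (is_linearN _ (lA u)) in h1.
have : 0 <= p * (A u (u - v) - A v (u - v)) by lra.
by rewrite pmulr_rge0.
Qed.

(** Elements of [sobolev0] at distance 0 need not be equal; that [A] ignores the difference follows
    from [op_equi] with [eta] tending to 0. *)
Lemma op_eq_of_norm0 u v : sobolev0_norm (u - v) = 0 -> forall z, A u z = A v z.
Proof.
move=> uv z; apply/eqP; rewrite -subr_eq0 -normr_le0.
have [C C0 HC] := grad_energy_le_norm n_gt0 oO p1.
have Guv : grad_energy (u - v) = 0.
  apply/eqP; rewrite eq_le grad_energy_ge0 andbT; apply: (le_trans (HC _)).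
  by rewrite uv powR0 ?mulr0 ?lt0r_neq0.
apply: le0_of_le_mul => eta e0; have := op_equi Areg e0 u v z.
by rewrite Guv mulr0 addr0; exact.
Qed.

(** With [q = m + d] and [r = m - d], the subgradient inequalities from [q] to [u], from [r] to [v]
    and from the midpoint [m] to [q] and [r] add up: the convexity defect bounds
    [p (A q d - A r d)]. [op_strict] turns this monotonicity gap into the energy of [q - r], which
    is half of [u - v]; hence the factor [2^p]. *)
Lemma op_uniformly_convex (eta : R) : 0 < eta -> exists2 K, 0 <= K & forall u v,
  grad_energy (u - v) <= eta * (A u u + A v v) +
    K * (A u u + A v v - 2 * A (2^-1 *: (u + v)) (2^-1 *: (u + v))).
Proof.
move=> e0; pose eta' := eta / 2 `^ p.
have t0 : 0 < 2 `^ p :> R by exact: powR_gt0.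
have e'0 : 0 < eta' by exact: divr_gt0.
exists (2 `^ p * K3 eta' * (2 / p)).
  by rewrite !mulr_ge0 ?powR_ge0 ?(op_K3 Areg) ?invr_ge0 ?ltW.
move=> u v; pose m := 2^-1 *: (u + v).
pose d := 4^-1 *: (u - v).
pose q := m + d; pose r := m - d.
have [uq vr uvd] : [/\ u - q = d, v - r = - d & u - v = 4 *: d].
  exact: quarter_points.
have qr : q - r = 2 *: d.
  by rewrite /q /r opprB addrC addrA subrK scaler_nat.
have e3 : q - m = d by rewrite /q addrC addKr.
have e4 : r - m = - d by rewrite /r addrC addKr.
rewrite -/m; clearbody m d q r.
have s1 := op_subgradient Areg q u; have s2 := op_subgradient Areg r v.
rewrite uq in s1; rewrite vr (is_linearN _ (lA _)) in s2.
have s3 := op_subgradient Areg m q; have s4 := op_subgradient Areg m r.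
rewrite e3 in s3; rewrite e4 (is_linearN _ (lA _)) in s4.
have mono := op_monotone q r.
have strict := op_strict Areg e'0 q r.
rewrite qr !(is_linearZ _ _ (lA _)) in mono strict.
rewrite uvd grad_energyZ; rewrite grad_energyZ in strict.
have -> : `|4| `^ p = 2 `^ p * `|2| `^ p :> R.
  by rewrite !ger0_norm// -powRM//; congr (_ `^ p); lra.
move: (grad_energy d) (A q d) (A r d) (A m d) (A q q) (A r r) (A u u) (A v v)
  (A m m) s1 s2 s3 s4 mono strict => gd qd rd md qq rr uu vv mm s1 s2 s3 s4 mono strict.
rewrite -mulrA; apply: (le_trans (ler_wpM2l (ltW t0) strict)).
rewrite mulrDr mulrA (mulrC (2 `^ p) eta') divfK ?gt_eqF//.
have M0 : 0 <= p * (qd - rd) by rewrite mulr_ge0 ?(ltW p0)//; lra.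
apply: lerD.
  by rewrite ler_wpM2l ?(ltW e0)//; lra.
rewrite -!mulrA ler_wpM2l ?(ltW t0)// ler_wpM2l ?(op_K3 Areg)//.
have -> : 2 * qd - 2 * rd = 2 * (p^-1 * (p * (qd - rd))).
  by rewrite mulKf ?lt0r_neq0// mulrBr.
rewrite ler_wpM2l// ler_wpM2l ?invr_ge0 ?(ltW p0)//.
lra.
Qed.

(* The perturbed problem A w + kappa sum_i l_i(w) l_i = g, solved by minimising
   A w w / p + kappa / 2 sum_i l_i(w)^2 - g w. *)
Variables (m : nat) (l : 'I_m -> W -> R) (kappa : R).
Context (kappa0 : 0 <= kappa) (ll : forall i, is_linear (l i))
  (bl : forall i, bounded_form (l i)).

Let S w z := \sum_i l i w * l i z.
Let J (g : W -> R) w := A w w / p + kappa / 2 * S w w - g w.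
Let dJ (g : W -> R) w z := A w z + kappa * S w z - g z.

Let S_linear w : is_linear (S w).
Proof.
move=> c u v; rewrite /S mulr_sumr -big_split/=; apply: eq_bigr => i _.
by rewrite ll; ring.
Qed.

Let S_sym w z : S w z = S z w.
Proof. by apply: eq_bigr => i _; rewrite mulrC. Qed.

Let S_ge0 w : 0 <= S w w.
Proof. by apply: sumr_ge0 => i _; rewrite -expr2 sqr_ge0. Qed.

Let dJ_linear g w : is_linear g -> is_linear (dJ g w).
Proof. by move=> lg c u v; rewrite /dJ (lA w) S_linear lg; ring. Qed.

Let J_subgradient g u v : is_linear g -> J g u + dJ g u (v - u) <= J g v.
Proof.
move=> lg; rewrite /J /dJ.
have := op_subgradient Areg u v; have := S_ge0 (v - u).
rewrite (is_linearB _ _ (lA u)) !(is_linearB _ _ (S_linear _)) (is_linearB _ _ lg).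
rewrite S_sym (is_linearB _ _ (S_linear _)) [S (v - u) u]S_sym.
rewrite (is_linearB _ _ (S_linear _)) (S_sym v u).
move: (A u u) (A u v) (A v v) (S u u) (S u v) (S v v) (g u) (g v).
move=> uu uv vv su suv sv gu gv h1 h2.
have h3 : uu / p + (uv - uu) <= vv / p.
  rewrite -(ler_pM2l p0) mulrDr !(mulrC p (_ / _)) !divfK ?lt0r_neq0//.
have h4 : 0 <= kappa * (sv - suv - (suv - su)) by rewrite mulr_ge0.
lra.
Qed.

(** The quadratic part of [J] is convex and the linear part has no defect, so the defect of the
    energy is at most [p] times that of [J]. *)
Let J_convex g u v : is_linear g -> A u u + A v v -
    2 * A (2^-1 *: (u + v)) (2^-1 *: (u + v)) <=
  p * (J g u + J g v - 2 * J g (2^-1 *: (u + v))).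
Proof.
move=> lg; rewrite /J (is_linearZ _ _ lg) (is_linearD _ _ lg).
rewrite (is_linearZ _ _ (S_linear _)) S_sym (is_linearZ _ _ (S_linear _)).
rewrite (is_linearD _ _ (S_linear _)) [S (u + v) u]S_sym [S (u + v) v]S_sym.
rewrite !(is_linearD _ _ (S_linear _)) (S_sym v u).
have := S_ge0 (u - v); rewrite (is_linearB _ _ (S_linear _)) [S (u - v) u]S_sym.
rewrite [S (u - v) v]S_sym !(is_linearB _ _ (S_linear _)) (S_sym v u).
move: (A u u) (A v v) (A (2^-1 *: (u + v)) (2^-1 *: (u + v))) (S u u) (S u v) (S v v) (g u) (g v).
move=> uu vv mm su suv sv gu gv h1.
have -> : p * (uu / p + kappa / 2 * su - gu + (vv / p + kappa / 2 * sv - gv) -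
    2 * (mm / p + kappa / 2 * (2^-1 * (2^-1 * (su + suv + (suv + sv)))) -
         2^-1 * (gu + gv))) =
   uu + vv - 2 * mm + p * (kappa / 4 * (su - suv - (suv - sv))).
  by field; rewrite lt0r_neq0.
by rewrite lerDl !mulr_ge0 ?(ltW p0).
Qed.

Lemma bounded_form_S w : bounded_form (S w).
Proof.
suff H (I : seq 'I_m) : bounded_form (fun z => \sum_(i <- I) l i w * l i z) by exact: H.
elim: I => [|i I [K K0 HK]].
  by exists 0 => // u; rewrite big_nil normr0 mul0r.
have [L L0 HL] := bl i; exists (`|l i w| * L + K).
  by rewrite addr_ge0// mulr_ge0.
move=> u; rewrite big_cons (le_trans (ler_normD _ _))// mulrDl lerD//.
by rewrite normrM -mulrA ler_wpM2l.
Qed.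

Lemma bounded_formD (f g : W -> R) (c : R) : bounded_form f -> bounded_form g ->
  bounded_form (fun z => f z + c * g z).
Proof.
move=> [K K0 HK] [L L0 HL]; exists (K + `|c| * L); first by rewrite addr_ge0// mulr_ge0.
move=> u; rewrite (le_trans (ler_normD _ _))// mulrDl lerD// normrM -mulrA.
by rewrite ler_wpM2l.
Qed.

Lemma perturbed_solution (g : W -> R) : is_linear g -> bounded_form g ->
  exists w, forall z, A w z + kappa * S w z = g z.
Proof.
move=> lg bg; have contra (X Y Z ay aw ks kss gy t : R) : 0 < t ->
    Z + kss + t <= - (aw + ks - gy) / 4 -> 0 < - (aw + ks - gy) -> Y <= Z ->
    X <= - (aw + ks - gy) / 4 -> ay - aw <= X + Y ->
    0 <= ay + (ks + kss) - gy -> False by lra.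
have [K Kge0 HK] := bg.
have a2p : 0 < alpha / (2 * p) by rewrite divr_gt0// mulr_gt0.
have [M M0 HM] := grad_energy_bound_of_norm Kge0 a2p.
have Jge u : alpha / (2 * p) * grad_energy u <= J g u + M.
  have h1 : g u <= alpha / (2 * p) * grad_energy u + M.
    by apply: (le_trans (ler_norm _)); apply: (le_trans (HK u)).
  have h2 : alpha / p * grad_energy u <= A u u / p.
    by rewrite mulrAC ler_wpM2r ?invr_ge0 ?(ltW p0)//; exact: (op_coercive Areg).
  have h3 : 0 <= kappa / 2 * S u u by rewrite !mulr_ge0.
  have e : alpha / p * grad_energy u =
    alpha / (2 * p) * grad_energy u + alpha / (2 * p) * grad_energy u.
    by field; rewrite lt0r_neq0.
  rewrite /J; lra.
have Jinf : has_inf (range (J g)).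
  split; first by exists (J g 0), 0.
  exists (- M) => _ [u _ <-].
  by rewrite lerNl -subr_ge0 opprK addrC (le_trans _ (Jge u))// mulr_ge0 ?(ltW a2p)// grad_energy_ge0.
pose i0 := inf (range (J g)).
have i0_le u : i0 <= J g u by apply: ge_inf; [case: Jinf|exists u].
(* The direct method by uniform convexity: the sublevel sets [J <= inf J + e] shrink in energy as
   [e] decreases, and completeness provides the limit point. *)
have [w Hw] : exists w, forall d e, 0 < d -> 0 < e ->
    exists2 u, J g u <= i0 + e & sobolev0_norm (w - u) <= d.
  apply: (@cauchy_family_limit _ _ n_gt0 _ _ bO _ _ (fun e => [set u | J g u <= i0 + e])).
  - move=> e e0; have [_ [u _ <-] Ju] := inf_adherent e0 Jinf.
    by exists u; exact: ltW.
  - by move=> e e' e0 ee' u /= h; apply: (le_trans h); rewrite lerD2l.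
  - move=> d d0.
    pose B := (i0 + 1 + M) / (alpha / (2 * p)).
    have Bge u e : e <= 1 -> J g u <= i0 + e -> grad_energy u <= B.
      move=> e1 Ju; rewrite ler_pdivlMr// mulrC; apply: (le_trans (Jge u)); lra.
    have B0 : 0 <= B.
      have [_ [u _ <-] Ju] := inf_adherent ltr01 Jinf.
      by apply: le_trans (Bge u 1 _ (ltW Ju)); rewrite ?grad_energy_ge0.
    have b0 := op_beta Areg.
    pose D := 2 * (beta * B) + 1.
    have D0 : 0 < D by rewrite ltr_wpDl// mulr_ge0// mulr_ge0// ltW.
    have eta0 : 0 < d / 2 / D by rewrite !divr_gt0.
    have [L L0 HL] := op_uniformly_convex eta0.
    pose e := Num.min 1 (d / 2 / (L * p * 2 + 1)).
    have q0 : 0 < L * p * 2 + 1 by rewrite ltr_wpDl// !mulr_ge0// ltW.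
    have e0 : 0 < e by rewrite lt_min ltr01 !divr_gt0.
    exists e => // u v /= Ju Jv.
    have e1 : e <= 1 by rewrite ge_min lexx.
    have e2 : e <= d / 2 / (L * p * 2 + 1) by rewrite ge_min lexx orbT.
    apply: (le_trans (HL u v)); rewrite [leRHS](splitr d); apply: lerD.
      have Eu : A u u <= beta * B.
        by apply: (le_trans (op_le Areg u)); rewrite ler_wpM2l ?(ltW b0)//; exact: Bge Ju.
      have Ev : A v v <= beta * B.
        by apply: (le_trans (op_le Areg v)); rewrite ler_wpM2l ?(ltW b0)//; exact: Bge Jv.
      rewrite mulrAC ler_pdivrMr// ler_wpM2l ?divr_ge0 ?(ltW d0)//.
      rewrite /D; lra.
    apply: (le_trans (ler_wpM2l L0 (J_convex _ _ lg))).
    have h := i0_le (2^-1 *: (u + v)).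
    have h2 : J g u + J g v - 2 * J g (2^-1 *: (u + v)) <= 2 * e by lra.
    rewrite mulrA; apply: (le_trans (ler_wpM2l _ h2)); first by rewrite mulr_ge0// ltW.
    rewrite ler_pdivlMr// in e2; apply: le_trans e2.
    by rewrite mulrCA -mulrA (mulrC p 2) mulrCA (mulrC e) !mulrA; rewrite (_ : L * p * 2 = 2 * L * p) ?ler_wpM2r//; lra.
exists w => z.
have bdJ : bounded_form (dJ g w).
  have b1 := bounded_formD kappa (op_bounded w) (bounded_form_S w).
  have := bounded_formD (-1) b1 bg.
  move=> [C C0 HC]; exists C => // u; have := HC u.
  by rewrite /dJ mulN1r.
(* Lower semicontinuity of [J] at [w]: its subgradient there is a bounded form, and points of all
   sublevels lie arbitrarily close to [w]. *)
have wmin u : J g w <= J g u.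
  apply: le_trans (i0_le u); apply/ler_addgt0Pr => e e0.
  have [C C0 HC] := bdJ.
  have C1 : 0 < C + 1 by rewrite ltr_wpDl.
  have e2 : 0 < e / 2 by rewrite divr_gt0.
  have [v Jv wv] := Hw (e / 2 / (C + 1)) (e / 2) (divr_gt0 e2 C1) e2.
  have := J_subgradient w v lg.
  have h := HC (v - w); rewrite sobolev0_normB in h.
  have : C * sobolev0_norm (w - v) <= e / 2.
    rewrite (@le_trans _ _ ((C + 1) * sobolev0_norm (w - v)))//.
      by rewrite ler_wpM2r ?sobolev0_norm_ge0// lerDl.
    by rewrite mulrC -ler_pdivlMr.
  move: h; rewrite ler_norml => /andP[h _]; lra.
(* Minimality gives the sign of the derivative at [w + t y] for [t > 0]; [op_equi] carries it to [w]
   as [t] decreases. Using [y] and [-y] then yields the equation. *)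
have dge0 y : 0 <= dJ g w y.
  have step (t : R) : 0 < t -> 0 <= dJ g (w + t *: y) y.
    move=> t0; have := J_subgradient (w + t *: y) w lg.
    rewrite (_ : w - (w + t *: y) = - (t *: y)); last by rewrite opprD addNKr.
    rewrite (is_linearN _ (dJ_linear _ lg)).
    rewrite (is_linearZ _ _ (dJ_linear _ lg)).
    have := wmin (w + t *: y) => h1 h2.
    have : 0 <= t * dJ g (w + t *: y) y by lra.
    by rewrite pmulr_rge0.
  rewrite leNgt; apply/negP => neg.
  pose e := - dJ g w y.
  have e0 : 0 < e by rewrite oppr_gt0.
  pose Q := 2 `^ p * (grad_energy w + grad_energy y) + grad_energy w + grad_energy y.
  have Q0 : 0 <= Q by rewrite !addr_ge0 ?mulr_ge0 ?addr_ge0 ?powR_ge0 ?grad_energy_ge0.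
  have Q1 : 0 < Q + 1 by rewrite ltr_wpDl.
  pose eta := e / 4 / (Q + 1).
  have eta0 : 0 < eta by rewrite !divr_gt0.
  have k40 := op_K4 Areg eta.
  pose U := K4 eta * grad_energy y + kappa * S y y + 1.
  have U0 : 0 < U by rewrite ltr_wpDl ?addr_ge0 ?mulr_ge0 ?grad_energy_ge0 ?S_ge0.
  pose t := Num.min 1 (e / 4 / U).
  have t0 : 0 < t by rewrite lt_min ltr01 !divr_gt0.
  have t1 : t <= 1 by rewrite ge_min lexx.
  have tU : t * U <= e / 4 by rewrite -ler_pdivlMr// ge_min lexx orbT.
  clearbody t; have := step t t0; rewrite /dJ.
  have := op_equi Areg eta0 (w + t *: y) w y.
  rewrite [w + _ - w]addrC addKr S_sym (is_linearD _ _ (S_linear y)).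
  rewrite (is_linearZ _ _ (S_linear y)) grad_energyZ (S_sym y w).
  have Gle : grad_energy (w + t *: y) <= 2 `^ p * (grad_energy w + grad_energy y).
    apply: (le_trans (grad_energyD _ _)); apply: ler_wpM2l; first exact: powR_ge0.
    rewrite lerD2l grad_energyZ; apply: ler_piMl.
      exact: grad_energy_ge0.
    have := powR_le (ltW p0) (normr_ge0 t); rewrite ger0_norm ?(ltW t0)//.
    by move=> /(_ 1 t1); rewrite powR1.
  have tp : `|t| `^ p <= t.
    by rewrite ger0_norm ?(ltW t0)//; apply: ge1r_powR; rewrite ?t0 ?(ltW p1).
  have gy := grad_energy_ge0 y.
  have h5 : K4 eta * (`|t| `^ p * grad_energy y) <= t * (K4 eta * grad_energy y).
    by rewrite mulrCA ler_wpM2r// mulr_ge0.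
  have h6 : eta * (grad_energy (w + t *: y) + grad_energy w + grad_energy y) <= e / 4.
    apply: (@le_trans _ _ (eta * (Q + 1))); last by rewrite divfK// gt_eqF.
    apply: ler_wpM2l; first exact: ltW.
    by rewrite /Q; apply: ler_wpDr; [exact: ler01|rewrite !lerD2r].
  rewrite ler_norml => /andP[_ h7] h8.
  have h9 : t * (kappa * S y y) = kappa * (t * S y y) by rewrite mulrCA.
  move: tU h8; rewrite /U 2!mulrDr mulr1 h9 (mulrDr kappa) => tU h8.
  exact: (contra _ _ _ _ _ _ _ _ _ t0 tU e0 h5 h6 h7 h8).
have dJ0 : dJ g w z = 0.
  have := dge0 (- z); rewrite (is_linearN _ (dJ_linear _ lg)) oppr_ge0 => h.
  by apply/eqP; rewrite eq_le h dge0.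
by move: dJ0; rewrite /dJ => /eqP; rewrite subr_eq0 => /eqP.
Qed.

(* Any solution operator is stable, and it becomes odd after averaging since
   it is unique up to elements of norm 0. *)
Lemma solution_map (g : W -> W -> R) :
  (forall v, is_linear (g v)) -> (forall v, bounded_form (g v)) ->
  (forall v z, g (- v) z = - g v z) ->
  (forall v d, 0 < d -> exists2 r, 0 < r & forall v' z, sobolev0_norm (v' - v) < r ->
     `|g v' z - g v z| <= d * sobolev0_norm z) ->
  exists T : W -> W, [/\ continuous T, forall v, T (- v) = - T v &
    forall v z, A (T v) z + kappa * S (T v) z = g v z].
Proof.
move=> lg bg og cg.
have /choice[T0 T0P] : forall v, exists w, forall z, A w z + kappa * S w z = g v z.
  by move=> v; exact: perturbed_solution.
have SN u z : S (- u) z = - S u z by rewrite S_sym (is_linearN _ (S_linear z)) S_sym.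
have uniq u v : (forall z, A u z + kappa * S u z = A v z + kappa * S v z) ->
    sobolev0_norm (u - v) = 0.
  move=> uv; apply: grad_energy_eq0_norm.
  apply: (@le0_of_le_mul _ _ (A u u + A v v)) => eta e0.
  apply: (le_trans (op_strict Areg e0 u v)); rewrite gerDl.
  apply: mulr_ge0_le0; first exact: (op_K3 Areg).
  have h := uv (u - v).
  have h3 : S u (u - v) - S v (u - v) = S (u - v) (u - v).
    by rewrite ![S _ (u - v)]S_sym -(is_linearB _ _ (S_linear _)).
  have : 0 <= kappa * S (u - v) (u - v) by rewrite mulr_ge0.
  rewrite -h3; lra.
have bS u : bounded_form (S u) by exact: bounded_form_S.
have T0N v : sobolev0_norm (T0 (- v) + T0 v) = 0.
  rewrite -[T0 v]opprK; apply: uniq => z.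
  by rewrite T0P og (op_odd Areg) SN mulrN -opprD T0P.
pose T v := 2^-1 *: (T0 v - T0 (- v)).
have TT0 v : sobolev0_norm (T v - T0 v) = 0.
  have -> : T v - T0 v = - 2^-1 *: (T0 (- v) + T0 v).
    rewrite /T -{2}(scaler_half (T0 v)) -scalerBr scaleNr -scalerN.
    by congr (_ *: _); rewrite opprD addrACA subrr add0r opprD.
  by rewrite sobolev0_normZ T0N mulr0.
have TP v z : A (T v) z + kappa * S (T v) z = g v z.
  rewrite (op_eq_of_norm0 (TT0 v)).
  have -> : S (T v) z = S (T0 v) z; last exact: T0P.
  apply/eqP; rewrite -subr_eq0 ![S _ z]S_sym -(is_linearB _ _ (S_linear z)).
  by apply/eqP; apply: bounded_form_eq0.
exists T; split => //; last by move=> v; rewrite /T opprK -scalerN opprB.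
have TA v : A (T v) (T v) <= g v (T v).
  by rewrite -TP lerDl mulr_ge0.
have kS u v : 0 <= kappa * (S u (u - v) - S v (u - v)).
  rewrite ![S _ (u - v)]S_sym -(is_linearB _ _ (S_linear _)).
  by rewrite mulr_ge0.
move=> v U /nbhs_ballP[d /= d0 dU].
have d20 : 0 < d / 2 by rewrite divr_gt0.
have [e e0 He] := grad_energy_norm_small d20.
have [K Kge0 HK] := bg v.
have [r r0 Hr] := @solution_stability alpha beta K3 K4 K e a0 (op_K3 Areg) Kge0 e0.
have [s s0 Hs] := cg v r r0.
apply/nbhs_ballP; exists s => //= v'; rewrite sobolev0_ballE/= => vv'.
apply: dU; rewrite sobolev0_ballE/=.
rewrite sobolev0_normB (@le_lt_trans _ _ (d / 2))//; last first.
  by rewrite ltr_pdivrMr// ltr_pMr// ltr1n.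
apply: He; apply: (Hr A (g v) (g v')) => //.
- by move=> z; apply: Hs; rewrite sobolev0_normB.
- by have := kS (T v') (T v); rewrite -!TP; lra.
Qed.

End operator.
End regular_operators.

(** * The operator of a structured function *)

Section pointwise_structure.
Context (R : realType) (n : nat) (p : R) (p1 : 1 < p).
Context (alpha beta c : R) (a0 : 0 < alpha) (b0 : 0 < beta) (c0 : 0 < c).
Local Notation E := 'rV[R]_n.
Local Notation p' := (p / (p - 1)).
Let p0 : 0 < p. Proof. exact: lt_trans p1. Qed.
Let q0 : 0 < p - 1. Proof. by rewrite subr_gt0. Qed.

(** The structure conditions at one fixed [x]. They hold simultaneously off one null set, so every
    pointwise consequence can be derived for a single map [b]. *)
Record structured (b : E -> E) : Prop := {
  st_continuous : forall i, continuous (fun xi => b xi 0 i : R) ;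
  st_monotone : forall xi1 xi2, 0 <= dotr (b xi1 - b xi2) (xi1 - xi2) ;
  st_coercive : forall xi, alpha * enorm xi `^ p <= dotr (b xi) xi ;
  st_bounded : forall xi, enorm (b xi) <= beta * enorm xi `^ (p - 1) ;
  st_homogeneous : forall xi t, 0 < t -> b (t *: xi) = t `^ (p - 1) *: b xi ;
  st_odd : forall xi, b (- xi) = - b xi ;
  st_equicontinuous : forall xi1 xi2,
    enorm (b xi1 - b xi2) <=
      c * (dotr (b xi1) xi1 + dotr (b xi2) xi2) `^
        ((p - 1 - Num.min (p / 2) (p - 1)) / p) *
      dotr (b xi1 - b xi2) (xi1 - xi2) `^ (Num.min (p / 2) (p - 1) / p) ;
  st_cyclic : forall (k : nat) (xi : nat -> E),
    (0 < k)%N -> xi k = xi 0%N ->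
    \sum_(i < k) dotr (b (xi i)) (xi i.+1 - xi i) <= 0 ;
  st_strict : forall xi1 xi2,
    alpha * enorm (xi1 - xi2) `^ Num.max 2 p *
      (dotr (b xi1) xi1 + dotr (b xi2) xi2) `^ (1 - Num.max 2 p / p) <=
      dotr (b xi1 - b xi2) (xi1 - xi2) }.

Context (b : E -> E) (bs : structured b).

Lemma st0 : b 0 = 0.
Proof.
have := st_bounded bs 0; rewrite enorm0 powR0 ?gt_eqF// mulr0 => h.
by apply: enorm_eq0; apply/eqP; rewrite eq_le h enorm_ge0.
Qed.

Lemma st_ge0 xi : 0 <= dotr (b xi) xi.
Proof.
by apply: le_trans (st_coercive bs xi); rewrite mulr_ge0 ?powR_ge0 ?(ltW a0).
Qed.

Lemma st_gt0 xi : xi != 0 -> 0 < dotr (b xi) xi.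
Proof.
move=> xi0; apply: lt_le_trans (st_coercive bs xi); rewrite mulr_gt0// powR_gt0//.
rewrite lt_neqAle enorm_ge0 andbT eq_sym.
by apply: contra xi0 => /eqP/enorm_eq0 ->.
Qed.

Lemma st_strict_gt0 xi1 xi2 : xi1 != xi2 -> 0 < dotr (b xi1 - b xi2) (xi1 - xi2).
Proof.
move=> x12; apply: lt_le_trans (st_strict bs xi1 xi2).
have d0 : 0 < enorm (xi1 - xi2).
  rewrite lt_neqAle enorm_ge0 andbT eq_sym.
  by apply: contra x12 => /eqP/enorm_eq0/eqP; rewrite subr_eq0.
rewrite !mulr_gt0 ?powR_gt0//.
have [z|z] := eqVneq xi1 0; last by rewrite ltr_pwDl ?st_gt0 ?st_ge0.
by rewrite ltr_wpDl ?st_ge0 ?st_gt0// eq_sym -z.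
Qed.

Lemma st_le xi : dotr (b xi) xi <= beta * enorm xi `^ p.
Proof.
apply: (le_trans (dotr_le _ _)).
apply: (le_trans (ler_wpM2r (enorm_ge0 _) (st_bounded bs xi))).
by rewrite -mulrA [_ * enorm xi]mulrC mulr_powRB1// enorm_ge0.
Qed.

Lemma st_flux xi : enorm (b xi) `^ p' <= beta `^ p' * enorm xi `^ p.
Proof.
apply: (le_trans (powR_le _ (enorm_ge0 _) (st_bounded bs xi))).
  by rewrite divr_ge0// ltW.
by rewrite powRM ?powR_ge0 ?(ltW b0)// -powRrM mulrCA mulfV ?mulr1 ?gt_eqF.
Qed.

Lemma st_dotr_le xi eta :
  `|dotr (b xi) eta| <= beta `^ p' * enorm xi `^ p + enorm eta `^ p.
Proof.
apply: (le_trans (cauchy_schwarz _ _)).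
apply: (le_trans (mul_le_powRD p1 (enorm_ge0 _) (enorm_ge0 _))).
by rewrite lerD2r st_flux.
Qed.

Lemma st_subgradient xi eta :
  p * dotr (b xi) (eta - xi) <= dotr (b eta) eta - dotr (b xi) xi.
Proof.
exact: (potential_subgradient p1 (st_homogeneous bs) st0 (st_cyclic bs) st_strict_gt0).
Qed.

Lemma st_scale xi t : dotr (b (t *: xi)) (t *: xi) = `|t| `^ p * dotr (b xi) xi.
Proof. exact: (potential_homogeneous p1 (st_homogeneous bs) (st_odd bs) st0). Qed.

Lemma st_differentiable xi :
  differentiable ((fun xi => dotr (b xi) xi) : E -> R) xi /\
  forall i, partial i ((fun xi => dotr (b xi) xi) : E -> R) xi = p * b xi 0 i.
Proof.
exact: (potential_differentiable p1 (st_continuous bs) (st_homogeneous bs) st0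
  (st_cyclic bs) st_strict_gt0).
Qed.

Lemma st_strictly_convex xi1 xi2 t : xi1 != xi2 -> 0 < t < 1 ->
  dotr (b (t *: xi1 + (1 - t) *: xi2)) (t *: xi1 + (1 - t) *: xi2) <
    t * dotr (b xi1) xi1 + (1 - t) * dotr (b xi2) xi2.
Proof.
exact: (potential_strictly_convex p1 (st_homogeneous bs) st0 (st_cyclic bs) st_strict_gt0).
Qed.

End pointwise_structure.

(** [K] is chosen before [b], hence is the same for every [a_e] and a.e. [x]. The constant
    [2^p / alpha] passed to [strict_monotone_absorb] comes from
    [|xi1 - xi2|^p <= 2^p (|xi1|^p + |xi2|^p)] and coercivity. *)
Lemma strict_constant (R : realType) (n : nat) (p : R) (p1 : 1 < p) (alpha beta c eta : R) :
  0 < alpha -> 0 < eta -> exists2 K, 0 <= K &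
  forall (b : 'rV[R]_n -> 'rV[R]_n), structured p alpha beta c b -> forall xi1 xi2,
  enorm (xi1 - xi2) `^ p <= eta * (dotr (b xi1) xi1 + dotr (b xi2) xi2) +
    K * dotr (b xi1 - b xi2) (xi1 - xi2).
Proof.
move=> a0 e0; have p0 : 0 < p by exact: lt_trans p1.
have [K K0 HK] := @strict_monotone_absorb R p p1 alpha eta (2 `^ p / alpha) a0 e0.
exists K => // b bs xi1 xi2; apply: HK.
- exact: enorm_ge0.
- by rewrite addr_ge0// (st_ge0 a0 bs).
- exact: (st_monotone bs).
- apply: (@le_trans _ _ ((enorm xi1 + enorm xi2) `^ p)).
    by rewrite powR_le ?(ltW p0) ?enorm_ge0// enormB_le.
  apply: (le_trans (powRD_le p0 (enorm_ge0 _) (enorm_ge0 _))).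
  rewrite -mulrA ler_wpM2l ?powR_ge0// ler_pdivlMl// mulrDr.
  by rewrite lerD// (st_coercive bs).
- exact: (st_strict bs).
Qed.

(** Cauchy-Schwarz and Young isolate the power [p'] of the increment of [b] with a factor [L].
    [equicontinuous_absorb] is then used with [eta / (L * beta + 1)], since [P] is at most [beta]
    times the sum of the powers. *)
Lemma equi_constant (R : realType) (n : nat) (p : R) (p1 : 1 < p) (alpha beta c eta : R) :
  0 < alpha -> 0 < beta -> 0 < c -> 0 < eta -> exists2 K, 0 <= K &
  forall (b : 'rV[R]_n -> 'rV[R]_n), structured p alpha beta c b -> forall xi1 xi2 zeta,
  `|dotr (b xi1 - b xi2) zeta| <=
    eta * (enorm xi1 `^ p + enorm xi2 `^ p + enorm zeta `^ p) +
    K * enorm (xi1 - xi2) `^ p.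
Proof.
move=> a0 b0 c0 e0; have p0 : 0 < p by exact: lt_trans p1.
have [L L0 HL] := mul_le_powRDr p1 e0.
have L1 : 0 < L * beta + 1 by rewrite ltr_wpDl// mulr_ge0// ltW.
have e'0 : 0 < eta / (L * beta + 1) by rewrite divr_gt0.
have [K K0 HK] := equicontinuous_absorb p1 c0 e'0.
exists (L * K); first by rewrite mulr_ge0.
move=> b bs xi1 xi2 zeta; apply: (le_trans (cauchy_schwarz _ _)).
apply: (le_trans (HL _ _ (enorm_ge0 _) (enorm_ge0 _))).
pose P := dotr (b xi1) xi1 + dotr (b xi2) xi2.
have Pge0 : 0 <= P by rewrite addr_ge0// (st_ge0 a0 bs).
have h := HK (enorm (xi1 - xi2)) P (dotr (b xi1 - b xi2) (xi1 - xi2))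
  (enorm (b xi1 - b xi2)) (enorm_ge0 _) Pge0 (enorm_ge0 _) (st_monotone bs _ _)
  (dotr_le _ _) (st_equicontinuous bs _ _).
have PG : P <= beta * (enorm xi1 `^ p + enorm xi2 `^ p).
  by rewrite mulrDr lerD// (st_le p1 bs).
have S0 : 0 <= enorm xi1 `^ p + enorm xi2 `^ p by rewrite addr_ge0 ?powR_ge0.
have E : eta / (L * beta + 1) * (L * beta + 1) = eta by rewrite divfK// gt_eqF.
move: h PG S0 E e'0 Pge0; clear HK HL bs; clearbody P.
move: (enorm xi1 `^ p + enorm xi2 `^ p) (enorm (b xi1 - b xi2) `^ (p / (p - 1)))
  (enorm zeta `^ p) (enorm (xi1 - xi2) `^ p) (eta / (L * beta + 1)).
move=> S B z x e' h PG S0 E e'0 Pge0.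
have h1 := ler_wpM2l L0 h.
have h2 := ler_wpM2l (mulr_ge0 L0 (ltW e'0)) PG.
have h3 : 0 <= e' * S by rewrite mulr_ge0// ltW.
have h4 : eta * S = L * e' * (beta * S) + e' * S by rewrite -E; ring.
rewrite !mulrDr in h1 *; rewrite -mulrA in h2.
lra.
Qed.

(** * Measurability of superposition by a Caratheodory function *)

Section caratheodory_composition.
Context (R : realType) (n : nat) (O : set 'rV[R]_n) (oO : open O).
Local Notation mu := (lebesgue_on oO).
Local Notation E := 'rV[R]_n.

(** [G x] is rounded down coordinatewise to the lattice of step [1/(k+1)]; the integer vector
    [cell G k x] records the lattice point and [node] places it in space. *)
Let node (k : nat) (z : {ffun 'I_n -> int}) : E := \row_i ((z i)%:~R / k.+1%:R).
Let cell (G : E -> E) (k : nat) (x : E) : {ffun 'I_n -> int} :=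
  [ffun i => Num.floor (k.+1%:R * G x 0 i)].

Let measurable_cell (G : E -> E) k z : measurable_fun setT G ->
  measurable [set x | cell G k x = z].
Proof.
move=> mG.
have -> : [set x | cell G k x = z] = \big[setI/setT]_(i < n)
    ((fun x => k.+1%:R * G x 0 i) @^-1` `[(z i)%:~R, (z i + 1)%:~R[%classic).
  rewrite -bigcap_seq; apply/seteqP; split => [x /= <- i _|x xz] /=.
    by rewrite in_itv/= ffunE floor_itv.
  apply/ffunP => i; rewrite ffunE; apply/eqP; rewrite floor_eq.
  by have := xz i; rewrite /= in_itv/=; apply; rewrite mem_index_enum.
apply: bigsetI_measurable => i _; rewrite -[X in measurable X]setTI.
have mf : measurable_fun setT (fun x => k.+1%:R * G x 0 i).
  apply: measurable_funM; first exact: measurable_cst.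
  exact: (measurableT_comp (@measurable_coor R n i) mG).
exact: (mf measurableT _ (measurable_itv _)).
Qed.

Let cvg_node (G : E -> E) x : (fun k => node k (cell G k x)) @ \oo --> G x.
Proof.
apply/cvg_ballP => e e0.
have : (fun j => j.+1%:R^-1 : R) @ \oo --> 0 by exact: cvg_harmonic.
move=> /cvgrPdist_lt => /(_ e e0); apply: filterS => k.
rewrite sub0r normrN ger0_norm ?invr_ge0// => ke.
rewrite /ball/=; split => // i j; rewrite ord1 mxE ffunE.
apply: le_lt_trans ke; have k0 : 0 < k.+1%:R :> R by rewrite ltr0n.
have /andP[h1 h2] := floor_itv (k.+1%:R * G x 0 j).
rewrite intrD in h2.
rewrite -(@ler_pM2l _ k.+1%:R)// -[X in X * `|_|]ger0_norm// -normrM mulrBr.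
rewrite [k.+1%:R * (_ / _)]mulrCA divff ?gt_eqF// mulr1 ger0_norm; lra.
Qed.

(** The rounded maps take countably many values, so a single null set is enough to replace [F] at
    all nodes by Borel functions; continuity of [F x] gives the limit. *)
Lemma caratheodory_comp (F : E -> E -> R) (G : E -> E) :
  caratheodory oO F -> measurable_fun setT G -> ae_mfun mu (fun x => F x (G x)).
Proof.
move=> [cF mF] mG.
have /choice[g gP] : forall q : nat * {ffun 'I_n -> int}, exists g : E -> R,
    measurable_fun setT g /\ {ae mu, forall x, F x (node q.1 q.2) = g x}.
  by move=> q; have [g mg Fg] := mF (node q.1 q.2); exists g.
have aeq : {ae mu, forall x, forall q, F x (node q.1 q.2) = g q x}.
  have : {ae mu, forall x, forall j : nat,
      if unpickle j is Some q then F x (node q.1 q.2) = g q x else True}.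
    apply/ae_foralln => j; case: unpickle => [q|]; last exact: aeW.
    exact: (gP q).2.
  by apply: filterS => x h q; have := h (pickle q); rewrite pickleK.
pose h k x := g (k, cell G k x) x.
have mh k : measurable_fun setT (h k).
  move=> _ Y mY; rewrite setTI.
  have -> : h k @^-1` Y = \bigcup_z ([set x | cell G k x = z] `&` g (k, z) @^-1` Y).
    by apply/seteqP; split => [x /= hx|x [z _ /= [<-]]//]; exists (cell G k x).
  apply: countable_bigcupT_measurable => // z; apply: measurableI.
    exact: measurable_cell.
  by rewrite -[X in measurable X]setTI; apply: (gP (k, z)).1.
(* The upper limit is Borel and defined everywhere; it equals the limit at almost every point. *)
exists (fun x => fine (limn_esup (fun k => (h k x)%:E))).
  apply: (measurableT_comp (fine_measurable measurableT)).
  by apply: measurable_fun_limn_esup => k; exact/measurable_EFinP.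
apply: filterS2 cF aeq => x cFx Fx.
have : (fun k => (h k x)%:E) @ \oo --> (F x (G x))%:E.
  apply: cvg_EFin; first exact: nearW.
  have -> : fine \o (fun k => (h k x)%:E) = (fun k => F x (node k (cell G k x))).
    by apply/funext => k /=; rewrite /h -Fx.
  by apply: continuous_cvg; [exact: cFx|exact: cvg_node].
by move=> /cvg_limn_einf_sup[_ ->].
Qed.

End caratheodory_composition.

(** * Integration of the pointwise estimates *)

Section structure_operator.
Context (R : realType) (n : nat) (O : set 'rV[R]_n)
  (oO : open O) (p : R) (p1 : 1 < p).
Local Notation mu := (lebesgue_on oO).
Local Notation W := (sobolev0 oO p1).
Local Notation E := 'rV[R]_n.
Local Notation p' := (p / (p - 1)).
Implicit Types u v w z : W.
Let p0 : 0 < p. Proof. exact: lt_trans p1. Qed.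
Let q0 : 0 < p - 1. Proof. by rewrite subr_gt0. Qed.

Definition form_of (a : E -> E -> E) (u v : W) : R :=
  (\int[mu]_x dotr (flux a u x) (grad v x))%R.

Section one_operator.
Context (a : E -> E -> E) (alpha beta c : R).
Context (sa : structure_conditions oO p a alpha beta c).

Let a0 : 0 < alpha. Proof. by have [] := sc_pos sa. Qed.
Let b0 : 0 < beta. Proof. by have [] := sc_pos sa. Qed.
Let c0 : 0 < c. Proof. by have [] := sc_pos sa. Qed.

Lemma ae_structured : {ae mu, forall x, structured p alpha beta c (a x)}.
Proof.
have cont : {ae mu, forall x, forall i, continuous (fun xi => a x xi 0 i : R)}.
  apply: filter_forall => i; have [h _] := sc_caratheodory sa i.
  exact: h.
have := sc_monotone sa; have := sc_coercive sa; have := sc_bounded sa.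
have := sc_homogeneous sa; have := sc_odd sa; have := sc_equicontinuous sa.
have := sc_cyclically_monotone sa; have := sc_strictly_monotone sa.
move=> h1 h2 h3 h4 h5 h6 h7 h8.
near=> x; split; near: x => //.
Unshelve. all: by end_near.
Qed.

Lemma flux_mfun u i : ae_mfun mu (fun x => flux a u x 0 i).
Proof.
exact: (caratheodory_comp (sc_caratheodory sa i) (measurable_grad u)).
Qed.

Lemma ae_mfun_dotr (F G : E -> E) : (forall i, ae_mfun mu (fun x => F x 0 i)) ->
  (forall i, ae_mfun mu (fun x => G x 0 i)) -> ae_mfun mu (fun x => dotr (F x) (G x)).
Proof. by move=> mF mG; apply: ae_mfun_sum => i; exact: ae_mfunM. Qed.

Lemma grad_mfun u i : ae_mfun mu (fun x => grad u x 0 i).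
Proof.
apply: measurable_ae_mfun.
exact: (measurableT_comp (@measurable_coor R n i) (measurable_grad u)).
Qed.

Lemma form_integrable u v : ae_integrable mu (fun x => dotr (flux a u x) (grad v x)).
Proof.
apply: (@ae_integrable_dom _ _ _ _ _
  (fun x => beta `^ p' * enorm (grad u x) `^ p + enorm (grad v x) `^ p)).
- by apply: ae_mfun_dotr; [exact: flux_mfun|exact: grad_mfun].
- by apply: ae_integrableD; [apply: ae_integrableZ|]; exact: grad_integrable.
- by apply: filterS ae_structured => x sx; exact: (st_dotr_le p1 b0 sx).
Qed.

Lemma flux_vLspace u : vLspace oO p' (flux a u).
Proof.
move=> i; split; first exact: flux_mfun.
have p'0 : 0 < p' by rewrite divr_gt0.
apply: (integrable_finite_norm p'0).
apply: (@ae_integrable_le _ _ _ _ _ (fun x => beta `^ p' * enorm (grad u x) `^ p)).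
- by apply: ae_mfun_powR; apply: ae_mfun_norm; exact: flux_mfun.
- by apply: ae_integrableZ; exact: grad_integrable.
- apply: filterS ae_structured => x sx; rewrite powR_ge0/=.
  apply: le_trans (st_flux p1 b0 sx (grad u x)).
  by rewrite powR_le ?(ltW p'0)// coord_le_enorm.
Qed.

Lemma form_linear u : is_linear (form_of a u).
Proof.
move=> t v w; rewrite /form_of -RintZ; last exact: form_integrable.
rewrite -RintD; last 2 first.
- by apply: ae_integrableZ; exact: form_integrable.
- exact: form_integrable.
by apply: eq_Rintegral => x _; rewrite grad_linear dotrDr dotrZr.
Qed.

(** [a(x, xi).xi] is a potential, so the one selected by [potential] has all the properties; Euler's
    identity then forces the selected one to be [a(x, xi).xi]. *)
Lemma potential_structured :
  {ae mu, forall x, forall xi, potential oO p a x xi = dotr (a x xi) xi}.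
Proof.
have ex : is_potential oO p a (fun x xi => dotr (a x xi) xi).
  split.
  - split.
      apply: filterS ae_structured => x sx xi.
      have [d _] := st_differentiable p1 a0 sx xi.
      exact: differentiable_continuous.
    move=> xi; apply: ae_mfun_dotr => i; last exact: ae_mfun_cst.
    by have [_ h] := sc_caratheodory sa i; exact: h.
  - by apply: filterS ae_structured => x sx xi; rewrite (st_odd sx) dotrNl dotrNr opprK.
  - by apply: filterS ae_structured => x sx xi t; exact: (st_scale p1 sx).
  - by apply: filterS ae_structured => x sx xi1 xi2 t; exact: (st_strictly_convex p1 a0 sx).
  - by apply: filterS ae_structured => x sx xi; exact: (st_differentiable p1 a0 sx).
  - by apply: filterS ae_structured => x sx; rewrite dotr0r.
have [_ _ ph _ pg _] := @getPex _ [set Phi | is_potential oO p a Phi] (ex_intro _ _ ex).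
apply: filterS2 ph pg => x ph pg xi; have [d g] := pg xi.
exact: (potential_unique p1 ph d g).
Qed.

Lemma energy_potential u : energy (potential oO p a) u = form_of a u u.
Proof.
by apply: ae_Rintegral_eq; apply: filterS potential_structured => x ->.
Qed.

End one_operator.

(** The constants become functions of [eta] before [a] is given, so one pair [K3], [K4] serves the
    whole family. For [eta <= 0] they take the default value 0, which keeps them nonnegative
    everywhere. *)
Lemma structure_operator (alpha beta c : R) : 0 < alpha -> 0 < beta -> 0 < c ->
  exists (K3 K4 : R -> R), forall a, structure_conditions oO p a alpha beta c ->
    regular_operator (form_of a) alpha beta K3 K4.
Proof.
move=> a0 b0 c0.
have /choice[K3 H3] : forall eta : R, exists K, 0 <= K /\ (0 < eta ->
    forall b, structured p alpha beta c b -> forall xi1 xi2 : E,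
    enorm (xi1 - xi2) `^ p <= eta * (dotr (b xi1) xi1 + dotr (b xi2) xi2) +
    K * dotr (b xi1 - b xi2) (xi1 - xi2)).
  move=> eta; have [e0|e0] := ltP 0 eta; last by exists 0; split.
  by have [K K0 HK] := @strict_constant R n p p1 alpha beta c eta a0 e0; exists K.
have /choice[K4 H4] : forall eta : R, exists K, 0 <= K /\ (0 < eta ->
    forall b, structured p alpha beta c b -> forall xi1 xi2 zeta : E,
    `|dotr (b xi1 - b xi2) zeta| <=
    eta * (enorm xi1 `^ p + enorm xi2 `^ p + enorm zeta `^ p) +
    K * enorm (xi1 - xi2) `^ p).
  move=> eta; have [e0|e0] := ltP 0 eta; last by exists 0; split.
  by have [K K0 HK] := @equi_constant R n p p1 alpha beta c eta a0 b0 c0 e0; exists K.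
exists K3, K4 => a sa.
have ig u : ae_integrable mu (fun x => enorm (grad u x) `^ p) by exact: grad_integrable.
have fi u v := form_integrable sa u v.
have st := ae_structured sa.
split => //.
- by move=> eta; exact: (H3 eta).1.
- by move=> eta; exact: (H4 eta).1.
- exact: (form_linear sa).
- move=> u; rewrite -RintZ//; apply: Rint_le => //; first exact: ae_integrableZ.
  by apply: filterS st => x sx; exact: (st_coercive sx).
- move=> u; rewrite -RintZ//; apply: Rint_le => //; first exact: ae_integrableZ.
  by apply: filterS st => x sx; exact: (st_le p1 sx).
- move=> t u; rewrite /form_of -RintZ//; apply: ae_Rintegral_eq.
  by apply: filterS st => x sx; rewrite /flux gradZ (st_scale p1 sx).
- move=> u z; rewrite /form_of -RintN//; apply: ae_Rintegral_eq.
  by apply: filterS st => x sx; rewrite /flux gradN (st_odd sx) dotrNl.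
- move=> u v; rewrite /form_of -RintZ// -RintD//; last exact: ae_integrableZ.
  apply: Rint_le => //; first by apply: ae_integrableD => //; exact: ae_integrableZ.
  apply: filterS st => x sx; rewrite gradB -lerBrDl.
  exact: (st_subgradient p1 a0 sx).
- move=> eta e0 u v; rewrite /form_of -RintD// -RintB// -!RintZ//; last 2 first.
  + exact: ae_integrableD.
  + exact: ae_integrableB.
  rewrite -RintD; last 2 first.
  + by apply: ae_integrableZ; exact: ae_integrableD.
  + by apply: ae_integrableZ; exact: ae_integrableB.
  apply: Rint_le => //.
    apply: ae_integrableD; apply: ae_integrableZ.
      exact: ae_integrableD.
    exact: ae_integrableB.
  apply: filterS st => x sx; rewrite gradB -dotrNl -dotrDl.
  by rewrite -gradB; have := (H3 eta).2 e0 _ sx (grad u x) (grad v x); rewrite -!gradB.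
- move=> eta e0 u v w; rewrite /form_of -RintB//.
  have i3 : ae_integrable mu (fun x => enorm (grad u x) `^ p + enorm (grad v x) `^ p).
    exact: ae_integrableD.
  have i4 := ae_integrableD i3 (ig w).
  have i5 := ae_integrableD (ae_integrableZ eta i4) (ae_integrableZ (K4 eta) (ig (u - v))).
  have -> : eta * (grad_energy u + grad_energy v + grad_energy w) +
      K4 eta * grad_energy (u - v) = (\int[mu]_x (eta * (enorm (grad u x) `^ p +
        enorm (grad v x) `^ p + enorm (grad w x) `^ p) +
        K4 eta * enorm (grad (u - v) x) `^ p))%R.
    rewrite RintD; last 2 first.
    + by apply: ae_integrableZ; exact: ae_integrableD.
    + exact: ae_integrableZ.
    by rewrite (RintZ eta i4) (RintZ (K4 eta) (ig (u - v))) (RintD i3 (ig w)) (RintD (ig u) (ig v)).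
  apply: Rint_norm_le.
  + by apply: ae_integrable_mfun; exact: ae_integrableB.
  + exact: i5.
  apply: filterS st => x sx; rewrite -dotrNl -dotrDl gradB.
  exact: ((H4 eta).2 e0 _ sx).
Qed.

End structure_operator.

(** * Convergence of the weighted masses *)

Lemma not_near0_right (R : realType) (P : R -> Prop) :
  ~ (\forall e \near 0^'+, P e) -> forall d, 0 < d -> exists e, [/\ 0 < e, e < d & ~ P e].
Proof.
move=> nP d d0; apply: contrapT => h; apply: nP.
apply: filterS2 (nbhs_right_gt 0) (nbhs_right_lt d0) => e e0 ed.
by apply: contrapT => nPe; apply: h; exists e.
Qed.

(** Compactness in its near-covering form, with parameter [e] tending to 0 from the right. *)
Lemma compact_local_uniform (R : realType) (X : pseudoMetricType R) (K : set X)
    (P : R -> X -> Prop) : compact K ->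
  (forall x, K x -> exists2 d, 0 < d &
    \forall e \near (0 : R)^'+, forall y, ball x d y -> P e y) ->
  \forall e \near (0 : R)^'+, forall x, K x -> P e x.
Proof.
move=> /compact_near_coveringP cK KP.
have := cK R (0 : R)^'+ P; apply => x Kx.
have [d d0 Hd] := KP x Kx.
near_simpl; exists (ball x d, [set e | forall y, ball x d y -> P e y]) => /=.
  by split => //; exact: nbhsx_ballx.
by move=> [y e] /= [xy h]; exact: h.
Qed.

(** * Uniform boundedness of weakly* convergent weights *)

Section weak_star_bound.
Context d (T : measurableType d) (R : realType)
  (mu : {measure set T -> \bar R}) (mu_fin : (mu setT < +oo)%E).
Implicit Types rho f : T -> R.

(** [S] is the essential supremum up to the factor [3/4]: among the numbers [L (3/4)^j], the last
    one before the first that fails to bound [rho]. *)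
Lemma ess_bound_scale rho (L M : R) : 0 < M -> {ae mu, forall x, `|rho x| <= L} ->
  ~ {ae mu, forall x, `|rho x| <= M} -> exists S, [/\ M < S,
    {ae mu, forall x, `|rho x| <= S} & ~ {ae mu, forall x, `|rho x| <= 3 / 4 * S}].
Proof.
move=> M0 aeL naeM.
have mono (a b : R) : a <= b -> {ae mu, forall x, `|rho x| <= a} ->
    {ae mu, forall x, `|rho x| <= b}.
  by move=> ab; apply: filterS => x /le_trans; apply.
pose P j := ~ {ae mu, forall x, `|rho x| <= L * (3 / 4) ^+ j}.
have exP : exists j, `[< P j >].
  have : geometric L (3 / 4 : R) @ \oo --> (0 : R).
    by apply: cvg_geometric; rewrite ger0_norm//; lra.
  move=> /cvgrPdist_lt => /(_ M M0) [j _ /(_ j (leqnn j))].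
  rewrite sub0r normrN => h; exists j; apply/asboolP => aej; apply: naeM.
  by apply: mono aej; rewrite ltW// (le_lt_trans (ler_norm _)).
have [[|j] /asboolP Pj jmin] := ex_minnP exP.
  by exfalso; apply: Pj; rewrite expr0 mulr1.
have aej : {ae mu, forall x, `|rho x| <= L * (3 / 4) ^+ j}.
  apply: contrapT => nae; have := jmin j; rewrite ltnn => /(_ _)/negP; apply => //.
  exact/asboolP.
exists (L * (3 / 4) ^+ j); split => //.
  by rewrite ltNge; apply/negP => /mono/(_ aej).
by rewrite mulrCA -exprS.
Qed.

Lemma norming_positive rho (L t : R) (A : set T) : 0 < t ->
  {ae mu, forall x, `|rho x| <= L} -> ae_mfun mu rho -> measurable A ->
  (0 < mu A)%E -> {ae mu, forall x, A x -> t <= rho x} ->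
  exists h : T -> R, [/\ measurable_fun setT h, ae_integrable mu h,
    (\int[mu]_x `|h x|)%R = 1 & t <= (\int[mu]_x (rho x * h x))%R].
Proof.
move=> t0 rL mr mA mu0 At.
have mAfin : mu A \is a fin_num.
  rewrite ge0_fin_numE//; apply: le_lt_trans mu_fin.
  by apply: le_measure; rewrite ?inE.
have c0 : 0 < fine (mu A) by rewrite fine_gt0// mu0 -ge0_fin_numE.
have i1 : ae_integrable mu (\1_A : T -> R).
  apply: integrable_ae_integrable.
  apply: (measurable_bounded_integrable measurableT mu_fin).
    exact: measurable_indic.
  exists 1; split; first exact: num_real.
  move=> M M1 x _ /=; rewrite indicE.
  by case: (_ \in _); rewrite ?normr1 ?normr0 ltW// (lt_trans ltr01 M1).
pose h x := (fine (mu A))^-1 * \1_A x.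
have ih : ae_integrable mu h by exact: ae_integrableZ.
have h0 x : 0 <= h x by rewrite mulr_ge0 ?invr_ge0 ?(ltW c0)// indicE ler0n.
have h1 : (\int[mu]_x `|h x|)%R = 1.
  under eq_Rintegral do rewrite ger0_norm//.
  rewrite RintZ// -[X in _ * X]/(fine _) integral_indic// setIT mulVf// gt_eqF//.
have irh : ae_integrable mu (fun x => rho x * h x).
  apply: (@ae_integrable_dom _ _ _ _ _ (fun x => L * h x)).
  - by apply: ae_mfunM => //; exact: ae_integrable_mfun.
  - exact: ae_integrableZ.
  - by apply: filterS rL => x rx; rewrite normrM (ger0_norm (h0 x)) ler_wpM2r.
exists h; split => //.
  by apply: measurable_funM; [exact: measurable_cst|exact: measurable_indic].
rewrite -[t]mulr1 -h1 -RintZ; last exact: ae_integrable_norm.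
apply: Rint_le => //; first exact/ae_integrableZ/ae_integrable_norm.
apply: filterS At => x Ax; rewrite (ger0_norm (h0 x)).
have [xA|xA] := boolP (x \in A); first by rewrite ler_wpM2r// Ax//; exact: set_mem.
by rewrite /h indicE (negbTE xA) mulr0n !mulr0.
Qed.

(** Either [rho > t] or [-rho > t] on a set of positive measure; [h] is its normalised indicator,
    with the corresponding sign. *)
Lemma norming_function rho (L t : R) : 0 < t ->
  {ae mu, forall x, `|rho x| <= L} -> ae_mfun mu rho ->
  ~ {ae mu, forall x, `|rho x| <= t} ->
  exists h : T -> R, [/\ measurable_fun setT h, ae_integrable mu h,
    (\int[mu]_x `|h x|)%R = 1 & t <= (\int[mu]_x (rho x * h x))%R].
Proof.
move=> t0 rL mr nae; have [g mg rg] := mr.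
have mA (b : T -> R) : measurable_fun setT b -> measurable [set x | t < b x].
  move=> mb; rewrite (_ : [set _ | _] = setT `&` b @^-1` `]t, +oo[%classic).
    exact: mb.
  by rewrite setTI; apply/seteqP; split => x /=; rewrite in_itv/= andbT.
have [h1|h1] := eqVneq (mu [set x | t < g x]) 0%E; last first.
  apply: (@norming_positive _ L _ [set x | t < g x]) => //; first exact: mA.
    by rewrite lt0e h1 measure_ge0.
  by apply: filterS rg => x -> /ltW.
have [h2|h2] := eqVneq (mu [set x | t < - g x]) 0%E; last first.
  have [h [mh ih hn rh]] : exists h : T -> R, [/\ measurable_fun setT h,
      ae_integrable mu h, (\int[mu]_x `|h x|)%R = 1 &
      t <= (\int[mu]_x (- rho x * h x))%R].
    apply: (@norming_positive _ L _ [set x | t < - g x]) => //.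
    - by apply: filterS rL => x; rewrite normrN.
    - under eq_fun do rewrite -mulN1r.
      by apply: ae_mfunM => //; exact: ae_mfun_cst.
    - exact/mA/measurable_funN.
    - by rewrite lt0e h2 measure_ge0.
    - by apply: filterS rg => x -> /ltW.
  exists (fun x => - h x); split => //.
  - exact: measurable_funN.
  - exact: ae_integrableN.
  - by under eq_Rintegral do rewrite normrN.
  - by under eq_Rintegral do rewrite mulrN -mulNr.
exfalso; apply: nae.
have n1 : {ae mu, forall x, g x <= t}.
  exists [set x | t < g x]; split => //; first exact: mA.
  by move=> x /= /negP; rewrite -ltNge.
have n2 : {ae mu, forall x, - g x <= t}.
  exists [set x | t < - g x]; split => //; first exact/mA/measurable_funN.
  by move=> x /= /negP; rewrite -ltNge.
apply: filterS3 rg n1 n2 => x -> x1 x2; rewrite ler_norml x1 andbT; lra.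
Qed.

Lemma rho_integrable rho (L : R) f : {ae mu, forall x, `|rho x| <= L} ->
  ae_mfun mu rho -> ae_integrable mu f -> ae_integrable mu (fun x => rho x * f x).
Proof.
move=> rL mr intf; apply: (@ae_integrable_dom _ _ _ _ _ (fun x => L * `|f x|)).
- by apply: ae_mfunM => //; exact: ae_integrable_mfun.
- exact/ae_integrableZ/ae_integrable_norm.
- by apply: filterS rL => x rx; rewrite normrM ler_wpM2r.
Qed.

(** A norming function of mass [w] is added to [f], with the sign for which its contribution does
    not cancel the pairing of [rho] with [f]. *)
Lemma gliding_hump_step rho (S w : R) f : 0 < S -> 0 < w ->
  {ae mu, forall x, `|rho x| <= S} -> ae_mfun mu rho ->
  ~ {ae mu, forall x, `|rho x| <= 3 / 4 * S} ->
  measurable_fun setT f -> ae_integrable mu f ->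
  exists f' : T -> R, [/\ measurable_fun setT f', ae_integrable mu f',
    (\int[mu]_x `|f' x - f x|)%R <= w &
    w * (3 / 4 * S) <= `|(\int[mu]_x (rho x * f' x))%R|].
Proof.
move=> S0 w0 rS mr nae mf intf.
have t0 : 0 < 3 / 4 * S by rewrite mulr_gt0//; lra.
have [h [mh ih hn rh]] := norming_function t0 rS mr nae.
pose s : R := if 0 <= (\int[mu]_x (rho x * f x))%R then 1 else -1.
have s1 : `|s| = 1 by rewrite /s; case: ifP => _; rewrite ?normrN normr1.
exists (fun x => f x + s * w * h x); split.
- apply: measurable_funD => //; apply: measurable_funM => //; exact: measurable_cst.
- exact/ae_integrableD/ae_integrableZ.
- under eq_Rintegral do rewrite addrC addKr !normrM s1 mul1r (ger0_norm (ltW w0)).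
  by rewrite RintZ ?hn ?mulr1//; exact: ae_integrable_norm.
have i1 := rho_integrable rS mr intf; have i2 := rho_integrable rS mr ih.
have -> : (\int[mu]_x (rho x * (f x + s * w * h x)))%R =
    (\int[mu]_x (rho x * f x))%R + s * w * (\int[mu]_x (rho x * h x))%R.
  rewrite -RintZ// -RintD//; last exact: ae_integrableZ.
  by apply: eq_Rintegral => x _; rewrite mulrDr mulrCA.
have h2 := ler_wpM2l (ltW w0) rh.
rewrite /s; case: ifPn => [I0|]; last rewrite -ltNge => I0.
  rewrite mul1r ger0_norm; first by rewrite (le_trans h2)// lerDr.
  by rewrite addr_ge0// (le_trans _ h2)// mulr_ge0 ?ltW.
rewrite mulN1r mulNr -normrN opprB ger0_norm.
  by rewrite (le_trans h2)// lerDl oppr_ge0 ltW.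
by rewrite addr_ge0 ?oppr_ge0 ?(ltW I0)// (le_trans _ h2)// mulr_ge0 ?ltW.
Qed.

(* Uniform boundedness principle for L^oo = (L^1)', by a gliding hump. *)
Lemma weak_star_bounded (rho_ : R -> T -> R) (l : (T -> R) -> R) :
  (forall e, 0 < e -> ae_mfun mu (rho_ e)) ->
  (forall e, 0 < e -> exists L, {ae mu, forall x, `|rho_ e x| <= L}) ->
  (forall f, ae_integrable mu f ->
    (\int[mu]_x (rho_ e x * f x))%R @[e --> 0^'+] --> l f) ->
  exists2 L : R, 0 < L & \forall e \near 0^'+, {ae mu, forall x, `|rho_ e x| <= L}.
Proof.
move=> mr br cr; apply: contrapT => nL.
(* Without a bound near 0 there are parameters [e_ j], tending to 0, at which [4^j] is not an
   essential bound. *)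
have /choice[e_ e_P] : forall j : nat, exists e, [/\ 0 < e, e < j.+1%:R^-1 &
    ~ {ae mu, forall x, `|rho_ e x| <= 4 ^+ j}].
  move=> j; apply: not_near0_right; last by rewrite invr_gt0.
  by move=> h; apply: nL; exists (4 ^+ j) => //; rewrite exprn_gt0.
have /choice[S_ S_P] : forall j, exists S, [/\ 4 ^+ j < S,
    {ae mu, forall x, `|rho_ (e_ j) x| <= S} &
    ~ {ae mu, forall x, `|rho_ (e_ j) x| <= 3 / 4 * S}].
  move=> j; have [ej0 _ nj] := e_P j; have [L rL] := br _ ej0.
  by apply: (ess_bound_scale _ rL nj); rewrite exprn_gt0.
have S0 j : 0 < S_ j.
  by have [h _ _] := S_P j; rewrite (lt_trans _ h)// exprn_gt0.
(* Hump [j] makes the pairing at least [3/4 w_j S_j], and all later humps together change it by at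
   most [1/2 w_j S_j]. What is left, [w_j S_j / 4], exceeds [(4/3)^j / 4] because [S_j > 4^j]. *)
pose w j : R := 3^-1 ^+ j.
have w0 j : 0 < w j by rewrite exprn_gt0// invr_gt0.
have /choice[F FP] : forall q : nat * (T -> R), exists f' : T -> R,
    measurable_fun setT q.2 -> ae_integrable mu q.2 ->
    [/\ measurable_fun setT f', ae_integrable mu f',
    (\int[mu]_x `|f' x - q.2 x|)%R <= w q.1 &
    w q.1 * (3 / 4 * S_ q.1) <= `|(\int[mu]_x (rho_ (e_ q.1) x * f' x))%R|].
  move=> [j f] /=; have [ej0 _ _] := e_P j; have [_ rS nS] := S_P j.
  have [mf|nmf] := pselect (measurable_fun setT f); last by exists f.
  have [intf|nif] := pselect (ae_integrable mu f); last by exists f.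
  have [f' f'P] := gliding_hump_step (S0 j) (w0 j) rS (mr _ ej0) nS mf intf.
  by exists f'.
pose f_ := fix f_ j : T -> R := if j is i.+1 then F (i, f_ i) else cst 0.
have f_P j : measurable_fun setT (f_ j) /\ ae_integrable mu (f_ j).
  elim: j => [|j [IH1 IH2]] /=.
    by split; [exact: measurable_cst|exact: ae_integrable0].
  by have [] := FP (j, f_ j) IH1 IH2.
have f_S j : (\int[mu]_x `|f_ j.+1 x - f_ j x|)%R <= w j /\
    w j * (3 / 4 * S_ j) <= `|(\int[mu]_x (rho_ (e_ j) x * f_ j.+1 x))%R|.
  by have [h1 h2] := f_P j; have [] := FP (j, f_ j) h1 h2.
have id k j : ae_integrable mu (fun x => f_ k x - f_ j x).
  by apply: ae_integrableB; [exact: (f_P k).2|exact: (f_P j).2].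
have third : 0 <= (3^-1 : R) < 1 by rewrite invr_ge0 ler0n/= invf_lt1// ltr1n.
have f_lim j : (\int[mu]_x `|f_ j.+1 x - f_ j x|%:E <= (1 * 3^-1 ^+ j)%:E)%E.
  rewrite mul1r -EFin_Rint//; last exact/ae_integrable_norm/id.
  by rewrite lee_fin; exact: (f_S j).1.
have [f mf hf] := ae_limit_of_summable third (fun j => (f_P j).1) f_lim.
have tail k j : (\int[mu]_x `|f_ (j + k)%N x - f_ k x|)%R <= 3 / 2 * w k.
  suff : (\int[mu]_x `|f_ (j + k)%N x - f_ k x|)%R <= 3 / 2 * w k - 3 / 2 * w (j + k)%N.
    by move=> /le_trans; apply; rewrite gerBl mulr_ge0 ?(ltW (w0 _)).
  elim: j => [|j IH].
    rewrite add0n subrr; under eq_Rintegral do rewrite subrr normr0.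
    by rewrite Rint0.
  apply: (@le_trans _ _ ((\int[mu]_x `|f_ (j.+1 + k)%N x - f_ (j + k)%N x|)%R +
    (\int[mu]_x `|f_ (j + k)%N x - f_ k x|)%R)).
    rewrite -RintD; try exact/ae_integrable_norm/id.
    apply: Rint_le; first exact/ae_integrable_norm/id.
      by apply: ae_integrableD; exact/ae_integrable_norm/id.
    by apply: aeW => x; rewrite -(subrKA (f_ (j + k)%N x)) ler_normD.
  have := (f_S (j + k)%N).1; rewrite addSn {3}/w exprS -/(w (j + k)%N); lra.
have ftail k : (\int[mu]_x `|f x - f_ k x|%:E <= (3 / 2 * w k)%:E)%E.
  apply: (@fatou_le _ _ _ mu (fun j x => `|f_ (j + k)%N x - f_ k x|)).
  - move=> j; apply: measurableT_comp; first exact: normr_measurable.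
    by apply: measurable_funB; exact: (f_P _).1.
  - by move=> j x; exact: normr_ge0.
  - apply: filterS hf => x hf; apply: cvg_norm; apply: cvgB; last exact: cvg_cst.
    by rewrite (cvg_shiftn k (fun j => f_ j x)).
  - move=> j; rewrite -EFin_Rint//; last exact/ae_integrable_norm/id.
    by rewrite lee_fin.
have idf k : ae_integrable mu (fun x => f x - f_ k x).
  apply: integrable_ae_integrable; apply/integrableP; split.
    by apply/measurable_EFinP; apply: measurable_funB => //; exact: (f_P _).1.
  by rewrite (le_lt_trans (ftail k))// ltry.
have intf : ae_integrable mu f.
  have := ae_integrableD (idf 0%N) (f_P 0%N).2.
  by under eq_fun do rewrite subrK.
have low j : 4^-1 * (4 / 3) ^+ j <= `|(\int[mu]_x (rho_ (e_ j) x * f x))%R|.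
  have [ej0 _ _] := e_P j; have [S4 rS _] := S_P j; have [_ h1] := f_S j.
  have mrj := mr _ ej0.
  have i1 := rho_integrable rS mrj (f_P j.+1).2.
  have i2 := rho_integrable rS mrj (idf j.+1).
  have E : (\int[mu]_x (rho_ (e_ j) x * f x))%R =
      (\int[mu]_x (rho_ (e_ j) x * f_ j.+1 x))%R +
      (\int[mu]_x (rho_ (e_ j) x * (f x - f_ j.+1 x)))%R.
    by rewrite -RintD//; apply: eq_Rintegral => x _; rewrite -mulrDr addrC subrK.
  have h2 : `|(\int[mu]_x (rho_ (e_ j) x * (f x - f_ j.+1 x)))%R| <= S_ j * (2^-1 * w j).
    apply: (@le_trans _ _ (\int[mu]_x (S_ j * `|f x - f_ j.+1 x|))%R).
      apply: Rint_norm_le; first exact: ae_integrable_mfun i2.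
        exact/ae_integrableZ/ae_integrable_norm.
      by apply: filterS rS => x rx; rewrite normrM ler_wpM2r.
    rewrite RintZ; last exact/ae_integrable_norm.
    rewrite ler_wpM2l ?(ltW (S0 j))// -lee_fin EFin_Rint//; last exact/ae_integrable_norm.
    apply: (le_trans (ftail j.+1)); rewrite lee_fin /w exprS; lra.
  have h3 : 4^-1 * (4 / 3) ^+ j <= 4^-1 * (w j * S_ j).
    by rewrite ler_wpM2l// expr_div_n mulrC /w exprVn ler_wpM2l ?invr_ge0 ?exprn_ge0// ltW.
  apply: (le_trans h3); rewrite E.
  have := lerB_normD (\int[mu]_x (rho_ (e_ j) x * f_ j.+1 x))%R
    (\int[mu]_x (rho_ (e_ j) x * (f x - f_ j.+1 x)))%R.
  rewrite mulrCA in h1; rewrite mulrCA [S_ j * _]mulrC in h2; lra.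
have /cvgrPdist_le/(_ 1 ltr01) : (\int[mu]_x (rho_ e x * f x))%R @[e --> 0^'+] --> l f.
  exact: cr.
move=> [r /= r0 Hr].
have [j0 j0r] : exists j0 : nat, j0.+1%:R^-1 < r.
  exists (Num.truncn r^-1); rewrite -[ltRHS]invrK ltf_pV2 ?posrE ?invr_gt0//.
  exact: truncnS_gt.
have up j : (j0 <= j)%N -> 4^-1 * (4 / 3) ^+ j <= `|l f| + 1.
  move=> j0j; apply: (le_trans (low j)).
  have [ej0 ej1 _] := e_P j.
  have : `|l f - (\int[mu]_x (rho_ (e_ j) x * f x))%R| <= 1.
    apply: Hr => //=; rewrite sub0r normrN ger0_norm ?(ltW ej0)//.
    apply: (lt_trans ej1); apply: le_lt_trans j0r.
    by rewrite lef_pV2 ?posrE ?ltr0n// ler_nat.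
  by rewrite distrC => h; rewrite -[X in `|X|](subrK (l f)) (le_trans (ler_normD _ _))// addrC lerD2l.
have : geometric (4 * (`|l f| + 1)) (3 / 4 : R) @ \oo --> (0 : R).
  by apply: cvg_geometric; rewrite ger0_norm//; lra.
move=> /cvgrPdist_lt => /(_ 1 ltr01) [j1 _ /(_ (maxn j0 j1) (leq_maxr _ _))].
rewrite sub0r normrN => h; have := le_lt_trans (ler_norm _) h.
rewrite /geometric/= ltNge => /negP; apply.
have := up _ (leq_maxl j0 j1).
set j := maxn _ _ => h2.
have q0 : 0 <= (3 / 4 : R) ^+ j by rewrite exprn_ge0//; lra.
have := ler_wpM2r q0 h2; rewrite -mulrA -exprMn.
rewrite (_ : 4 / 3 * (3 / 4) = 1 :> R) ?expr1n; last by field.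
rewrite -mulrA; lra.
Qed.

End weak_star_bound.

(** * Continuity and uniform convergence of the weighted masses *)

Section weighted_masses.
Context (R : realType) (n : nat) (n_gt0 : (0 < n)%N) (O : set 'rV[R]_n)
  (oO : open O) (bO : bounded_set O) (p : R) (p1 : 1 < p).
Local Notation mu := (lebesgue_on oO).
Local Notation W := (sobolev0 oO p1).
Implicit Types (u v : W) (rho : 'rV[R]_n -> R).
Let p0 : 0 < p. Proof. exact: lt_trans p1. Qed.

Lemma mass_integrable rho u : in_Lspace oO +oo%E rho ->
  ae_integrable mu (fun x => rho x * `|sobolev0_fun u x| `^ p).
Proof.
move=> [mr /finite_normy_bounded[L L0 rL]].
by apply: (rho_integrable rL mr); exact: fun_integrable.
Qed.

Lemma massZ rho (t : R) u : in_Lspace oO +oo%E rho ->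
  weighted_mass rho (t *: u) = `|t| `^ p * weighted_mass rho u.
Proof.
move=> hr; rewrite /weighted_mass -RintZ; last exact: mass_integrable.
apply: eq_Rintegral => x _; rewrite sobolev0_funZ normrM powRM//.
by rewrite mulrCA.
Qed.

Lemma massN rho u : weighted_mass rho (- u) = weighted_mass rho u.
Proof. by apply: eq_Rintegral => x _; rewrite sobolev0_funN normrN. Qed.

Lemma fun_energyE_int u : fun_energy u = (\int[mu]_x `|sobolev0_fun u x| `^ p)%R.
Proof. by []. Qed.

Lemma fun_energyN u : fun_energy (- u) = fun_energy u.
Proof.
by rewrite !fun_energyE_int; apply: eq_Rintegral => x _; rewrite sobolev0_funN normrN.
Qed.

Lemma fun_energyD u v : fun_energy (u + v) <= 2 `^ p * (fun_energy u + fun_energy v).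
Proof.
have iu (w : W) := fun_integrable w.
rewrite !fun_energyE_int -RintD// -RintZ; last exact: ae_integrableD.
apply: Rint_le => //; first by apply: ae_integrableZ; exact: ae_integrableD.
apply: aeW => x.
have -> : sobolev0_fun (u + v) x = sobolev0_fun u x + sobolev0_fun v x by [].
apply: (le_trans (powR_le (ltW p0) (normr_ge0 _) (ler_normD _ _))).
exact: powRD_le.
Qed.

Lemma mass_dist (L eta : R) : 0 < L -> 0 < eta -> exists2 K, 0 <= K &
  forall rho, in_Lspace oO +oo%E rho -> {ae mu, forall x, `|rho x| <= L} ->
  forall u v, `|weighted_mass rho u - weighted_mass rho v| <=
    eta * (fun_energy u + fun_energy v) + K * fun_energy (u - v).
Proof.
move=> L0 e0; have [K K0 HK] := powR_dist_le p0 (divr_gt0 e0 L0).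
exists (L * K); first by rewrite mulr_ge0// ltW.
move=> rho hr rL u v.
have iu (w : W) := fun_integrable w.
rewrite /weighted_mass -RintB; try exact: mass_integrable.
have i1 := ae_integrableD (iu u) (iu v).
have i2 := ae_integrableD (ae_integrableZ eta i1) (ae_integrableZ (L * K) (iu (u - v))).
have -> : eta * (fun_energy u + fun_energy v) + L * K * fun_energy (u - v) =
   (\int[mu]_x (eta * (`|sobolev0_fun u x| `^ p + `|sobolev0_fun v x| `^ p) +
     L * K * `|sobolev0_fun (u - v) x| `^ p))%R.
  rewrite (RintD (ae_integrableZ eta i1) (ae_integrableZ (L * K) (iu (u - v)))).
  by rewrite (RintZ eta i1) (RintZ (L * K) (iu (u - v))) (RintD (iu u) (iu v)).
apply: (Rint_norm_le _ i2).
  by apply: ae_integrable_mfun; apply: ae_integrableB; exact: mass_integrable.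
apply: filterS rL => x rx; rewrite -mulrBr normrM.
apply: (le_trans (ler_wpM2r (normr_ge0 _) rx)).
apply: (le_trans (ler_wpM2l (ltW L0) (HK _ _))).
by rewrite mulrDr mulrA mulrCA divff ?gt_eqF// mulr1 mulrA.
Qed.

(** The threshold [t] depends on the weight only through [L], so it serves [rho] and all [rho_e]
    with [e] small. *)
Lemma mass_small (L M delta : R) : 0 < L -> 0 <= M -> 0 < delta -> exists2 t, 0 < t &
  forall rho, in_Lspace oO +oo%E rho -> {ae mu, forall x, `|rho x| <= L} ->
  forall u v, grad_energy u <= M -> grad_energy v <= M -> fun_energy (u - v) <= t ->
    `|weighted_mass rho u - weighted_mass rho v| <= delta.
Proof.
move=> L0 M0 d0.
have [C C0 HC] := fun_energy_le_grad n_gt0 oO bO p1.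
have CM1 : 0 < 2 * (C * M) + 1 by rewrite ltr_wpDl// !mulr_ge0// ltW.
have e2 : 0 < delta / 2 / (2 * (C * M) + 1) by rewrite !divr_gt0.
have [K K0 HK] := mass_dist L0 e2.
have K1 : 0 < K + 1 by rewrite ltr_wpDl.
exists (delta / 2 / (K + 1)); first by rewrite !divr_gt0.
move=> r hr rr u v uM vM uvt; apply: (le_trans (HK r hr rr u v)).
rewrite [leRHS]splitr; apply: lerD.
  apply: (@le_trans _ _ (delta / 2 / (2 * (C * M) + 1) * (2 * (C * M) + 1))).
    apply: ler_wpM2l; first exact: ltW.
    rewrite mulr_natl mulr2n; apply: ler_wpDr; first exact: ler01.
    by apply: lerD; [exact: le_trans (HC u) (ler_wpM2l (ltW C0) uM)|
                     exact: le_trans (HC v) (ler_wpM2l (ltW C0) vM)].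
  by rewrite divfK// gt_eqF.
apply: (@le_trans _ _ ((K + 1) * (delta / 2 / (K + 1)))).
  by rewrite ler_pM ?fun_energy_ge0// lerDl.
by rewrite mulrC divfK// gt_eqF.
Qed.

Lemma box_compact m (X : R) : compact [set c : 'rV[R]_m | forall i, `|c 0 i| <= X].
Proof.
have := @rV_compact R m (fun=> `[- X, X]%classic) (fun=> @segment_compact _ _ _).
congr compact; apply/seteqP; split => c /= h i; have := h i.
  by rewrite in_itv/= ler_norml.
by rewrite in_itv/= ler_norml.
Qed.

Lemma forms_bounded m (l : 'I_m -> W -> R) (Y : R) : 0 <= Y ->
  (forall i, bounded_form (l i)) -> exists2 X, 0 <= X &
  forall u, sobolev0_norm u <= Y -> forall i, `|l i u| <= X.
Proof.
move=> Y0 bl.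
have /choice[k kP] : forall i, exists k, 0 <= k /\ forall u, `|l i u| <= k * sobolev0_norm u.
  by move=> i; have [k k0 h] := bl i; exists k.
exists (\sum_i k i * Y); first by apply: sumr_ge0 => i _; rewrite mulr_ge0// (kP i).1.
move=> u uY i; apply: (le_trans ((kP i).2 u)).
rewrite (bigD1 i)//= ler_wpDr//; last by rewrite ler_wpM2l// (kP i).1.
by apply: sumr_ge0 => j _; rewrite mulr_ge0// (kP j).1.
Qed.

Lemma norm_le_of_grad_energy (M : R) : exists2 Y, 0 <= Y &
  forall u, grad_energy u <= M -> sobolev0_norm u <= Y.
Proof.
have [L L0 HL] := grad_energy_bound_of_norm n_gt0 oO bO p1 (ler01 : (0 : R) <= 1) ltr01.
exists (`|M| + L); first by rewrite addr_ge0.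
move=> u uM; have := HL u; rewrite !mul1r => h; apply: (le_trans h).
by rewrite lerD2r (le_trans uM)// ler_norm.
Qed.

Lemma small_powR (C e : R) : 0 <= C -> 0 < e -> exists2 s, 0 < s & C * s `^ p <= e.
Proof.
move=> C0 e0; have C1 : 0 < C + 1 by rewrite ltr_wpDl.
exists ((e / (C + 1)) `^ p^-1); first by rewrite powR_gt0// divr_gt0.
rewrite powRVK ?lt0r_neq0//; last by rewrite divr_ge0 ?ltW.
by rewrite mulrCA ler_piMr ?(ltW e0)// ler_pdivrMr// mul1r lerDl.
Qed.

Section weak_star_masses.
Variables (rho_ : R -> 'rV[R]_n -> R) (rho : 'rV[R]_n -> R).
Context (hrho_ : forall e, 0 < e -> in_Lspace oO +oo%E (rho_ e))
  (hrho : in_Lspace oO +oo%E rho) (wrho : weakstar_cvg oO rho_ rho).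

Lemma weak_star_integrable f : ae_integrable mu f ->
  (\int[mu]_x (rho_ e x * f x))%R @[e --> 0^'+] --> (\int[mu]_x (rho x * f x))%R.
Proof.
move=> intf; apply: wrho; split; first exact: ae_integrable_mfun.
apply: (integrable_finite_norm ltr01).
by under eq_fun do rewrite powRr1//; exact: ae_integrable_norm.
Qed.

Lemma weights_bounded : exists2 L : R, 0 < L &
  \forall e \near 0^'+, {ae mu, forall x, `|rho_ e x| <= L}.
Proof.
apply: (weak_star_bounded (mu_finite oO bO) _ _ weak_star_integrable).
- by move=> e e0; have [] := hrho_ e0.
- move=> e e0; have [_ /finite_normy_bounded[L _ hL]] := hrho_ e0.
  by exists L.
Qed.

(** Compactness is used in R^m: the values of the Ehrling forms on the energy ball lie in a compact
    box, and two functions with nearby values are close in L^p. Weak* convergence tested on one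
    function per small ball of values is therefore enough. *)
Lemma mass_uniform_cvg (M delta : R) : 0 <= M -> 0 < delta ->
  \forall e \near 0^'+, forall u, grad_energy u <= M ->
    `|weighted_mass (rho_ e) u - weighted_mass rho u| <= delta.
Proof.
move=> M0 d0.
have tri (a b c d : R) : `|a - b| <= delta / 3 -> `|c - d| <= delta / 3 ->
    `|d - b| <= delta / 3 -> `|a - c| <= delta.
  rewrite !ler_norml => /andP[a1 a2] /andP[a3 a4] /andP[a5 a6].
  by apply/andP; split; lra.
have [L1 L10 nL1] := weights_bounded.
have [_ /finite_normy_bounded[L2 L20 rL2]] := hrho.
pose L := L1 + L2.
have L0 : 0 < L by rewrite addr_gt0.
have rL : {ae mu, forall x, `|rho x| <= L}.
  by apply: filterS rL2 => x /le_trans; apply; rewrite lerDr ltW.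
have nL : \forall e \near 0^'+, {ae mu, forall x, `|rho_ e x| <= L}.
  apply: filterS nL1 => e; apply: filterS => x /le_trans; apply.
  by rewrite lerDl ltW.
have d30 : 0 < delta / 3 by rewrite divr_gt0.
have [t t0 B6] := mass_small L0 M0 d30.
have Q0 : 0 < 2 `^ p * (M + M) + 1 by rewrite ltr_wpDl// mulr_ge0 ?powR_ge0// addr_ge0.
have eta0 : 0 < t / 2 / (2 `^ p * (M + M) + 1) by rewrite !divr_gt0.
have [m [l [K' [K'0 ll bl HE]]]] := ehrling n_gt0 oO bO p1 eta0.
have Km0 : 0 <= K' * m%:R by rewrite mulr_ge0.
have t20 : 0 < t / 2 by rewrite divr_gt0.
have [s s0 Hs] := small_powR Km0 t20.
have [Y Y0 HY] := norm_le_of_grad_energy M.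
have [X X0 HX] := forms_bounded Y0 bl.
have close u v : grad_energy u <= M -> grad_energy v <= M ->
    (forall i, `|l i u - l i v| <= s) -> fun_energy (u - v) <= t.
  move=> uM vM luv; apply: (le_trans (HE _)); rewrite [leRHS](splitr t); apply: lerD.
    apply: (@le_trans _ _ (t / 2 / (2 `^ p * (M + M) + 1) * (2 `^ p * (M + M) + 1))).
      apply: ler_wpM2l; first exact: ltW.
      apply: (le_trans (grad_energyD _ _)); rewrite grad_energyN ler_wpDr//.
      exact: (ler_wpM2l (powR_ge0 _ _) (lerD uM vM)).
    by rewrite divfK// gt_eqF.
  apply: le_trans Hs; rewrite -mulrA ler_wpM2l//.
  apply: (@le_trans _ _ (\sum_(i < m) s `^ p)).
    by apply: ler_sum => i _; rewrite (is_linearB _ _ (ll i)) powR_le ?(ltW p0).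
  by rewrite sumr_const card_ord mulr_natl.
suff : \forall e \near 0^'+, forall c : 'rV[R]_m, (forall i, `|c 0 i| <= X) ->
    forall u, grad_energy u <= M -> (forall i, l i u = c 0 i) ->
    `|weighted_mass (rho_ e) u - weighted_mass rho u| <= delta.
  apply: filterS => e He u uM.
  apply: (He (\row_i l i u)) => // i; rewrite mxE//.
  by apply: HX; exact: HY.
apply: (@compact_local_uniform R 'rV[R]_m _ (fun e (c : 'rV[R]_m) =>
    forall u, grad_energy u <= M -> (forall i, l i u = c 0 i) ->
    `|weighted_mass (rho_ e) u - weighted_mass rho u| <= delta)).
  exact: box_compact.
move=> c _.
have s20 : 0 < s / 2 by rewrite divr_gt0.
exists (s / 2) => //.
have lball u (c' : 'rV[R]_m) : ball c (s / 2) c' -> (forall i, l i u = c' 0 i) ->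
    forall i, `|l i u - c 0 i| <= s / 2.
  by move=> [_ cc'] lu i; rewrite lu distrC ltW//; exact: cc'.
(* If no function of bounded energy has its values near [c], the claim is vacuous around [c]. *)
have [[u0 [u0M lu0]]|no] := pselect (exists u0, grad_energy u0 <= M /\
    forall i, `|l i u0 - c 0 i| <= s / 2).
  have := weak_star_integrable (fun_integrable u0).
  move=> /cvgrPdist_le/(_ _ d30) c0.
  apply: filterS3 nL (nbhs_right_gt 0) c0 => e rLe e0 c0 c' cc' u uM luc.
  have uu0 : fun_energy (u - u0) <= t.
    apply: close => // i; rewrite -(subrKA (c 0 i)) (le_trans (ler_normD _ _))//.
    rewrite (splitr s) lerD//; first exact: (lball u c').
    by rewrite distrC.
  have h1 := B6 _ (hrho_ e0) rLe u u0 uM u0M uu0.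
  have h2 := B6 _ hrho rL u u0 uM u0M uu0.
  exact: tri h1 h2 c0.
apply: nearW => e c' cc' u uM luc; exfalso; apply: no; exists u; split => //.
exact: (lball u c').
Qed.

End weak_star_masses.
End weighted_masses.

(** * Uniform consequences of G-convergence *)

Lemma powR_continuous_pos (R : realType) (q b : R) : 0 < b ->
  {for b, continuous (fun x : R => x `^ q)}.
Proof.
move=> b0.
have H : {for b, continuous (fun x : R => expR (q * ln x))}.
  apply: (@continuous_comp _ _ _ (fun x : R => q * ln x)); last exact: continuous_expR.
  by apply: continuousM; [exact: cst_continuous|exact: continuous_ln].
have E x : 0 < x -> x `^ q = expR (q * ln x).
  by move=> x0; rewrite /powR gt_eqF.
rewrite /prop_for /continuous_at E//; apply: cvg_trans H.
by apply: near_eq_cvg; near=> x; rewrite E//; near: x; exact: lt_nbhsr.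
Unshelve. all: by end_near. Qed.

Section convergence.
Context (R : realType) (n : nat) (n_gt0 : (0 < n)%N) (O : set 'rV[R]_n)
  (oO : open O) (bO : bounded_set O) (p : R) (p1 : 1 < p).
Local Notation mu := (lebesgue_on oO).
Local Notation W := (sobolev0 oO p1).
Implicit Types (u v w z : W).
Let p0 : 0 < p. Proof. exact: lt_trans p1. Qed.

Section one_operator.
Variables (A : W -> W -> R) (alpha beta : R) (K3 K4 : R -> R).
Context (Areg : regular_operator A alpha beta K3 K4).

Lemma op_solve (f : W -> R) : is_linear f -> bounded_form f ->
  exists w, forall z, A w z = f z.
Proof.
move=> lf bf.
(* The perturbed problem with no forms at all ([m = 0]), whose conditions over ['I_0] are
   vacuous. *)
have [w Hw] := @perturbed_solution _ _ n_gt0 _ _ bO _ _ _ _ _ _ _ Areg 0%N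
  (fun _ _ => 0) 0 (lexx 0) (fun i => match i with Ordinal _ h => False_rect _ (notF h) end)
  (fun i => match i with Ordinal _ h => False_rect _ (notF h) end) _ lf bf.
by exists w => z; rewrite -Hw mul0r addr0.
Qed.

Lemma op_continuous v d : 0 < d -> exists2 r, 0 < r & forall v' z,
  sobolev0_norm (v' - v) < r -> `|A v' z - A v z| <= d * sobolev0_norm z.
Proof.
move=> d0; have [C C0 HC] := grad_energy_le_norm n_gt0 oO p1.
pose Q := 2 `^ p * (grad_energy v + 1) + grad_energy v + C + 1.
have Q0 : 0 < Q.
  by rewrite ltr_wpDl// !addr_ge0 ?(ltW C0) ?grad_energy_ge0// mulr_ge0 ?powR_ge0// addr_ge0 ?grad_energy_ge0.
have e0 : 0 < d / 2 / Q by rewrite !divr_gt0.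
have k0 := op_K4 Areg (d / 2 / Q).
have K1 : 0 < K4 (d / 2 / Q) + 1 by rewrite ltr_wpDl.
have m0 : 0 < Num.min 1 (d / 2 / (K4 (d / 2 / Q) + 1)) by rewrite lt_min ltr01 !divr_gt0.
have [r r0 Hr] := small_powR p1 (ltW C0) m0.
exists r => // v' z vr.
apply: (form_le_of_ball (l := fun z => A v' z - A v z)); last first.
- move=> {}z z1; apply: (le_trans (op_equi Areg e0 v' v z)).
  have Gd : grad_energy (v' - v) <= Num.min 1 (d / 2 / (K4 (d / 2 / Q) + 1)).
    apply: (le_trans (HC _)); apply: le_trans Hr; apply: ler_wpM2l; first exact: ltW.
    by rewrite powR_le ?(ltW p0) ?sobolev0_norm_ge0// ltW.
  move: Gd; rewrite le_min => /andP[G1 G2].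
  have Gv' : grad_energy v' <= 2 `^ p * (grad_energy v + 1).
    rewrite -{1}(subrK v v') addrC; apply: (le_trans (grad_energyD _ _)).
    by rewrite ler_wpM2l ?powR_ge0// lerD2l.
  have Gz : grad_energy z <= C.
    apply: (le_trans (HC z)); apply: ler_piMr; first exact: ltW.
    by have := powR_le (ltW p0) (sobolev0_norm_ge0 z) z1; rewrite powR1.
  rewrite [leRHS]splitr; apply: lerD.
    apply: (@le_trans _ _ (d / 2 / Q * Q)); last by rewrite divfK// gt_eqF.
    apply: ler_wpM2l; first exact: ltW.
    rewrite /Q; apply: ler_wpDr; first exact: ler01.
    by apply: lerD => //; rewrite lerD2r.
  apply: (@le_trans _ _ ((K4 (d / 2 / Q) + 1) * (d / 2 / (K4 (d / 2 / Q) + 1)))).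
    by apply: ler_pM => //; [exact: grad_energy_ge0|rewrite lerDl].
  by rewrite mulrC divfK// gt_eqF.
- by move=> c x y; rewrite !(op_linear Areg); ring.
Qed.

Lemma op_energy_continuous v d : 0 < d -> exists2 r, 0 < r & forall v',
  sobolev0_norm (v' - v) < r -> `|A v' v' - A v v| <= d.
Proof.
move=> d0; have [K Kge0 HK] := op_bounded n_gt0 Areg v.
pose Q := sobolev0_norm v + 1.
have Q0 : 0 < Q by rewrite ltr_wpDl// sobolev0_norm_ge0.
have e0 : 0 < d / 2 / Q by rewrite !divr_gt0.
have [r r0 Hr] := op_continuous v e0.
have K1 : 0 < K + 1 by rewrite ltr_wpDl.
exists (Num.min r (Num.min 1 (d / 2 / (K + 1)))).
  by rewrite !lt_min r0 ltr01 !divr_gt0.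
move=> v'; rewrite !lt_min => /and3P[vr v1 vd].
have nv' : sobolev0_norm v' <= Q.
  rewrite -(subrK v v') addrC; apply: (le_trans (sobolev0_normD _ _)).
  by rewrite lerD2l ltW.
have -> : A v' v' - A v v = (A v' v' - A v v') + A v (v' - v).
  by rewrite (is_linearB _ _ (op_linear Areg v)) addrA subrK.
rewrite (le_trans (ler_normD _ _))// [leRHS]splitr; apply: lerD.
  apply: (le_trans (Hr v' v' vr)).
  by rewrite mulrAC ler_pdivrMr// ler_wpM2l// divr_ge0// ltW.
apply: (le_trans (HK _)); apply: (@le_trans _ _ ((K + 1) * (d / 2 / (K + 1)))).
  by apply: ler_pM => //; [exact: sobolev0_norm_ge0|rewrite lerDl|exact: ltW].
by rewrite mulrC divfK// gt_eqF.
Qed.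

Lemma op_unique u v : (forall z, A u z = A v z) -> sobolev0_norm (u - v) = 0.
Proof.
move=> uv; apply: (grad_energy_eq0_norm n_gt0 bO).
apply: (@le0_of_le_mul _ _ (A u u + A v v)) => eta e0.
have := op_strict Areg e0 u v.
by rewrite (uv (u - v)) subrr mulr0 addr0.
Qed.

End one_operator.

Variables (alpha beta : R) (K3 K4 : R -> R) (A_ : R -> W -> W -> R).
Context (hA_ : forall e, 0 < e -> regular_operator (A_ e) alpha beta K3 K4).
Variables (alpha' beta' : R) (K3' K4' : R -> R) (A : W -> W -> R).
Context (hA : regular_operator A alpha' beta' K3' K4').
(** G-convergence for a right-hand side independent of [e], expressed by forms; [G_cvg_forms]
    derives it. *)
Context (GA : forall (f : W -> R) (u_ : R -> W), is_linear f -> bounded_form f ->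
  (forall e, 0 < e -> forall z, A_ e (u_ e) z = f z) ->
  exists u, (forall z, A u z = f z) /\
    forall l, is_linear l -> bounded_form l -> l (u_ e) @[e --> 0^'+] --> l u).

Let a0 : 0 < alpha. Proof. exact: (op_alpha (hA_ ltr01)). Qed.
Let a'0 : 0 < alpha'. Proof. exact: (op_alpha hA). Qed.

(** The energy of [w_e] is the right-hand side [A v] evaluated at [w_e], so it converges with the
    weak limit. The Ehrling inequality upgrades weak convergence to convergence in L^p. *)
Lemma G_fixed v (w_ : R -> W) (delta : R) : 0 < delta ->
  (forall e, 0 < e -> forall z, A_ e (w_ e) z = A v z) ->
  \forall e \near 0^'+, `|A_ e (w_ e) (w_ e) - A v v| <= delta /\
    fun_energy (w_ e - v) <= delta.
Proof.
move=> d0 hw; have lv := op_linear hA v; have bv := op_bounded n_gt0 hA v.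
have [u [uA ul]] := GA lv bv hw.
have uv := op_unique hA uA.
have lim l : is_linear l -> bounded_form l -> l (w_ e) @[e --> 0^'+] --> l v.
  move=> ll bl; suff <- : l u = l v by exact: ul.
  apply/eqP; rewrite -subr_eq0 -(is_linearB _ _ ll).
  by apply/eqP; exact: bounded_form_eq0.
have [K Kge0 HK] := bv.
have [Q Q0 HQ] := energy_bound n_gt0 oO bO p1 a0 Kge0.
pose D := 2 `^ p * (Q + grad_energy v) + 1.
have D0 : 0 < D by rewrite ltr_wpDl// mulr_ge0 ?powR_ge0// addr_ge0// grad_energy_ge0.
have d20 : 0 < delta / 2 by rewrite divr_gt0.
have e0 : 0 < delta / 2 / D by rewrite divr_gt0.
have [m [l [K' [K'0 ll bl HE]]]] := ehrling n_gt0 oO bO p1 e0.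
have [s s0 Hs] := small_powR p1 (mulr_ge0 K'0 (ler0n _ m)) d20.
have near_l : \forall e \near 0^'+, forall i, `|l i v - l i (w_ e)| <= s.
  by apply: filter_forall => i; have /cvgrPdist_le := lim _ (ll i) (bl i); exact.
have /cvgrPdist_le/(_ _ d0) near_A := lim _ lv bv.
apply: filterS3 (nbhs_right_gt 0) near_l near_A => e ep nl nA; split.
  by rewrite hw// distrC.
have [Gw _ _] : [/\ grad_energy (w_ e) <= Q, A_ e (w_ e) (w_ e) <= Q &
    sobolev0_norm (w_ e) <= Q].
  apply: HQ; first exact: (op_coercive (hA_ ep)).
  by rewrite hw// (le_trans (ler_norm _)).
apply: (le_trans (HE _)); rewrite [leRHS]splitr; apply: lerD.
  apply: (@le_trans _ _ (delta / 2 / D * D)); last by rewrite divfK// gt_eqF.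
  apply: ler_wpM2l; first exact: ltW.
  apply: (le_trans (grad_energyD _ _)); rewrite grad_energyN.
  rewrite /D; apply: ler_wpDr; first exact: ler01.
  by rewrite ler_wpM2l ?powR_ge0// lerD2r.
apply: le_trans Hs; rewrite -mulrA; apply: ler_wpM2l => //.
apply: (@le_trans _ _ (\sum_(i < m) s `^ p)).
  apply: ler_sum => i _; rewrite (is_linearB _ _ (ll i)) distrC.
  by rewrite powR_le ?(ltW p0).
by rewrite sumr_const card_ord mulr_natl.
Qed.

(* By stability, convergence for a fixed right-hand side is locally uniform in
   the right-hand side. *)
Lemma G_local v (delta : R) : 0 < delta -> exists2 r, 0 < r &
  \forall e \near 0^'+, forall v' w',
    (forall z, `|A v' z - A v z| <= r * sobolev0_norm z) ->
    (forall z, A_ e w' z = A v' z) ->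
    `|A_ e w' w' - A v' v'| <= delta /\ fun_energy (w' - v') <= delta.
Proof.
move=> d0; have lv := op_linear hA v; have bv := op_bounded n_gt0 hA v.
have [K Kge0 HK] := bv.
have K10 : 0 <= K + 1 by rewrite addr_ge0.
have K1p : 0 < K + 1 by rewrite ltr_wpDl.
have [Q Q0 HQ] := energy_bound n_gt0 oO bO p1 a0 K10.
have [Q' Q'0 HQ'] := energy_bound n_gt0 oO bO p1 a'0 K10.
have [C C0 HC] := fun_energy_le_grad n_gt0 oO bO p1.
have t20 : 0 < 2 `^ p :> R by exact: powR_gt0.
(* Chosen so that two applications of [fun_energyD], to three differences of size [t], add up to
   [delta]. *)
pose t := delta / (2 `^ p * (1 + 2 `^ p * 2)).
have P0 : 0 < 2 `^ p * (1 + 2 `^ p * 2) :> R.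
  by rewrite mulr_gt0// ltr_wpDr// mulr_ge0// ltW.
have t0 : 0 < t by rewrite divr_gt0.
have tE : 2 `^ p * (t + 2 `^ p * (t + t)) = delta.
  by rewrite /t; field; rewrite !gt_eqF//= ltr_wpDr// mulr_ge0// ltW.
have d40 : 0 < delta / 4 by rewrite divr_gt0.
have s0 : 0 < delta / 4 / (K + 1) by rewrite divr_gt0.
have [e1 e10 He1] := grad_energy_norm_small n_gt0 oO bO p1 s0.
pose d := Num.min (t / C) e1.
have dp : 0 < d by rewrite lt_min e10 divr_gt0.
have [r1 r10 Hr1] := solution_stability n_gt0 oO bO p1 beta K4 a0
  (op_K3 (hA_ ltr01)) Kge0 dp.
have [r2 r20 Hr2] := solution_stability n_gt0 oO bO p1 beta' K4' a'0 (op_K3 hA) Kge0 dp.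
have QQ : 0 < Q + Q' + 1 by rewrite ltr_wpDl// addr_ge0.
(* [r1] and [r2] give stability for [A_e] and for [A]; 1 keeps the right-hand sides bounded by
   [K + 1]; the last entry makes [A v' - A v] small on [w' - v'], whose norm is at most [Q + Q']. *)
pose r := Num.min (Num.min r1 r2) (Num.min 1 (delta / 4 / (Q + Q' + 1))).
have r0 : 0 < r by rewrite !lt_min r10 r20 ltr01 !divr_gt0.
exists r => //.
have /choice[w_ w_P] : forall e, exists w, 0 < e -> forall z, A_ e w z = A v z.
  move=> e; have [e0|e0] := ltP 0 e; last by exists 0.
  by have [w Hw] := op_solve (hA_ e0) lv bv; exists w.
have m0 : 0 < Num.min (delta / 4) t by rewrite lt_min d40.
apply: filterS2 (nbhs_right_gt 0) (G_fixed m0 w_P) => e e0 [nE nF] v' w' vv' w'v'.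
move: nE nF; rewrite !le_min => /andP[nE _] /andP[_ nF].
have wE := w_P e e0; set w := w_ e in wE nE nF.
have rr1 : r <= r1 by rewrite !ge_min lexx.
have rr2 : r <= r2 by rewrite !ge_min lexx orbT.
have rr3 : r <= 1 by rewrite !ge_min lexx !orbT.
have rr4 : r * (Q + Q' + 1) <= delta / 4.
  by rewrite -ler_pdivlMr// !ge_min lexx !orbT.
have vv (k : R) z : r <= k -> `|A v' z - A v z| <= k * sobolev0_norm z.
  by move=> rk; apply: (le_trans (vv' z)); rewrite ler_wpM2r// sobolev0_norm_ge0.
have bv' z : A v' z <= (K + 1) * sobolev0_norm z.
  have -> : A v' z = A v z + (A v' z - A v z) by rewrite addrC subrK.
  rewrite mulrDl; apply: lerD; first exact: le_trans (ler_norm _) (HK z).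
  exact: le_trans (ler_norm _) (vv 1 z rr3).
have [_ _ nw'] : [/\ grad_energy w' <= Q, A_ e w' w' <= Q & sobolev0_norm w' <= Q].
  by apply: HQ; [exact: (op_coercive (hA_ e0))|rewrite w'v'].
have [_ _ nv'] : [/\ grad_energy v' <= Q', A v' v' <= Q' & sobolev0_norm v' <= Q'].
  by apply: HQ'; [exact: (op_coercive hA)|].
have G1 : grad_energy (w' - w) <= d.
  apply: (Hr1 (A_ e) (A v) (A v')) => //; first exact: hA_.
  - by move=> z; exact: vv.
  - by rewrite wE.
  - by rewrite w'v'.
  - by rewrite w'v' wE.
have G2 : grad_energy (v' - v) <= d.
  by apply: (Hr2 A (A v) (A v')) => // z; exact: vv.
have dt : C * d <= t by rewrite mulrC -ler_pdivlMr// ge_min lexx.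
have de : d <= e1 by rewrite ge_min lexx orbT.
split; last first.
  have -> : w' - v' = (w' - w) + ((w - v) + (v - v')) by rewrite addrA !subrKA.
  rewrite -tE; apply: (le_trans (fun_energyD _ _)).
  apply: ler_wpM2l; first exact: ltW.
  apply: lerD; first exact: le_trans (HC _) (le_trans (ler_wpM2l (ltW C0) G1) dt).
  apply: (le_trans (fun_energyD _ _)); apply: ler_wpM2l; first exact: ltW.
  apply: lerD; first exact: nF.
  rewrite -opprB fun_energyN.
  exact: le_trans (HC _) (le_trans (ler_wpM2l (ltW C0) G2) dt).
have Ks x : grad_energy x <= d -> `|A v x| <= delta / 4.
  move=> xd; apply: (le_trans (HK x)).
  have xs := He1 x (le_trans xd de).
  apply: (@le_trans _ _ ((K + 1) * (delta / 4 / (K + 1)))).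
    by apply: ler_pM => //; [exact: sobolev0_norm_ge0|rewrite lerDl].
  by rewrite mulrC divfK// gt_eqF.
have h1 : `|A v' (w' - v') - A v (w' - v')| <= delta / 4.
  apply: le_trans rr4; apply: (le_trans (vv' _)).
  apply: ler_wpM2l; first exact: ltW.
  apply: (le_trans (sobolev0_normD _ _)); rewrite sobolev0_normN.
  by apply: ler_wpDr => //; exact: lerD.
have h2 := Ks _ G1; have h3 := Ks _ G2.
(* Four terms of size [delta / 4]: the change of right-hand side, the displacement of each solution,
   and the convergence for the fixed right-hand side [A v]. *)
have E : A_ e w' w' - A v' v' = (A v' (w' - v') - A v (w' - v')) +
    (A v (w' - w) + ((A_ e w w - A v v) - A v (v' - v))).
  rewrite w'v' wE !(is_linearB _ _ lv) !(is_linearB _ _ (op_linear hA v')).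
  by ring.
rewrite E; clear E.
move: h1 h2 h3 nE; clear; move: (_ - _) (A v (w' - w)) (A_ e w w - A v v) (A v (v' - v)).
move=> a b c d; rewrite !ler_norml => /andP[? ?] /andP[? ?] /andP[? ?] /andP[? ?].
by apply/andP; split; lra.
Qed.

End convergence.

(** * Arithmetic of the error margins *)

Section elementary_estimates.
Context (R : realFieldType).
Implicit Types x y X d p Lam E k : R.

Lemma dist3_ge x1 x2 x3 x4 d : `|x2 - x1| <= d -> `|x4 - x3| <= d ->
  `|x3 - x2| <= d -> x1 - 3 * d <= x4.
Proof. rewrite !ler_norml => /andP[h1 _] /andP[h2 _] /andP[h3 _]; lra. Qed.

Lemma dist2_ge x1 x2 x3 d : `|x2 - x3| <= d -> `|x1 - x2| <= d -> x1 - 2 * d <= x3.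
Proof. rewrite !ler_norml => /andP[_ h1] /andP[_ h2]; lra. Qed.

Lemma dist2_le x1 x2 x3 d : `|x3 - x2| <= d -> `|x2 - x1| <= d -> x3 <= x1 + 2 * d.
Proof. rewrite !ler_norml => /andP[_ h1] /andP[_ h2]; lra. Qed.

Lemma mulB_le_sqr x y X : `|x| <= X -> (x - y) * y <= X ^+ 2.
Proof.
move=> xX; have X0 : 0 <= X by exact: le_trans xX.
have h : x ^+ 2 <= X ^+ 2.
  by rewrite -real_normK ?num_real// ler_pXn2r ?nnegrE.
apply: le_trans h; have h1 := sqr_ge0 (x - y); have h2 := sqr_ge0 x.
have h3 := sqr_ge0 y; nra.
Qed.

(** In [lower_transport], [E'] is the energy of the solution for [A_e], [E] is [A w w], and [k] is
    the penalty [kappa S (u - w) (u - w)]. *)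
Lemma dual_energy_gap p d Lam E E' k : 1 < p -> 0 <= d -> `|E' - E| <= d ->
  E' + p * (E + k - E') <= Lam -> E + p * k <= Lam + p * d.
Proof.
move=> p1 d0; rewrite ler_norml => /andP[_ h1] h2.
have h3 : (p - 1) * (E' - E) <= (p - 1) * d by rewrite ler_wpM2l// subr_ge0 ltW.
nra.
Qed.

Lemma quarter_gap x d : 0 < x -> d <= x / 4 -> 0 < x - 3 * d.
Proof. lra. Qed.

Lemma gap_le_scaled b d Lam E a : E <= a + 2 * d -> d * (2 + 3 * Lam) <= Lam * b - a ->
  E <= Lam * (b - 3 * d).
Proof. move=> h1 h2; nra. Qed.

Lemma gap_le_scaled2 p d Lam Lam' : d * (p + 2 * Lam') <= Lam' - Lam ->
  Lam + p * d <= Lam' * (1 - 2 * d).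
Proof. move=> h; nra. Qed.

End elementary_estimates.

(** * Odd maps between admissible sets *)

Section transports.
Context (R : realType) (n : nat) (n_gt0 : (0 < n)%N) (O : set 'rV[R]_n)
  (oO : open O) (bO : bounded_set O) (p : R) (p1 : 1 < p).
Local Notation mu := (lebesgue_on oO).
Local Notation W := (sobolev0 oO p1).
Implicit Types (u v w z : W).
Let p0 : 0 < p. Proof. exact: lt_trans p1. Qed.

Lemma fun_energy_small v (t : R) : 0 < t -> exists2 r, 0 < r & forall v',
  sobolev0_norm (v' - v) < r ->
  fun_energy (v' - v) <= t /\ grad_energy v' <= 2 `^ p * (grad_energy v + 1).
Proof.
move=> t0; have [C C0 HC] := fun_energy_le_grad n_gt0 oO bO p1.
have [D D0 HD] := grad_energy_le_norm n_gt0 oO p1.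
have m0 : 0 < Num.min 1 (t / C) by rewrite lt_min ltr01 divr_gt0.
have [r r0 Hr] := small_powR p1 (ltW D0) m0.
exists r; first exact: r0.
move=> v' vr.
have /andP[G1 G2] : (grad_energy (v' - v) <= 1) && (grad_energy (v' - v) <= t / C).
  rewrite -le_min; apply: (le_trans (HD _)); apply: le_trans Hr; apply: ler_wpM2l; first exact: ltW.
  by rewrite powR_le ?(ltW p0) ?sobolev0_norm_ge0// ltW.
split; first by apply: (le_trans (HC _)); rewrite mulrC -ler_pdivlMr.
rewrite -{1}(subrK v v') addrC; apply: (le_trans (grad_energyD _ _)).
by rewrite ler_wpM2l ?powR_ge0// lerD2l.
Qed.

Lemma mass_local (rho : 'rV[R]_n -> R) v (d : R) : in_Lspace oO +oo%E rho -> 0 < d ->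
  exists2 r, 0 < r & forall v', sobolev0_norm (v' - v) < r ->
    `|weighted_mass rho v' - weighted_mass rho v| <= d.
Proof.
move=> hr d0; have [_ /finite_normy_bounded[L L0 rL]] := hr.
pose M := 2 `^ p * (grad_energy v + 1) + grad_energy v.
have M0 : 0 <= M.
  by rewrite addr_ge0 ?grad_energy_ge0// mulr_ge0 ?powR_ge0// addr_ge0 ?grad_energy_ge0.
have [t t0 Ht] := mass_small n_gt0 oO bO p1 L0 M0 d0.
have [r r0 Hr] := fun_energy_small v t0.
exists r => // v' vr; have [h1 h2] := Hr v' vr.
apply: (Ht rho hr rL) => //.
  by apply: (le_trans h2); rewrite lerDl grad_energy_ge0.
by rewrite lerDr mulr_ge0 ?powR_ge0// addr_ge0 ?grad_energy_ge0.
Qed.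

Lemma mass_continuous (rho : 'rV[R]_n -> R) v : in_Lspace oO +oo%E rho ->
  {for v, continuous (fun v : W => weighted_mass rho v : R)}.
Proof.
move=> hr; apply/(@cvgrPdist_le _ _ _ (nbhs v) (nbhs_filter v)) => d d0.
have [r r0 Hr] := mass_local v hr d0.
apply/nbhs_ballP; exists r => //= v'; rewrite sobolev0_ballE/= sobolev0_normB => vv'.
by rewrite distrC; exact: Hr.
Qed.

Lemma scale_continuous (c : W -> R) v : {for v, continuous c} ->
  {for v, continuous (fun v => c v *: v)}.
Proof.
move=> cc U /nbhs_ballP[d /= d0 dU].
have c1 : 0 < `|c v| + 1 by rewrite ltr_wpDl.
have n1 : 0 < sobolev0_norm v + 1 by rewrite ltr_wpDl// sobolev0_norm_ge0.
have e0 : 0 < d / 4 / (sobolev0_norm v + 1) by rewrite !divr_gt0.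
have /(@cvgrPdist_le _ _ _ (nbhs v) (nbhs_filter v))/(_ _ e0) nc := cc.
have nb : \forall v' \near v, sobolev0_norm (v - v') < Num.min 1 (d / 4 / (`|c v| + 1)).
  apply/nbhs_ballP; exists (Num.min 1 (d / 4 / (`|c v| + 1))) => //=.
  by rewrite lt_min ltr01 !divr_gt0.
apply: filterS2 nc nb => v' h1; rewrite lt_min => /andP[h2 h3].
apply: dU; rewrite sobolev0_ballE/=.
have -> : c v *: v - c v' *: v' = c v *: (v - v') + (c v - c v') *: v'.
  by rewrite scalerBr scalerBl addrA subrK.
apply: (le_lt_trans (sobolev0_normD _ _)); rewrite !sobolev0_normZ.
have h4 : sobolev0_norm v' <= sobolev0_norm v + 1.
  rewrite -{1}(subrK v v') addrC; apply: (le_trans (sobolev0_normD _ _)).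
  by rewrite lerD2l sobolev0_normB ltW.
apply: (@le_lt_trans _ _ (d / 4 + d / 4)); last by lra.
apply: lerD.
  apply: (@le_trans _ _ ((`|c v| + 1) * (d / 4 / (`|c v| + 1)))).
    by apply: ler_pM => //; [exact: sobolev0_norm_ge0|rewrite lerDl|exact: ltW].
  by rewrite mulrC divfK// gt_eqF.
apply: (@le_trans _ _ (d / 4 / (sobolev0_norm v + 1) * (sobolev0_norm v + 1))).
  by apply: ler_pM => //; exact: sobolev0_norm_ge0.
by rewrite divfK// gt_eqF.
Qed.

Variables (alpha beta : R) (K3 K4 : R -> R) (A_ : R -> W -> W -> R).
Context (hA_ : forall e, 0 < e -> regular_operator (A_ e) alpha beta K3 K4).
Variables (alpha' beta' : R) (K3' K4' : R -> R) (A : W -> W -> R).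
Context (hA : regular_operator A alpha' beta' K3' K4').
Context (GA : forall (f : W -> R) (u_ : R -> W), is_linear f -> bounded_form f ->
  (forall e, 0 < e -> forall z, A_ e (u_ e) z = f z) ->
  exists u, (forall z, A u z = f z) /\
    forall l, is_linear l -> bounded_form l -> l (u_ e) @[e --> 0^'+] --> l u).
Variables (rho_ : R -> 'rV[R]_n -> R) (rho : 'rV[R]_n -> R).
Context (hrho_ : forall e, 0 < e -> in_Lspace oO +oo%E (rho_ e))
  (hrho : in_Lspace oO +oo%E rho) (wrho : weakstar_cvg oO rho_ rho).
Local Notation B_ e := (weighted_mass (rho_ e)).
Local Notation B := (weighted_mass rho).

Let a0 : 0 < alpha. Proof. exact: (op_alpha (hA_ ltr01)). Qed.
Let a'0 : 0 < alpha'. Proof. exact: (op_alpha hA). Qed.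

(** The strict inequality at each point of [C] leaves room for the errors in energy and mass near
    that point; compactness of [C] makes the admissible range of [e] uniform. *)
Lemma upper_transport (Lam : R) (C : set W) : compact C ->
  (forall v, C v -> 0 < B v /\ A v v < Lam * B v) ->
  \forall e \near 0^'+, exists T : W -> W, [/\ continuous T,
    forall v, T (- v) = - T v &
    forall v, C v -> 0 < B_ e (T v) /\ A_ e (T v) (T v) <= Lam * B_ e (T v)].
Proof.
move=> cC HC.
suff : \forall e \near 0^'+, forall v, C v -> forall w, (forall z, A_ e w z = A v z) ->
    0 < B_ e w /\ A_ e w w <= Lam * B_ e w.
  apply: filterS2 (nbhs_right_gt 0) => e e0 He.
  (* With no forms, [T v] solves [A_e (T v) = A v]. *)
  have [T [cT oT TP]] := @solution_map _ _ n_gt0 _ _ bO _ _ _ _ _ _ _ (hA_ e0) 0%N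
    (fun _ _ => 0) 0 (lexx 0)
    (fun i => match i with Ordinal _ h => False_rect _ (notF h) end)
    (fun i => match i with Ordinal _ h => False_rect _ (notF h) end) A
    (op_linear hA) (op_bounded n_gt0 hA) (op_odd hA) (op_continuous n_gt0 hA).
  exists T; split; [exact: cT|exact: oT|].
  move=> v Cv; apply: (He v Cv) => z.
  by rewrite -TP mul0r addr0.
apply: (@compact_local_uniform R W C (fun e v => forall w,
  (forall z, A_ e w z = A v z) -> 0 < B_ e w /\ A_ e w w <= Lam * B_ e w) cC).
move=> v Cv; have [b0 gap] := HC v Cv.
have E0 := op_energy_ge0 hA v.
have Lam0 : 0 < Lam by rewrite -(pmulr_lgt0 Lam b0) (le_lt_trans E0).
have gap0 : 0 < Lam * B v - A v v by rewrite subr_gt0.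
have L23 : 0 < 2 + 3 * Lam by rewrite addr_gt0// mulr_gt0.
(* Below, the mass drops by at most [3 d] and the energy rises by at most [2 d]. The first entry
   keeps [B v - 3 d] positive, the second ensures [A v v + 2 d <= Lam (B v - 3 d)]. *)
pose d := Num.min (B v / 4) ((Lam * B v - A v v) / (2 + 3 * Lam)).
have d0 : 0 < d by rewrite lt_min !divr_gt0.
have /andP[db dg] : (d <= B v / 4) && (d * (2 + 3 * Lam) <= Lam * B v - A v v).
  by rewrite -ler_pdivlMr// -le_min.
clearbody d.
have [_ /finite_normy_bounded[L L0 rL]] := hrho.
pose E2 := A v v + 2 * d.
have E20 : 0 <= E2 by rewrite addr_ge0// mulr_ge0// ltW.
pose M := E2 / alpha + E2 / alpha'.
have Ma : 0 <= E2 / alpha by rewrite divr_ge0// ltW.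
have Ma' : 0 <= E2 / alpha' by rewrite divr_ge0// ltW.
have M0 : 0 <= M by rewrite addr_ge0.
have [t t0 Ht] := mass_small n_gt0 oO bO p1 L0 M0 d0.
have m0 : 0 < Num.min d t by rewrite lt_min d0.
have [r1 r10 nG] := G_local n_gt0 bO hA_ hA GA v m0.
have [r2 r20 Hr2] := op_continuous n_gt0 hA v r10.
have [r3 r30 Hr3] := op_energy_continuous n_gt0 hA v d0.
have [r4 r40 Hr4] := mass_local v hrho d0.
exists (Num.min r2 (Num.min r3 r4)); first by rewrite !lt_min r20 r30.
apply: filterS3 (nbhs_right_gt 0) nG (mass_uniform_cvg n_gt0 bO p1 hrho_ hrho wrho M0 d0).
move=> e e0 He HB v'; rewrite sobolev0_ballE/= sobolev0_normB !lt_min => /and3P[v2 v3 v4].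
move=> w wv'.
have [h1 /le_trans h2] := He v' w (fun z => Hr2 v' z v2) wv'.
have {}h1 : `|A_ e w w - A v' v'| <= d by rewrite (le_trans h1)// ge_min lexx.
have {}h2 : fun_energy (w - v') <= t by apply: h2; rewrite ge_min lexx orbT.
have h3 := Hr3 v' v3; have h4 := Hr4 v' v4.
have Ew : A_ e w w <= E2.
  exact: dist2_le h1 h3.
have Ev' : A v' v' <= E2.
  rewrite /E2 mulr_natl mulr2n addrA ler_wpDr ?(ltW d0)// addrC -lerBlDr.
  exact: le_trans (ler_norm _) h3.
have Gw : grad_energy w <= M.
  apply: (@le_trans _ _ (E2 / alpha)); last by rewrite lerDl.
  by rewrite ler_pdivlMr// mulrC (le_trans (op_coercive (hA_ e0) w)).
have Gv' : grad_energy v' <= M.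
  apply: (@le_trans _ _ (E2 / alpha')); last by rewrite lerDr.
  by rewrite ler_pdivlMr// mulrC (le_trans (op_coercive hA v')).
have h5 := HB w Gw.
have h6 := Ht rho hrho rL w v' Gw Gv' h2.
have h7 : B v - 3 * d <= B_ e w.
  exact: dist3_ge h4 h5 h6.
split; first exact: lt_le_trans (quarter_gap b0 db) h7.
apply: le_trans (ler_wpM2l (ltW Lam0) h7).
exact: gap_le_scaled Ew dg.
Qed.

(* An admissible u for A_e, normalised by B_e u = 1, is sent to the solution w of
   A w + kappa sum_i l_i(w) l_i = kappa sum_i l_i(u) l_i. With f = A w and
   A_e v = f, convexity of the energy of A_e at v gives
   A_e u u >= A_e v v + p f(u - v), whose right-hand side is close to
   A w w + p kappa sum_i l_i(u - w)^2. Hence w has almost the energy of u, and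
   for large kappa it is close to u in L^p. As f ranges over a compact set of
   combinations of the l_i, this is uniform in u. *)
Lemma lower_transport (Lam Lam' : R) : 0 <= Lam -> Lam < Lam' ->
  \forall e \near 0^'+, exists T : W -> W, (forall u, T (- u) = - T u) /\
    forall C : set W, (forall u, C u -> 0 < B_ e u /\ A_ e u u <= Lam * B_ e u) ->
      {within C, continuous T} /\
      forall u, C u -> 0 < B (T u) /\ A (T u) (T u) <= Lam' * B (T u).
Proof.
move=> Lam0 LL'.
have Lam'0 : 0 < Lam' by exact: le_lt_trans LL'.
have q0 : 0 < p + 2 * Lam' by rewrite addr_gt0// mulr_gt0.
have dL0 : 0 < Lam' - Lam by rewrite subr_gt0.
(* The image of a normalised [u] will have mass at least [1 - 2 d] and energy at most [Lam + p d];
   the second entry ensures [Lam + p d <= Lam' (1 - 2 d)]. *)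
pose d := Num.min 4^-1 ((Lam' - Lam) / (p + 2 * Lam')).
have d0 : 0 < d by rewrite lt_min invr_gt0 ltr0n divr_gt0.
have /andP[d4 dL] : (d <= 4^-1) && (d * (p + 2 * Lam') <= Lam' - Lam).
  by rewrite -ler_pdivlMr// -le_min.
clearbody d.
pose E1 := Lam + p * d.
have E10 : 0 <= E1 by rewrite addr_ge0// mulr_ge0// ltW.
pose M1 := Lam / alpha; pose M2 := E1 / alpha'.
have M10 : 0 <= M1 by rewrite divr_ge0// ltW.
have M20 : 0 <= M2 by rewrite divr_ge0// ltW.
have M0 : 0 <= M1 + M2 by rewrite addr_ge0.
have [_ /finite_normy_bounded[L L0 rL]] := hrho.
have [t t0 Ht] := mass_small n_gt0 oO bO p1 L0 M0 d0.
pose D := 2 `^ p * (M1 + M2) + 1.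
have D0 : 0 < D by rewrite ltr_wpDl// mulr_ge0// powR_ge0.
have t20 : 0 < t / 2 by rewrite divr_gt0.
have eta0 : 0 < t / 2 / D by rewrite divr_gt0.
have [m [l [K' [K'0 ll bl HE]]]] := ehrling n_gt0 oO bO p1 eta0.
have [s s0 Hs] := small_powR p1 (mulr_ge0 K'0 (ler0n _ m)) t20.
have ps0 : 0 < p * s ^+ 2 by rewrite mulr_gt0// exprn_gt0.
(* The energy inequality will bound [p kappa S (u - w) (u - w)] by [E1]; this value of [kappa] then
   forces [S (u - w) (u - w) <= s^2], the closeness required by the Ehrling inequality. *)
pose kappa := (E1 + 1) / (p * s ^+ 2).
have k0 : 0 < kappa by rewrite divr_gt0// ltr_wpDl.
have kE : p * kappa * s ^+ 2 = E1 + 1.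
  by rewrite /kappa; field; rewrite !gt_eqF.
clearbody kappa.
pose S w z := \sum_i l i w * l i z.
have lS w : is_linear (S w).
  move=> c u v; rewrite /S mulr_sumr -big_split/=; apply: eq_bigr => i _.
  by rewrite ll; ring.
have S_sym w z : S w z = S z w by apply: eq_bigr => i _; rewrite mulrC.
have S_ge0 w : 0 <= S w w by apply: sumr_ge0 => i _; rewrite -expr2 sqr_ge0.
have bS w : bounded_form (S w) by exact: bounded_form_S.
have bkS w : bounded_form (fun z => kappa * S w z).
  have [k kge0 Hk] := bS w; exists (kappa * k); first by rewrite mulr_ge0// ltW.
  move=> z; rewrite normrM (gtr0_norm k0) -mulrA; apply: ler_wpM2l => //.
  exact: ltW.
have /choice[kf kfP] : forall i, exists k, 0 <= k /\ forall u, `|l i u| <= k * sobolev0_norm u.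
  by move=> i; have [k kge0 h] := bl i; exists k.
pose kk := \sum_i kf i.
have kk0 : 0 <= kk by apply: sumr_ge0 => i _; exact: (kfP i).1.
have kkl i u : `|l i u| <= kk * sobolev0_norm u.
  apply: (le_trans ((kfP i).2 u)); apply: ler_wpM2r; first exact: sobolev0_norm_ge0.
  by rewrite /kk (bigD1 i)//= lerDl sumr_ge0// => j _; exact: (kfP j).1.
have comb_le (c : 'I_m -> R) (X : R) z : (forall i, `|c i| <= X) ->
    `|\sum_i c i * l i z| <= X * (m%:R * kk) * sobolev0_norm z.
  move=> cX; apply: (le_trans (ler_norm_sum _ _ _)).
  apply: (@le_trans _ _ (\sum_(i < m) (X * (kk * sobolev0_norm z)))).
    by apply: ler_sum => i _; rewrite normrM; apply: ler_pM.
  by rewrite sumr_const card_ord -mulr_natl; lra.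
have [J [cJ oJ JP]] : exists T : W -> W, [/\ continuous T, forall v, T (- v) = - T v &
    forall v z, A (T v) z + kappa * S (T v) z = kappa * S v z].
  apply: (solution_map n_gt0 bO hA (ltW k0) ll bl (g := fun v z => kappa * S v z)).
  - by move=> v c x y; rewrite lS; ring.
  - exact: bkS.
  - by move=> v z; rewrite S_sym (is_linearN _ (lS z)) S_sym mulrN.
  - move=> v e e0; pose Q := kappa * kk * (m%:R * kk) + 1.
    have Q0 : 0 < Q by rewrite ltr_wpDl// !mulr_ge0// ltW.
    exists (e / Q); first exact: divr_gt0.
    move=> v' z vr.
    have -> : kappa * S v' z - kappa * S v z = \sum_i (kappa * l i (v' - v)) * l i z.
      rewrite -mulrBr ![S _ z]S_sym -(is_linearB _ _ (lS z)) S_sym /S mulr_sumr.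
      by apply: eq_bigr => i _; rewrite mulrA.
    have lc i : `|kappa * l i (v' - v)| <= kappa * (kk * sobolev0_norm (v' - v)).
      by rewrite normrM (gtr0_norm k0); apply: ler_wpM2l; [exact: ltW|exact: kkl].
    apply: (le_trans (comb_le _ _ z lc)).
    apply: ler_wpM2r; first exact: sobolev0_norm_ge0.
    move: vr; rewrite ltr_pdivlMr// => /ltW; apply: le_trans.
    have -> : kappa * (kk * sobolev0_norm (v' - v)) * (m%:R * kk) =
      sobolev0_norm (v' - v) * (kappa * kk * (m%:R * kk)) by ring.
    apply: ler_wpM2l; first exact: sobolev0_norm_ge0.
    by rewrite lerDl.
have [Y1 Y10 HY1] := norm_le_of_grad_energy n_gt0 oO bO p1 M1.
have [X1 X10 HX1] := forms_bounded Y10 bl.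
(* A preliminary bound on [w], possibly large with [kappa] but independent of [u] and [e]: in
   [A w w = kappa S (u - w) w] each summand [(l_i u - l_i w) l_i w] is at most [X1^2]. It confines
   the coefficients [kappa l_i (u - w)] to the box of radius [Z]. *)
have [Y3 Y30 HY3] := norm_le_of_grad_energy n_gt0 oO bO p1 (kappa * (m%:R * X1 ^+ 2) / alpha').
have [X3 X30 HX3] := forms_bounded Y30 bl.
pose Z := kappa * (X1 + X3).
(* The right-hand sides are parametrised by a compact box of R^m, so local uniformity in the
   right-hand side becomes uniformity for all of them. *)
have near_c : \forall e \near 0^'+, forall c : 'rV[R]_m, (forall i, `|c 0 i| <= Z) ->
    forall w v', (forall z, A w z = \sum_i c 0 i * l i z) ->
      (forall z, A_ e v' z = A w z) -> `|A_ e v' v' - A w w| <= d.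
  apply: (@compact_local_uniform R 'rV[R]_m _ (fun e (c : 'rV[R]_m) => forall w v',
    (forall z, A w z = \sum_i c 0 i * l i z) ->
      (forall z, A_ e v' z = A w z) -> `|A_ e v' v' - A w w| <= d)).
    exact: box_compact.
  move=> c _.
  have lc : is_linear (fun z => \sum_i c 0 i * l i z).
    move=> a x y; rewrite mulr_sumr -big_split/=; apply: eq_bigr => i _.
    by rewrite ll; ring.
  have bc : bounded_form (fun z => \sum_i c 0 i * l i z).
    pose X := \sum_i `|c 0 i|.
    have X0 : 0 <= X by apply: sumr_ge0.
    exists (X * (m%:R * kk)); first by rewrite !mulr_ge0.
    move=> z; apply: comb_le => i; rewrite /X (bigD1 i)//= lerDl.
    by apply: sumr_ge0.
  have [vc Hvc] := op_solve n_gt0 bO hA lc bc.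
  have [r r0 nG] := G_local n_gt0 bO hA_ hA GA vc d0.
  have Q0 : 0 < m%:R * kk + 1 by rewrite ltr_wpDl// mulr_ge0.
  exists (r / (m%:R * kk + 1)); first exact: divr_gt0.
  apply: filterS nG => e nG c' [_ cc'] w v' wc v'w.
  apply: (nG w v' _ v'w).1 => z.
  have -> : A w z - A vc z = \sum_i (c' 0 i - c 0 i) * l i z.
    by rewrite wc Hvc -sumrB; apply: eq_bigr => i _; rewrite mulrBl.
  apply: (le_trans (comb_le (fun i => c' 0 i - c 0 i) (r / (m%:R * kk + 1)) z _)).
    by move=> i; rewrite distrC ltW//; exact: cc'.
  apply: ler_wpM2r; first exact: sobolev0_norm_ge0.
  rewrite mulrAC ler_pdivrMr//; apply: ler_wpM2l; first exact: ltW.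
  by rewrite lerDl.
apply: filterS3 (nbhs_right_gt 0) near_c
  (mass_uniform_cvg n_gt0 bO p1 hrho_ hrho wrho M10 d0) => e e0 Hc HB.
pose N u := B_ e u `^ (- p^-1) *: u.
exists (J \o N); split.
  by move=> u /=; rewrite /N massN scalerN oJ.
(* The normalising factor is continuous only where [B_e] is positive, hence continuity within
   [C]. *)
move=> C HC; split.
  apply: continuous_in_subspaceT => u /set_mem Cu.
  apply: continuous_comp; last exact: cJ.
  apply: scale_continuous.
  apply: (@continuous_comp _ _ _ (fun u : W => B_ e u : R) (fun x : R => x `^ (- p^-1))).
    by apply: mass_continuous; exact: hrho_.
  by apply: powR_continuous_pos; exact: (HC u Cu).1.
move=> u0 Cu0 /=; have [Bu0 Eu0] := HC u0 Cu0.
set u := N u0; set w := J u.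
have cp : `|B_ e u0 `^ (- p^-1)| `^ p = (B_ e u0)^-1.
  by rewrite ger0_norm ?powR_ge0// -powRrM mulNr mulVf ?lt0r_neq0// powR_inv1// ltW.
have Bu : B_ e u = 1.
  by rewrite /u /N massZ ?cp ?mulVf ?gt_eqF//; exact: hrho_.
have Eu : A_ e u u <= Lam.
  by rewrite /u /N (op_hom (hA_ e0)) cp ler_pdivrMl// mulrC.
have Gu : grad_energy u <= M1.
  by rewrite ler_pdivlMr// mulrC (le_trans (op_coercive (hA_ e0) u)).
clearbody u.
have Aw z : A w z = kappa * S (u - w) z.
  rewrite ![S _ z]S_sym (is_linearB _ _ (lS z)) ![S z _]S_sym.
  by rewrite mulrBr -JP addrK.
clearbody w.
have lu i := HX1 u (HY1 u Gu) i.
have Gw3 : grad_energy w <= kappa * (m%:R * X1 ^+ 2) / alpha'.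
  rewrite ler_pdivlMr// mulrC; apply: (le_trans (op_coercive hA w)).
  rewrite Aw; apply: ler_wpM2l; first exact: ltW.
  rewrite mulr_natl -[m in leRHS]card_ord -sumr_const /S; apply: ler_sum => i _.
  rewrite (is_linearB _ _ (ll i)); exact: mulB_le_sqr.
have lw i := HX3 w (HY3 w Gw3) i.
have [ve Hve] := op_solve n_gt0 bO (hA_ e0) (op_linear hA w) (op_bounded n_gt0 hA w).
have Ed : `|A_ e ve ve - A w w| <= d.
  apply: (Hc (\row_i (kappa * l i (u - w)))) => //.
    move=> i; rewrite mxE normrM (gtr0_norm k0); apply: ler_wpM2l; first exact: ltW.
    rewrite (is_linearB _ _ (ll i)) (le_trans (ler_normB _ _))//.
    by apply: lerD.
  move=> z; rewrite Aw /S mulr_sumr; apply: eq_bigr => i _.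
  by rewrite mxE mulrA.
have key : A w w + p * kappa * S (u - w) (u - w) <= E1.
  have := op_subgradient (hA_ e0) ve u.
  rewrite (is_linearB _ _ (op_linear (hA_ e0) ve)) !Hve.
  have -> : A w u = A w w + kappa * S (u - w) (u - w).
    by rewrite -Aw (is_linearB _ _ (op_linear hA w)) addrC subrK.
  have -> : A w ve = A_ e ve ve by rewrite Hve.
  move=> /le_trans/(_ Eu); rewrite -mulrA.
  exact: dual_energy_gap p1 (ltW d0) Ed.
have Ew0 := op_energy_ge0 hA w.
have Sge := S_ge0 (u - w).
have Ew : A w w <= E1.
  by apply: le_trans key; rewrite lerDl !mulr_ge0// ltW.
have Gw : grad_energy w <= M2.
  by rewrite ler_pdivlMr// mulrC (le_trans (op_coercive hA w)).
have Ssmall : S (u - w) (u - w) <= s ^+ 2.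
  have pk : 0 < p * kappa by rewrite mulr_gt0.
  rewrite -(ler_pM2l pk) kE; apply: ler_wpDr; first exact: ler01.
  by apply: le_trans key; rewrite lerDr.
have fuw : fun_energy (u - w) <= t.
  apply: (le_trans (HE _)); rewrite [leRHS]splitr; apply: lerD.
    apply: (@le_trans _ _ (t / 2 / D * D)); last by rewrite divfK// gt_eqF.
    apply: ler_wpM2l; first exact: ltW.
    apply: (le_trans (grad_energyD _ _)); rewrite grad_energyN.
    rewrite /D; apply: ler_wpDr; first exact: ler01.
    by apply: ler_wpM2l; [exact: powR_ge0|exact: lerD].
  apply: le_trans Hs; rewrite -mulrA; apply: ler_wpM2l => //.
  apply: (@le_trans _ _ (\sum_(i < m) s `^ p)); last first.
    by rewrite sumr_const card_ord mulr_natl.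
  apply: ler_sum => i _; apply: powR_le; [exact: ltW|exact: normr_ge0|].
  rewrite -(ger0_norm (ltW s0)) -ler_sqr ?nnegrE// !real_normK ?num_real//.
  apply: le_trans Ssmall; rewrite /S (bigD1 i)//= -expr2 lerDl.
  by apply: sumr_ge0 => j _; rewrite -expr2 sqr_ge0.
have GuM : grad_energy u <= M1 + M2 by rewrite (le_trans Gu)// lerDl.
have GwM : grad_energy w <= M1 + M2 by rewrite (le_trans Gw)// lerDr.
have h1 := Ht rho hrho rL u w GuM GwM fuw.
have h2 := HB u Gu; rewrite Bu in h2.
have Bw : 1 - 2 * d <= B w.
  exact: dist2_ge h1 h2.
split; last first.
  apply: (le_trans Ew); apply: le_trans (ler_wpM2l (ltW Lam'0) Bw).
  exact: gap_le_scaled2.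
apply: lt_le_trans Bw; rewrite subr_gt0 (le_lt_trans (ler_wpM2l _ d4))//.
by rewrite ltr_pdivrMr// mul1r ltr_nat.
Qed.

End transports.

(** * Convergence of the eigenvalues *)

(** With real thresholds on both sides, finite limits and the limit [+oo] are treated alike. *)
Lemma ereal_cvg_of_bounds (R : realType) (f : R -> \bar R) (l : \bar R) :
  (0 <= l)%E ->
  (forall Lam : R, (l < Lam%:E)%E -> \forall e \near 0^'+, (f e <= Lam%:E)%E) ->
  (forall Lam : R, (Lam%:E < l)%E -> \forall e \near 0^'+, (Lam%:E <= f e)%E) ->
  f e @[e --> 0^'+] --> l.
Proof.
case: l => [r _ up lo| _ _ lo|//]; last first.
  by apply/cvgeyPge => Lam; apply: lo; exact: ltry.
have bounds d : 0 < d -> \forall e \near 0^'+, ((r - d)%:E <= f e <= (r + d)%:E)%E.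
  move=> d0; have h1 : ((r - d)%:E < r%:E)%E by rewrite lte_fin gtrBl.
  have h2 : (r%:E < (r + d)%:E)%E by rewrite lte_fin ltrDl.
  by apply: filterS2 (lo _ h1) (up _ h2) => e -> ->.
apply/fine_cvgP; split.
  apply: filterS (bounds _ ltr01) => e /andP[h1 h2].
  by rewrite fin_numE; apply/andP; split; apply/eqP => E; rewrite E ?leeNy_eq ?leye_eq in h1 h2.
apply/cvgrPdist_le => d d0; apply: filterS (bounds d d0) => e /=.
case: (f e) => [x| |]; rewrite ?leye_eq ?leeNy_eq ?andbF//= !lee_fin => /andP[h1 h2].
by rewrite ler_norml; apply/andP; split; lra.
Qed.

(** * Genus under odd maps *)

Section genus_classes.
Context (R : realType) (n : nat) (O : set 'rV[R]_n) (oO : open O) (p : R) (p1 : 1 < p).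
Local Notation W := (sobolev0 oO p1).
Implicit Types (u v : W) (C : set W) (rho : 'rV[R]_n -> R).

(** An odd nonvanishing map on the image of [C] pulls back to [C] by composition with [T]. *)
Lemma genus_image C (T : W -> W) : {within C, continuous T} ->
  (forall u, T (- u) = - T u) -> (genus C <= genus (T @` C))%E.
Proof.
move=> cT oT; apply: ereal_inf_le_tmp => _ [k [f [cf fN f0]] <-].
exists k => //; exists (f \o T); split.
- apply/subspace_continuousP => x Cx U nU.
  move/subspace_continuousP : cf => /(_ (T x)) cf.
  have TCx : (T @` C) (T x) by exists x.
  have := cf TCx U nU; rewrite /nbhs/= /within/= => nV.
  move/subspace_continuousP : cT => /(_ x Cx) cT.
  have := cT _ nV; rewrite /nbhs/= /within/=.
  by apply: filterS => y /= h Cy; apply: h => //; exists y.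
- by move=> u Cu /=; rewrite oT fN//; exists u.
- by move=> u Cu /=; apply: f0; exists u.
Qed.

Lemma genus_class_image rho rho' (k : nat) C (T : W -> W) :
  genus_class rho k C -> {within C, continuous T} -> (forall u, T (- u) = - T u) ->
  (forall u, C u -> 0 < weighted_mass rho' (T u)) -> genus_class rho' k (T @` C).
Proof.
move=> [cC sC _ gC] cT oT TB; split.
- exact: continuous_compact.
- apply/seteqP; split => [_ [_ [u Cu <-] <-]|_ [u Cu <-]].
    by exists (- u) => //; rewrite -sC; exists u.
  have : [set - u | u in C] u by rewrite sC.
  by move=> [v Cv <-]; exists (T v); [exists v|rewrite oT].
- by move=> _ [u Cu <-]; exact: TB.
- by apply: (le_trans gC); exact: genus_image.
Qed.

(** On the empty set the constant map into R^0 satisfies all the conditions, so its genus is 0. *)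
Lemma genus_class_nonempty rho (k : nat) C : (0 < k)%N -> genus_class rho k C ->
  exists u, C u.
Proof.
move=> k0 [_ _ _ gC]; apply: contrapT => nC.
have C0 : C = set0 by apply/seteqP; split => // u Cu; apply: nC; exists u.
have : (genus C <= 0%:R%:E)%E.
  apply: ereal_inf_lbound; exists 0%N => //; exists (fun=> 0); split.
  - by apply: continuous_subspaceT => x; exact: cst_continuous.
  - by move=> u; rewrite C0.
  - by move=> u; rewrite C0.
move=> /(le_trans gC); rewrite lee_fin ler_nat leqNgt k0//.
Qed.

End genus_classes.

(** * The eigenvalues in terms of energy forms *)

Section eigenvalues.
Context (R : realType) (n : nat) (O : set 'rV[R]_n) (oO : open O) (p : R) (p1 : 1 < p).
Local Notation W := (sobolev0 oO p1).
Implicit Types (u v : W) (C : set W).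
Context (a : 'rV[R]_n -> 'rV[R]_n -> 'rV[R]_n) (alpha beta c : R).
Context (sa : structure_conditions oO p a alpha beta c).
Variables (rho : 'rV[R]_n -> R) (k : nat).
Context (k_gt0 : (0 < k)%N).

Lemma lambda_plus_lt (Lam : R) : (lambda_plus oO p1 a rho k < Lam%:E)%E ->
  exists2 C, genus_class rho k C & forall v, C v ->
    0 < weighted_mass rho v /\ form_of a v v < Lam * weighted_mass rho v.
Proof.
move=> /ereal_inf_lt[_ [C gC <-] CL]; exists C => // v Cv.
have Bv : 0 < weighted_mass rho v by have [_ _ h _] := gC; exact: h.
split => //; rewrite -ltr_pdivrMr// -(energy_potential sa) -lte_fin.
by apply: le_lt_trans CL; apply: ereal_sup_ubound; exists v.
Qed.

Lemma lambda_plus_le (Lam : R) C : genus_class rho k C ->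
  (forall v, C v -> 0 < weighted_mass rho v /\
    form_of a v v <= Lam * weighted_mass rho v) ->
  (lambda_plus oO p1 a rho k <= Lam%:E)%E.
Proof.
move=> gC CL; apply: (@le_trans _ _ (ereal_sup
  [set (energy (potential oO p a) v / weighted_mass rho v)%:E | v in C])).
  by apply: ereal_inf_lbound; exists C.
apply: ge_ereal_sup => _ [v Cv <-]; have [B0 h] := CL v Cv.
by rewrite lee_fin ler_pdivrMr// (energy_potential sa).
Qed.

Lemma lambda_plus_ge0 : (0 <= lambda_plus oO p1 a rho k)%E.
Proof.
have [a0 b0 c0] := sc_pos sa.
have [K3 [K4 HK]] := structure_operator oO p1 a0 b0 c0.
apply: le_ereal_inf_tmp => _ [C gC <-].
have [v Cv] := genus_class_nonempty k_gt0 gC.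
apply: ereal_sup_ge; exists (energy (potential oO p a) v / weighted_mass rho v)%:E.
  by exists v.
have [_ _ h _] := gC.
rewrite lee_fin divr_ge0 ?(ltW (h v Cv))// (energy_potential sa).
exact: (op_energy_ge0 (HK a sa)).
Qed.

(** No function has positive mass for a nonpositive weight, and nonempty admissible sets would
    contain one: the infimum is over the empty family. *)
Lemma lambda_plus_pinfty : in_Lspace oO +oo%E rho -> {ae lebesgue_on oO, forall x, rho x <= 0} ->
  lambda_plus oO p1 a rho k = +oo%E.
Proof.
move=> hr r0; rewrite /lambda_plus (_ : genus_class rho k = set0) ?image_set0 ?ereal_inf0//.
apply/seteqP; split => // C gC.
have [v Cv] := genus_class_nonempty k_gt0 gC; have [_ _ h _] := gC.
have := h v Cv; rewrite /Mplus/= ltNge => /negP; apply.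
have : 0 <= (\int[lebesgue_on oO]_x (- (rho x * `|sobolev0_fun v x| `^ p)))%R.
  by apply: Rint_ge0; apply: filterS r0 => x rx; rewrite oppr_ge0 mulr_le0_ge0 ?powR_ge0.
by rewrite (RintN (mass_integrable v hr)) oppr_ge0.
Qed.

End eigenvalues.

(** The constant family of right-hand sides converges strongly, with dual distance 0, so [G_cvg]
    applies to it. *)
Lemma G_cvg_forms (R : realType) (n : nat) (O : set 'rV[R]_n) (oO : open O)
    (p : R) (p1 : 1 < p) (alpha beta c : R)
    (a_ : R -> 'rV[R]_n -> 'rV[R]_n -> 'rV[R]_n) a :
  (forall e, 0 < e -> structure_conditions oO p (a_ e) alpha beta c) ->
  G_cvg oO p1 a_ a ->
  forall (f : sobolev0 oO p1 -> R) (u_ : R -> sobolev0 oO p1),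
    is_linear f -> bounded_form f ->
    (forall e, 0 < e -> forall z, form_of (a_ e) (u_ e) z = f z) ->
  exists u, (forall z, form_of a u z = f z) /\
    forall l, is_linear l -> bounded_form l -> l (u_ e) @[e --> 0^'+] --> l u.
Proof.
move=> sa_ Ga f u_ lf bf uf; have [F FE] := linear_form lf.
have bF : dual_sobolev F by apply: bounded_form_dual; rewrite FE.
have [|||u [[_ uF] uw _]] := Ga F (fun=> F) u_ bF.
- by move=> e _.
- rewrite /dual_strong_cvg (_ : (fun _ => _) = cst 0%E); first exact: cvg_cst.
  apply/funext => e /=; apply/eqP; rewrite eq_le; apply/andP; split.
    by apply: dual_norm_le => // v; rewrite subrr normr0 mul0r.
  apply: ereal_sup_ubound; exists 0; rewrite /= ?sobolev0_norm0 ?ler01//.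
  by rewrite subrr normr0.
- move=> e e0; split; first exact: (flux_vLspace (sa_ e e0)).
  by move=> v; rewrite FE; exact: uf.
exists u; split; first by move=> z; rewrite -FE; exact: uF.
move=> l ll bl; have [G GE] := linear_form ll.
by have := uw G; rewrite -GE; apply; apply: bounded_form_dual; rewrite GE.
Qed.

Theorem theorem1p1 (R : realType) (N : nat) (N_gt0 : (0 < N)%N)
  (p : R) (p1 : 1 < p)
  (Omega : set 'rV[R]_N) (oOmega : open Omega) (bOmega : bounded_set Omega)
  (alpha beta c : R) (a_ : R -> 'rV[R]_N -> 'rV[R]_N -> 'rV[R]_N)
  (ha_ : forall e, 0 < e ->
    structure_conditions oOmega p (a_ e) alpha beta c)
  (a : 'rV[R]_N -> 'rV[R]_N -> 'rV[R]_N)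
  (ha : exists alpha' beta' c', structure_conditions oOmega p a alpha' beta' c')
  (Ga : G_cvg oOmega p1 a_ a)
  (rho_ : R -> 'rV[R]_N -> R) (rho : 'rV[R]_N -> R)
  (hrho_ : forall e, 0 < e ->
    [/\ in_Lspace oOmega +oo%E (rho_ e),
        ~ {ae lebesgue_on oOmega, forall x, rho_ e x <= 0} &
        ~ {ae lebesgue_on oOmega, forall x, 0 <= rho_ e x}])
  (hrho : in_Lspace oOmega +oo%E rho)
  (wrho : weakstar_cvg oOmega rho_ rho)
  (k : nat) (k_gt0 : (0 < k)%N) :
  ({ae lebesgue_on oOmega, forall x, rho x <= 0} ->
    lambda_plus oOmega p1 (a_ e) (rho_ e) k @[e --> 0^'+] --> +oo%E) /\
  (~ {ae lebesgue_on oOmega, forall x, rho x <= 0} ->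
    lambda_plus oOmega p1 (a_ e) (rho_ e) k @[e --> 0^'+] -->
      lambda_plus oOmega p1 a rho k).
Proof.
have [alpha' [beta' [c' sa]]] := ha.
have [a0 b0 c0] := sc_pos (ha_ _ ltr01).
have [a'0 b'0 c'0] := sc_pos sa.
have [K3 [K4 HK]] := structure_operator oOmega p1 a0 b0 c0.
have [K3' [K4' HK']] := structure_operator oOmega p1 a'0 b'0 c'0.
have hA_ e : 0 < e -> regular_operator (@form_of R N Omega oOmega p p1 (a_ e)) alpha beta K3 K4.
  by move=> e0; apply: HK; exact: ha_.
have hA := HK' a sa.
have GA := G_cvg_forms ha_ Ga.
have hr_ e : 0 < e -> in_Lspace oOmega +oo%E (rho_ e) by move=> /hrho_[].
suff cvg : lambda_plus oOmega p1 (a_ e) (rho_ e) k @[e --> 0^'+] -->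
    lambda_plus oOmega p1 a rho k.
  by split => // r0; rewrite -(lambda_plus_pinfty p1 a k_gt0 hrho r0).
apply: ereal_cvg_of_bounds.
- exact: (lambda_plus_ge0 p1 sa rho k_gt0).
- move=> Lam /(lambda_plus_lt sa)[C gC CL].
  have [cC _ _ _] := gC.
  have := upper_transport N_gt0 bOmega hA_ hA GA hr_ hrho wrho cC CL.
  apply: filterS2 (nbhs_right_gt 0) => e e0 [T [cT oT TC]].
  apply: (lambda_plus_le (ha_ e e0) (C := T @` C)).
    apply: (genus_class_image gC) => //; first exact: continuous_subspaceT.
    by move=> u Cu; exact: (TC u Cu).1.
  by move=> _ [u Cu <-]; exact: TC.
(* [lower_transport] starts from [0 <= Lam]; a negative bound is immediate since the eigenvalues are
   nonnegative. *)
- move=> Lam LamL; have [Lam0|Lam0] := ltP Lam 0.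
    apply: filterS (nbhs_right_gt 0) => e e0.
    apply: (@le_trans _ _ 0%E); first by rewrite lee_fin ltW.
    exact: (lambda_plus_ge0 p1 (ha_ e e0) (rho_ e) k_gt0).
  (* A level strictly between [Lam] and the limit eigenvalue: a set admissible below [Lam] for [A_e]
     would be transported to one at level [Lam'] for [A], which is impossible. *)
  have [Lam' LL' L'l] : exists2 Lam' : R, Lam < Lam' &
      (Lam'%:E < lambda_plus oOmega p1 a rho k)%E.
    move: LamL; case: (lambda_plus _ _ _ _ _) => [r| |//]; last first.
      by move=> _; exists (Lam + 1); [rewrite ltrDl|exact: ltry].
    rewrite lte_fin => Lr; exists ((Lam + r) / 2); rewrite ?lte_fin; lra.
  have := lower_transport N_gt0 bOmega hA_ hA GA hr_ hrho wrho Lam0 LL'.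
  apply: filterS2 (nbhs_right_gt 0) => e e0 [T [oT HT]].
  rewrite leNgt; apply/negP => /(lambda_plus_lt (ha_ e e0))[C gC CL].
  have [cT TC] := HT C (fun u Cu => conj (CL u Cu).1 (ltW (CL u Cu).2)).
  have := lambda_plus_le sa (C := T @` C) (Lam := Lam') (rho := rho) (k := k).
  rewrite leNgt L'l => h; have : false; last by [].
  apply: h; last by move=> _ [u Cu <-]; exact: TC.
  by apply: (genus_class_image gC) => // u Cu; exact: (TC u Cu).1.
Qed.
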